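(* Let $k\ge 1$ and $\mathbf{a}=(a_1,\dots,a_k)\in\mathbb{N}^k$. The sum $P_{5,\mathbf{a}}$ is universal over $\mathbb{N}_0$ if and only if it represents each of the integers $$1,2,3,4,6,7,8,9,11,13,14,17,18,19,23,28,31,33,34,39,42,63$$ over $\mathbb{N}_0$.
   Context: $\mathbb{N}=\{1,2,3,\dots\}$ and $\mathbb{N}_0=\mathbb{N}\cup\{0\}$. A pentagonal number is $P_5(x)=\frac{3x^2-x}{2}$ with $x\in\mathbb{N}_0$. For $\mathbf{a}=(a_1,\dots,a_k)\in\mathbb{N}^k$ and $\mathbf{x}=(x_1,\dots,x_k)$, put $P_{5,\mathbf{a}}(\mathbf{x})=\sum_{i=1}^k a_iP_5(x_i)$. An integer $N$ is represented by $P_{5,\mathbf{a}}$ over $\mathbb{N}_0$ if $P_{5,\mathbf{a}}(\mathbf{x})=N$ for some $\mathbf{x}\in\mathbb{N}_0^k$; the sum $P_{5,\mathbf{a}}$ is universal over $\mathbb{N}_0$ if it represents every $N\in\mathbb{N}_0$ over $\mathbb{N}_0$. *)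

(* Defs.v *)
From mathcomp Require Import all_boot.
Set Implicit Arguments. Unset Strict Implicit. Unset Printing Implicit Defensive.

(* Pentagonal number P_5(x) = (3x^2 - x)/2 for x in N_0 (3x^2 - x is even and >= 0,
   so the truncated subtraction and division are exact). *)
Definition P5 (x : nat) : nat := (3 * x ^ 2 - x) %/ 2.

Definition P5a (k : nat) (a x : 'I_k -> nat) : nat := \sum_(i < k) a i * P5 (x i).

Definition represents (k : nat) (a : 'I_k -> nat) (N : nat) : Prop :=
  exists x : 'I_k -> nat, P5a a x = N.

Definition universal (k : nat) (a : 'I_k -> nat) : Prop :=
  forall N : nat, represents a N.

Definition critical_set : seq nat :=
  [:: 1; 2; 3; 4; 6; 7; 8; 9; 11; 13; 14; 17; 18; 19; 23; 28; 31; 33; 34; 39; 42; 63].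

(* Main.v *)
(** A sum representing 1 needs a coefficient 1, one representing 2 a further coefficient at most 2, and so on:
    after four steps every universal sum contains one of 34 quaternary sums, which represents everything
    outside an explicit set of exceptions; each exception in turn bounds a further coefficient.

    For one quaternary sum write [B = sum a_i x_i], [A = sum a_i x_i^2] and [S = sum a_i], so that [N] is
    represented when [3 A - B = 2 N].  Lagrange's identity [S A - B^2 = J(x)] turns this into a representation
    of [(S (2 N + B) - 3 B^2) / 3] by a ternary form [J] in the differences [x_i - x_4], under congruence
    conditions.  By Ankeny's argument a number that is represented locally everywhere is represented by some
    form in the genus of [J]: a prime in a suitable residue class serves as an auxiliary modulus, and its
    existence is Dirichlet's theorem in a weak form, provable with real characters only.  Enumerating the
    reduced forms of the genus and carrying their representations over to [J] through tables of lattice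
    inclusions removes the dependence on the class.  Choosing [B] in a short window near [sqrt (2 S N / 3)]
    makes all the [x_i] nonnegative.  The remaining [N] form a finite range, which is sieved. *)

From Stdlib Require Classical ClassicalEpsilon ZArith Znumtheory NArith Lia List Bool MSetPositive.
Require Import Defs.
From mathcomp Require Import all_boot.
From mathcomp Require all_order all_algebra all_field cyclic realalg zify ssrZ ring lra.

(** Ankeny's argument does not need a prime: a product [u'] of primes modulo which [- E] is a square
    serves as well, and its class matters only up to squares, because a square can be absorbed by
    rescaling basis vectors. Classes modulo squares form a group of exponent two, hence real
    characters suffice, and comparing one bounded weighted sum with the harmonic series separates
    two of them without any L-function.

    Two obstacles shape the rest. The differences [y_i] yield an integral [x_4] only if
    [sum a_i y_i] is congruent to [B] or [- B] modulo [S], while the ternary value fixes only its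
    square; where this leaves more than a common sign, [B] is restricted, or the linear form is
    tracked modulo a divisor of [S] through every change of form. Moreover the genus often has
    several classes. Another class reaches [J] either after scaling by [c], so that [c^2] must
    divide the ternary value, or on sublattices, so that congruences on that value must force its
    vectors into them. All these conditions fall on [B], and they fix how long its window has to be
    and so how far the sieve must go. *)

Module RealCharacters.
Import all_boot all_order all_algebra zify ring lra.
Set Implicit Arguments. Unset Strict Implicit. Unset Printing Implicit Defensive.
Import Order.TTheory GRing.Theory Num.Theory.
Local Open Scope ring_scope.

(** * Real characters and the hyperbola method *)

Section Characters.
Variables (R : rcfType) (W : nat).

Definition bounded_sums (c : nat -> R) := forall m n, `|\sum_(m <= i < n) c i| <= W%:R.

Record real_char (c : nat -> R) : Prop := RealChar {
  rc1 : c 1%N = 1;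
  rcM : forall m n, c (m * n)%N = c m * c n;
  rcW : forall n, c (n + W)%N = c n;
  rc_unit : forall n, coprime n W -> c n = 1 \/ c n = -1;
  rc_zero : forall n, ~~ coprime n W -> c n = 0 }.

Lemma rc_norm c n : real_char c -> `|c n| <= 1.
Proof.
case=> _ _ _ u z; have [/u [->|->]|/z ->] := boolP (coprime n W).
- by rewrite normr1.
- by rewrite normrN1.
- by rewrite normr0 ler01.
Qed.

Lemma rc_mod c n : real_char c -> c (n %% W)%N = c n.
Proof.
move=> hc; rewrite [in RHS](divn_eq n W) addnC.
elim: (n %/ W)%N => [|k IH]; first by rewrite mul0n addn0.
by rewrite mulSn addnCA addnC rcW.
Qed.

(** Multiplication by the unit [u] permutes the residues and multiplies the sum by -1. *)
Lemma rc_period0 c u : (0 < W)%N -> real_char c -> coprime u W -> c u = -1 ->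
  \sum_(0 <= i < W) c i = 0.
Proof.
move=> W0 hc cu cu1.
have E : \sum_(i < W) c i = c u * \sum_(i < W) c i.
  pose h (i : 'I_W) := Ordinal (ltn_pmod (u * i)%N W0).
  have hI : injective h.
    move=> i j [] /eqP eij; apply/val_inj => /=; move: eij.
    wlog le : i j / (i <= j)%N.
      by move=> H; case: (leqP i j) => [/H//|/ltnW /H H1 H2]; apply/esym/H1; rewrite eq_sym.
    rewrite eq_sym eqn_mod_dvd ?leq_mul // -mulnBr Gauss_dvdr 1?coprime_sym //.
    have: (j - i < W)%N by rewrite (leq_ltn_trans (leq_subr _ _)).
    move=> lt dv; have : (j - i == 0)%N by move: dv; rewrite /dvdn modn_small.
    by rewrite subn_eq0 => le2; apply/eqP; rewrite eqn_leq le le2.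
  rewrite [LHS](reindex_inj hI) /= mulr_sumr; apply: eq_bigr => i _.
  by rewrite rc_mod // rcM.
rewrite big_mkord; move: E; rewrite cu1 mulN1r => /eqP; rewrite -addr_eq0 -mulr2n.
by rewrite mulrn_eq0 /= => /eqP.
Qed.

(** Whole periods cancel wherever they start, and fewer than [W] terms of absolute value at most 1
    are left. *)
Lemma rc_bounded c u : (0 < W)%N -> real_char c -> coprime u W -> c u = -1 ->
  bounded_sums c.
Proof.
move=> W0 hc cu cu1.
have block m : \sum_(m <= i < m + W) c i = 0.
  elim: m => [|m IH]; first by rewrite add0n (rc_period0 W0 hc cu cu1).
  rewrite addSn big_nat_recr /=; last by lia.
  move: IH; rewrite (@big_ltn _ _ _ m); last by lia.
  by rewrite rcW // => /eqP; rewrite addrC => /eqP.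
move=> m n; have [k] := ubnP (n - m)%N; elim: k m => // k IH m ltk.
have [lt|ge] := ltnP (n - m) W.
  apply: (le_trans (ler_norm_sum _ _ _)).
  apply: (le_trans (ler_sum _ (fun i _ => rc_norm i hc))).
  by rewrite sumr_const_nat ler_nat ltnW.
rewrite (@big_cat_nat _ _ _ (m + W)) /=; [|lia|lia].
by rewrite block add0r; apply: IH; lia.
Qed.

(** Summation by parts: the partial sums are at most [C], and the decrements of the weight telescope
    to [w u - w v]. *)
Lemma abel_bound (a w : nat -> R) (C : R) u v : (u <= v)%N ->
  (forall k, `|\sum_(u <= i < k) a i| <= C) -> (forall i, 0 <= w i) ->
  (forall i, (u <= i)%N -> w i.+1 <= w i) ->
  `|\sum_(u <= i < v) a i * w i| <= C * w u.
Proof.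
move=> uv hA w0 wd.
have E : \sum_(u <= i < v) a i * w i = (\sum_(u <= i < v) a i) * w v
   + \sum_(u <= i < v) (\sum_(u <= j < i.+1) a j) * (w i - w i.+1).
  elim: v uv => [|v IH] uv.
    by rewrite !big_geq // mul0r addr0.
  have [->|ne] := eqVneq u v.+1; first by rewrite !big_geq // mul0r addr0.
  have le : (u <= v)%N by lia.
  rewrite !(@big_nat_recr _ _ _ v u) //= IH //; ring.
have F : w u = w v + \sum_(u <= i < v) (w i - w i.+1).
  elim: v uv {E} => [|v IH] uv; first by rewrite big_geq // addr0; congr w; lia.
  have [->|ne] := eqVneq u v.+1; first by rewrite big_geq // addr0.
  have le : (u <= v)%N by lia.
  rewrite (@big_nat_recr _ _ _ v u) //= {1}(IH le); ring.
rewrite E F mulrDr; apply: (le_trans (ler_normD _ _)); apply: lerD.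
  by rewrite normrM (ger0_norm (w0 v)) ler_wpM2r.
apply: (le_trans (ler_norm_sum _ _ _)); rewrite mulr_sumr.
rewrite !big_nat; apply: ler_sum => i /andP[ui _].
have d0 : 0 <= w i - w i.+1 by rewrite subr_ge0 wd.
by rewrite normrM (ger0_norm d0) ler_wpM2r.
Qed.

(** With exponent 1/2 the squares contribute a harmonic series, while the double sum of
    [hyperbola_bound] still stays bounded. *)
Definition isq (n : nat) : R := (Num.sqrt n%:R)^-1.

Lemma isq_ge0 n : 0 <= isq n.
Proof. by rewrite invr_ge0 sqrtr_ge0. Qed.

Lemma isqM m n : isq (m * n) = isq m * isq n.
Proof. by rewrite /isq natrM sqrtrM ?ler0n // invfM. Qed.

Lemma isq1 : isq 1 = 1.
Proof. by rewrite /isq sqrtr1 invr1. Qed.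

Lemma isq_sqr m : isq (m ^ 2) = m%:R^-1.
Proof. by rewrite /isq natrX sqrtr_sqr ger0_norm ?ler0n. Qed.

Lemma isq_dec m n : (0 < m <= n)%N -> isq n <= isq m.
Proof.
case/andP=> m0 le; rewrite /isq lef_pV2 ?posrE ?sqrtr_gt0 ?ltr0n //; last by lia.
by rewrite ler_wsqrtr // ler_nat.
Qed.

Lemma isq_ratio m k l : (0 < m)%N -> (0 < k)%N -> (m <= k * l)%N -> isq k <= Num.sqrt l%:R * isq m.
Proof.
move=> m0 k0 h; have l0 : (0 < l)%N by lia.
rewrite /isq -ler_pdivrMr ?invr_gt0 ?sqrtr_gt0 ?ltr0n // invrK mulrC.
rewrite ler_pdivrMr ?sqrtr_gt0 ?ltr0n // -sqrtrM ?ler0n // -natrM.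
by rewrite ler_wsqrtr // ler_nat mulnC.
Qed.

(** For consecutive square roots [s < t] the step [1 / t <= 2 (t - s)] is [0 <= (t - s)^2] in
    disguise. *)
Lemma sum_isq Y : \sum_(1 <= i < Y.+1) isq i <= 2 * Num.sqrt Y%:R.
Proof.
elim: Y => [|Y IH]; first by rewrite big_geq // mulr_ge0 ?sqrtr_ge0.
rewrite big_nat_recr //=; apply: (le_trans (lerD IH (lexx _))).
set s := Num.sqrt Y%:R; set t := Num.sqrt Y.+1%:R.
have t0 : 0 < t by rewrite sqrtr_gt0 ltr0n.
have s0 : 0 <= s by rewrite sqrtr_ge0.
have e1 : s ^+ 2 = Y%:R by rewrite sqr_sqrtr ?ler0n.
have e2 : t ^+ 2 = Y%:R + 1 by rewrite sqr_sqrtr ?ler0n // -natr1.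
have ti : t * t^-1 = 1 by rewrite divff // gt_eqF.
have ti0 : 0 < t^-1 by rewrite invr_gt0.
rewrite -/(isq _) /isq -/t.
rewrite -(ler_pM2r t0) mulrDl mulVf ?gt_eqF //.
have : 0 <= (t - s) ^+ 2 by rewrite sqr_ge0.
nra.
Qed.


(** Dirichlet's hyperbola method: pairs with [a <= Y] are summed over [b] first; all others have
    [b <= Y] and are summed over [a] first. The point is that the bound does not depend on [Y]. *)
Lemma hyperbola_bound (c1 c2 : nat -> R) Y : (0 < Y)%N ->
  bounded_sums c1 -> bounded_sums c2 ->
  (forall n, `|c1 n| <= 1) -> (forall n, `|c2 n| <= 1) ->
  `|\sum_(1 <= a < (Y ^ 2).+1) \sum_(1 <= b < (Y ^ 2).+1 | (a * b <= Y ^ 2)%N)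
      c1 a * c2 b * isq (a * b)| <= W%:R ^+ 2 + 3 * W%:R.
Proof.
move=> Y0 b1 b2 n1 n2; set N := (Y ^ 2)%N.
have YN : (Y <= N)%N by rewrite /N -[X in (X <= _)%N]expn1 leq_pexp2l.
pose g1 a := c1 a * isq a; pose g2 b := c2 b * isq b.
have abel (c : nat -> R) (hc : bounded_sums c) u v : (0 < u)%N ->
    `|\sum_(u <= i < v) c i * isq i| <= W%:R * isq u.
  move=> u0; have [le|gt] := leqP u v; last first.
    by rewrite big_geq ?normr0 ?mulr_ge0 ?isq_ge0 //; lia.
  apply: abel_bound => // [i|i ui]; first exact: isq_ge0.
  by apply: isq_dec; lia.
have inner c a M : (0 < a)%N -> (M <= N)%N ->
    \sum_(1 <= b < N.+1 | (a * b <= M)%N) c b * isq b =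
    \sum_(1 <= b < (M %/ a).+1) c b * isq b :> R.
  move=> a0 leM; rewrite (@big_cat_nat _ _ _ (M %/ a).+1 1 N.+1) //=; last first.
    by rewrite ltnS (leq_trans (leq_div _ _)).
  rewrite [X in _ + X]big_nat_cond [X in _ + X]big1 => [|b]; last first.
    by rewrite mulnC -leq_divRL // => /andP[/andP[? _]] ?; lia.
  rewrite addr0 big_nat_cond [RHS]big_nat_cond; apply: eq_bigl => b.
  by rewrite mulnC -leq_divRL //; lia.
have -> : \sum_(1 <= a < N.+1) \sum_(1 <= b < N.+1 | (a * b <= N)%N)
      c1 a * c2 b * isq (a * b) =
   \sum_(1 <= a < Y.+1) g1 a * (\sum_(1 <= b < (N %/ a).+1) g2 b) +
   \sum_(1 <= b < Y.+1) g2 b * (\sum_(Y.+1 <= a < (N %/ b).+1) g1 a).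
  rewrite (@big_cat_nat _ _ _ Y.+1 1 N.+1) //=; congr (_ + _).
    apply: eq_big_nat => a /andP[a1 aY]; rewrite -inner // mulr_sumr.
    by apply: eq_bigr => b _; rewrite isqM /g1; ring.
  rewrite (exchange_big_dep_nat xpredT) //=.
  rewrite (@big_cat_nat _ _ _ Y.+1 1 N.+1) //= [X in _ + X]big_nat_cond.
  rewrite [X in _ + X]big1 ?addr0 => [|b /andP[/andP[Yb _] _]]; last first.
    rewrite big_nat_cond big1 // => a /andP[/andP[Ya _]] le.
    have : (Y.+1 * Y.+1 <= N)%N by apply: leq_trans le; apply: leq_mul.
    by rewrite /N; lia.
  apply: eq_big_nat => b /andP[b1' bY]; rewrite mulr_sumr.
  have YNb : (Y.+1 <= (N %/ b).+1)%N by rewrite ltnS leq_divRL // /N -mulnn leq_mul.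
  rewrite (@big_cat_nat _ _ _ (N %/ b).+1 Y.+1 N.+1) //=; last first.
    by rewrite ltnS leq_div.
  rewrite [X in _ + X]big_nat_cond [X in _ + X]big1 ?addr0 => [|a]; last first.
    by rewrite -leq_divRL // => /andP[/andP[? _]] ?; lia.
  rewrite big_nat_cond [RHS]big_nat_cond.
  apply: eq_big => [a|a _]; first by rewrite -leq_divRL //; lia.
  by rewrite isqM /g1 /g2; ring.
have WW : 0 <= W%:R :> R by [].
apply: (le_trans (ler_normD _ _)).
have -> : W%:R ^+ 2 + 3 * W%:R = (W%:R ^+ 2 + W%:R) + 2 * W%:R :> R by ring.
apply: lerD.
  (* The inner sum is the full sum [X] minus a tail. The full sums multiply to at most [W ^ 2], and
     each of the [Y] tails costs at most [W / Y]. *)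
  pose X := \sum_(1 <= b < N.+1) g2 b.
  have E a : (1 <= a < Y.+1)%N -> g1 a * (\sum_(1 <= b < (N %/ a).+1) g2 b) =
     g1 a * X - g1 a * (\sum_((N %/ a).+1 <= b < N.+1) g2 b).
    move=> /andP[a1 aY]; rewrite -mulrBr /X (@big_cat_nat _ _ _ (N %/ a).+1 1 N.+1) //=.
      by rewrite addrK.
    by rewrite ltnS leq_div.
  rewrite (eq_big_nat _ _ E) sumrB; apply: (le_trans (ler_normB _ _)); apply: lerD.
    rewrite -mulr_suml normrM expr2; apply: ler_pM => //.
      by have := abel _ b1 1%N Y.+1 isT; rewrite isq1 mulr1.
    by have := abel _ b2 1%N N.+1 isT; rewrite isq1 mulr1.
  apply: (le_trans (ler_norm_sum _ _ _)).
  have H a : (1 <= a < Y.+1)%N ->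
     `|g1 a * (\sum_((N %/ a).+1 <= b < N.+1) g2 b)| <= W%:R * Y%:R^-1.
    move=> /andP[a1 aY]; rewrite normrM.
    have h1 : `|g1 a| <= isq a.
      by rewrite normrM (ger0_norm (isq_ge0 _)) ler_piMl ?isq_ge0.
    have h2 := abel _ b2 (N %/ a).+1 N.+1 isT.
    apply: (le_trans (ler_pM (normr_ge0 _) (normr_ge0 _) h1 h2)).
    have h3 : isq (N %/ a).+1 <= Num.sqrt a%:R * isq N.
      apply: isq_ratio => //; first by rewrite /N expn_gt0 Y0.
      by apply: ltnW; rewrite ltn_ceil.
    have h4 : isq a * Num.sqrt a%:R = 1.
      by rewrite mulVf // gt_eqF // sqrtr_gt0 ltr0n.
    rewrite mulrCA ler_wpM2l // -isq_sqr -/N.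
    apply: (le_trans (ler_wpM2l (isq_ge0 _) h3)).
    by rewrite mulrA h4 mul1r.
  rewrite big_nat; apply: (le_trans (ler_sum _ H)); rewrite -big_nat sumr_const_nat subn1 /=.
  by rewrite -[X in X <= _]mulr_natr -mulrA mulVf ?mulr1 // pnatr_eq0; lia.
apply: (le_trans (ler_norm_sum _ _ _)).
have H b : (1 <= b < Y.+1)%N ->
   `|g2 b * (\sum_(Y.+1 <= a < (N %/ b).+1) g1 a)| <= isq b * (W%:R * isq Y).
  move=> /andP[b1' bY]; rewrite normrM; apply: ler_pM => //.
    by rewrite normrM (ger0_norm (isq_ge0 _)) ler_piMl ?isq_ge0.
  apply: (le_trans (abel _ b1 Y.+1 _ isT)); rewrite ler_wpM2l //.
  by apply: isq_dec; lia.
rewrite big_nat; apply: (le_trans (ler_sum _ H)); rewrite -big_nat -mulr_suml.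
apply: (le_trans (ler_wpM2r _ (sum_isq Y))); first by rewrite mulr_ge0 ?isq_ge0.
have sY : Num.sqrt Y%:R * isq Y = 1.
  by rewrite /isq divff // gt_eqF // sqrtr_gt0 ltr0n.
have -> : 2 * Num.sqrt Y%:R * (W%:R * isq Y) = 2 * W%:R * (Num.sqrt Y%:R * isq Y) by ring.
by rewrite sY mulr1.
Qed.
End Characters.

End RealCharacters.

(** * Separating two real characters by a prime *)

Module HarmonicProgression.
Import all_boot all_order all_algebra realalg zify ring lra RealCharacters.
Set Implicit Arguments. Unset Strict Implicit. Unset Printing Implicit Defensive.
Import Order.TTheory GRing.Theory Num.Theory.
Local Open Scope ring_scope.

Section CharactersSum.
Variables (R : rcfType) (W : nat).
Hypothesis W0 : (0 < W)%N.
Implicit Types c : nat -> R.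

Definition sumdiv c n := \sum_(d <- divisors n) c d.

Lemma sumdiv_pfactor c p k m : real_char W c -> prime p -> (0 < m)%N -> coprime p m ->
  sumdiv c (p ^ k * m) = (\sum_(0 <= i < k.+1) c p ^+ i) * sumdiv c m.
Proof.
move=> hc pp m0 cpm; have p0 := prime_gt0 pp.
have pk0 : (0 < p ^ k * m)%N by rewrite muln_gt0 expn_gt0 p0.
have cX j e : c (p ^ j * e)%N = c p ^+ j * c e.
  by elim: j => [|j IH]; rewrite ?mul1n ?expr0 ?mul1r // expnS exprS -mulnA (rcM hc) IH mulrA.
rewrite /sumdiv (perm_big [seq (p ^ i * e)%N | i <- index_iota 0 k.+1, e <- divisors m]).
  rewrite (@big_allpairs_dep _ _ _ nat (fun=> nat) nat (fun i e => (p ^ i * e)%N) _ (fun=> divisors m)) mulr_suml; apply: eq_bigr => i _.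
  by rewrite mulr_sumr; apply: eq_bigr => e _.
have cpe i e : e \in divisors m -> coprime (p ^ i) e.
  by rewrite -dvdn_divisors // => em; apply: coprimeXl; apply: coprime_dvdr em _.
apply: uniq_perm; first exact: divisors_uniq.
  apply: allpairs_uniq; [exact: iota_uniq|exact: divisors_uniq|].
  move=> [i e] [j f] /allpairsP[[i' e'] [_ he [-> ->]]] /allpairsP[[j' f'] [_ hf [-> ->]]] E.
  rewrite /= in he hf E *.
  have lg l g : g \in divisors m -> logn p (p ^ l * g) = l.
    move=> gm; have g0 : (0 < g)%N by rewrite -dvdn_divisors // in gm; apply: dvdn_gt0 gm.
    rewrite lognM ?expn_gt0 ?p0 // pfactorK // lognE pp g0 /=.
    have -> : (p %| g)%N = false; last by rewrite addn0.
    by apply: negbTE; rewrite -prime_coprime // -[p]expn1 cpe.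
  have ij : i' = j' by rewrite -(lg i' e') // E lg.
  move: E; rewrite ij => /eqP; rewrite eqn_mul2l expn_eq0.
  by case: eqP p0 => [->//|_ _] /= /eqP ->.
move=> d; rewrite -dvdn_divisors //; apply/idP/allpairsP => [dv|[[i e] /= [ik em ->]]].
  have d0 : (0 < d)%N by apply: dvdn_gt0 dv.
  exists (logn p d, d`_p^')%N => /=; split.
  - rewrite mem_index_iota ltnS /=.
    apply: (leq_trans (dvdn_leq_log p pk0 dv)).
    rewrite lognM ?expn_gt0 ?p0 // pfactorK // lognE pp m0 /=.
    by move: cpm; rewrite prime_coprime // => /negbTE ->; rewrite addn0.
  - rewrite -dvdn_divisors //.
    have h : (d`_p^' %| p ^ k * m)%N by apply: dvdn_trans dv; exact: dvdn_part.
    rewrite Gauss_dvdr // in h; apply: coprimeXr.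
    by rewrite coprime_sym (@pnat_coprime p) ?part_pnat // pnat_id.
  - by rewrite -p_part partnC.
rewrite dvdn_mul //.
  by apply: dvdn_exp2l; move: ik; rewrite mem_index_iota ltnS.
by rewrite dvdn_divisors.
Qed.

(** A prime with [c p = -1] contributes the factor 1 or 0 according to the parity of its exponent, a
    prime with [c p = 1] its exponent plus one. So a nonzero divisor sum means that [n] is a product
    of squares and of primes with [c p = 1]. *)
Lemma sumdiv_good c (Good : nat -> Prop) : real_char W c ->
  Good 1%N -> (forall m n, Good m -> Good n -> Good (m * n)%N) ->
  (forall m, (0 < m)%N -> coprime m W -> Good (m ^ 2)%N) ->
  (forall p, prime p -> coprime p W -> c p = 1 -> Good p) ->
  forall n, (0 < n)%N -> coprime n W ->
  [/\ 0 <= sumdiv c n, (forall m, n = (m ^ 2)%N -> 1 <= sumdiv c n) &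
      sumdiv c n = 0 \/ Good n].
Proof.
move=> hc G1 GM GS Gp n; have [k] := ubnP n; elim: k n => // k IH n ltk n0 cn.
have [n1|n1] := leqP n 1.
  have -> : n = 1%N by lia.
  by rewrite /sumdiv big_seq1 (rc1 hc); split=> //; right.
set p := pdiv n; have pp : prime p by apply: pdiv_prime.
have [m cpm En] := pfactor_coprime pp n0; set l := logn p n in En.
have l0 : (0 < l)%N by rewrite /l logn_gt0 mem_primes pp n0 pdiv_dvd.
have m0 : (0 < m)%N by move: n0; rewrite En muln_gt0 => /andP[].
have cm : coprime m W by move: cn; rewrite En coprimeMl => /andP[].
have cp : coprime p W.
  by move: cn; rewrite En coprimeMl => /andP[_]; rewrite coprime_pexpl.
have mn : (m < k)%N.
  have : (m * 2 <= n)%N; last by lia.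
  rewrite En leq_mul2l; apply/orP; right; apply: (leq_trans (prime_gt1 pp)).
  by rewrite -[X in (X <= _)%N]expn1 leq_pexp2l // prime_gt0.
have [s0 s1 sG] := IH m mn m0 cm.
have Es : sumdiv c n = (\sum_(0 <= i < l.+1) c p ^+ i) * sumdiv c m.
  by rewrite {1}En mulnC sumdiv_pfactor.
have GX j q : Good q -> Good (q ^ j)%N.
  by move=> Gq; elim: j => // j Ij; rewrite expnS; apply: GM.
have msq r : n = (r ^ 2)%N -> exists2 r', m = (r' ^ 2)%N & ~~ odd l.
  move=> Er; have r0 : (0 < r)%N by move: n0; rewrite Er; case: r Er.
  have [r' cr' Er'] := pfactor_coprime pp r0; exists r'.
    have ll : l = (logn p r * 2)%N by rewrite /l Er lognX mulnC.
    have h : (m * p ^ l = r' ^ 2 * p ^ l)%N.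
      by rewrite -En Er {1}Er' expnMn -expnM -ll.
    apply/eqP; move/eqP: h; rewrite eqn_mul2r expn_eq0.
    by case: eqP (prime_gt0 pp) => [->//|_ _].
  by rewrite /l Er lognX mul2n odd_double.
case: (rc_unit hc cp) => cpE.
  have Esum : \sum_(0 <= i < l.+1) c p ^+ i = l.+1%:R.
    by rewrite cpE (eq_bigr (fun=> 1)) => [|i _]; rewrite ?sumr_const_nat ?expr1n ?subn0.
  rewrite Es Esum; split; first by rewrite mulr_ge0.
    move=> r /msq[r' /s1 h _]; apply: (le_trans h).
    by rewrite ler_peMl // ler1n.
  case: sG => [->|Gm]; first by left; rewrite mulr0.
  by right; rewrite En; apply: GM => //; apply: GX; apply: Gp.
have Esum : \sum_(0 <= i < l.+1) c p ^+ i = (~~ odd l)%:R.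
  elim: (l) => [|j Ij]; first by rewrite big_nat1 expr0.
  rewrite big_nat_recr //= Ij cpE -signr_odd /=; case: (odd j) => /=; ring.
rewrite Es Esum; split; first by rewrite mulr_ge0.
  by move=> r /msq[r' /s1 h ->]; rewrite mul1r.
have [ol|el] := boolP (odd l); first by left; rewrite mul0r.
case: sG => [->|Gm]; first by left; rewrite mulr0.
right; rewrite En; apply: GM => //.
have -> : (p ^ l = (p ^ l./2) ^ 2)%N by rewrite -expnM muln2 even_halfK.
by apply: GS; rewrite ?expn_gt0 ?prime_gt0 // coprimeXl.
Qed.

(** Each term is at least [1 / (W (k + 1))], and every dyadic block of the harmonic series adds
    1/2. *)
Lemma harmonic_progression (B : nat) :
  exists K, B%:R < \sum_(0 <= k < K) ((k * W).+1%:R : R)^-1.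
Proof.
have H j : (j%:R : R) / 2 <= \sum_(0 <= k < 2 ^ j) (k.+1%:R : R)^-1.
  elim: j => [|j IH]; first by rewrite mul0r; apply: sumr_ge0 => i _; rewrite invr_ge0.
  have le2 : (2 ^ j <= 2 ^ j.+1)%N by rewrite leq_pexp2l.
  rewrite (@big_cat_nat _ _ _ (2 ^ j)) //= -natr1 mulrDl lerD //.
  have -> : (1 / 2 : R) = \sum_(2 ^ j <= k < 2 ^ j.+1) ((2 ^ j.+1)%:R : R)^-1.
    rewrite sumr_const_nat expnS mul2n -addnn addnK -[RHS]mulr_natr natrD.
    have : ((2 ^ j)%:R : R) != 0 by rewrite pnatr_eq0 expn_eq0.
    by move: ((2 ^ j)%:R) => x x0; field; rewrite -mulr2n mulrn_eq0 /= ?x0.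
  rewrite [X in X <= _]big_nat [X in _ <= X]big_nat; apply: ler_sum => i /andP[_ hi].
  by rewrite lef_pV2 ?posrE ?ltr0n ?expn_gt0 // ler_nat.
pose j := (2 * W * B.+1)%N; exists (2 ^ j)%N.
have Wr : (W%:R : R) != 0 by rewrite pnatr_eq0 -lt0n.
apply: (@lt_le_trans _ _ (W%:R^-1 * (j%:R / 2))).
  have -> : W%:R^-1 * (j%:R / 2) = B.+1%:R :> R by rewrite /j !natrM; field.
  by rewrite ltr_nat.
have Wi : 0 <= (W%:R : R)^-1 by rewrite invr_ge0.
apply: (le_trans (ler_wpM2l Wi (H j))).
rewrite mulr_sumr; apply: ler_sum => k _.
rewrite -invfM -natrM lef_pV2 ?posrE ?ltr0n ?muln_gt0 ?W0 // ler_nat.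
by rewrite mulnS mulnC; lia.
Qed.

Lemma sum_increasing_le (a : nat -> R) (g : nat -> nat) K :
  (forall n, (0 < n)%N -> 0 <= a n) -> (forall k, (g k < g k.+1)%N) -> (0 < g 0)%N ->
  \sum_(0 <= k < K) a (g k) <= \sum_(1 <= n < g K) a n.
Proof.
move=> a0 gI g0; have gp k : (0 < g k)%N by elim: k => // k; move: (gI k); lia.
elim: K => [|K IH].
  by rewrite big_geq // big_nat; apply: sumr_ge0 => i /andP[? _]; apply: a0.
rewrite big_nat_recr //= (@big_cat_nat _ _ _ (g K) 1) /=; [|by move: (gp K)|by apply: ltnW].
apply: lerD => //; rewrite big_ltn // lerDl big_nat; apply: sumr_ge0 => i /andP[? _].
by apply: a0; move: (gp K); lia.
Qed.

(** [F] is the Dirichlet convolution of [c'] and [c' c], two characters that take the value -1, so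
    its sum weighted by [isq] is bounded. If [c' = 1] at every prime where [c = 1], then [F] is
    nonnegative, and at least 1 on the squares of the numbers [k W + 1], whose weights alone form a
    divergent series. *)
Lemma two_chars_contra c c' u u' : real_char W c -> real_char W c' ->
  coprime u W -> c' u = -1 -> coprime u' W -> c' u' * c u' = -1 ->
  (forall p, prime p -> coprime p W -> c p = 1 -> c' p = 1) -> False.
Proof.
move=> hc hc' cu cu1 cu' cu1' hp.
have hcc : real_char W (fun n => c' n * c n).
  split=> [|m n|n|n cn|n cn].
  - by rewrite (rc1 hc) (rc1 hc') mulr1.
  - by rewrite (rcM hc) (rcM hc') mulrACA.
  - by rewrite (rcW hc) (rcW hc').
  - by case: (rc_unit hc cn) => ->; case: (rc_unit hc' cn) => ->;
      rewrite ?mulr1 ?mul1r ?mulrNN ?mulN1r ?mulr1 ?opprK; auto.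
  - by rewrite (rc_zero hc cn) mulr0.
pose F n := c' n * sumdiv c n.
have F0 n : (0 < n)%N -> 0 <= F n /\ (forall m, n = (m ^ 2)%N -> coprime m W -> 1 <= F n).
  move=> n0; have [cn|cn] := boolP (coprime n W); last first.
    rewrite /F (rc_zero hc' cn) mul0r; split=> // m En cm; case/negP: cn.
    by rewrite En coprimeXl.
  have sq1 m : coprime m W -> c' (m ^ 2)%N = 1.
    by move=> cm; rewrite expnS expn1 (rcM hc'); case: (rc_unit hc' cm) => ->;
      rewrite ?mulr1 ?mulrNN ?mulr1.
  have [||||h1 h2 h3] := @sumdiv_good c (fun n => c' n = 1) hc _ _ _ _ n n0 cn.
  - exact: (rc1 hc').
  - by move=> a b ha hb; rewrite (rcM hc') ha hb mulr1.
  - by move=> m _ cm; apply: sq1.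
  - exact: hp.
  case: h3 => [E|E]; rewrite /F.
    by split=> [|m /h2]; rewrite E ?mulr0 // ler10.
  by rewrite E mul1r; split=> // m /h2.
(* The bound of [hyperbola_bound]. The first [K] terms of the harmonic progression exceed it, and
   [Y ^ 2] is large enough to include all their squares. *)
pose B := (W ^ 2 + 3 * W)%N.
have [K hK] := harmonic_progression B.
pose Y := (K * W).+1.
have Y0 : (0 < Y)%N by [].
pose N := (Y ^ 2)%N.
have N0 : (0 < N)%N by rewrite /N expn_gt0.
have bc' := rc_bounded W0 hc' cu cu1.
have bcc := rc_bounded W0 hcc cu' cu1'.
have := hyperbola_bound Y0 bc' bcc (fun n => rc_norm n hc') (fun n => rc_norm n hcc).
rewrite -/N.
have -> : \sum_(1 <= a < N.+1) \sum_(1 <= b < N.+1 | (a * b <= N)%N)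
     c' a * (c' b * c b) * isq R (a * b) = \sum_(1 <= n < N.+1) F n * isq R n.
  pose G (a b : nat) : R := c' a * (c' b * c b) * isq R (a * b).
  transitivity (\sum_(1 <= a < N.+1) \sum_(1 <= b < N.+1)
                  \sum_(1 <= n < N.+1 | n == (a * b)%N) G a b).
    apply: eq_big_nat => a /andP[a1 _]; rewrite big_mkcond; apply: eq_big_nat => b /andP[b1 _].
    case: leqP => le; last first.
      by rewrite big_nat_cond big1 // => n /andP[/andP[_ h] /eqP E]; lia.
    rewrite big_mkcond (bigD1_seq (a * b)%N) ?iota_uniq //=; last first.
      by rewrite mem_index_iota ltnS le muln_gt0 a1 b1.
    by rewrite eqxx big1 ?addr0 // => n /negbTE ->.
  transitivity (\sum_(1 <= a < N.+1) \sum_(1 <= n < N.+1)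
                  \sum_(1 <= b < N.+1 | n == (a * b)%N) G a b).
    by apply: eq_bigr => a _; rewrite (exchange_big_dep_nat xpredT).
  rewrite (exchange_big_dep_nat xpredT) //=.
  apply: eq_big_nat => n /andP[n1 nN].
  transitivity (\sum_(1 <= b < N.+1) \sum_(1 <= a < N.+1 | n == (a * b)%N)
                  c' n * isq R n * c b).
    rewrite (exchange_big_dep_nat xpredT) //=; apply: eq_bigr => b _.
    by apply: eq_bigr => a /eqP ->; rewrite /G (rcM hc'); ring.
  rewrite /F /sumdiv mulrAC mulr_sumr.
  rewrite [RHS](perm_big [seq d <- index_iota 1 N.+1 | d %| n]%N); last first.
    apply: uniq_perm; [exact: divisors_uniq|exact: filter_uniq (iota_uniq _ _)|move=> d].
    rewrite mem_filter mem_index_iota -dvdn_divisors //; case dv: (d %| n)%N => //=.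
    by rewrite (dvdn_gt0 n1 dv) ltnS (leq_trans (dvdn_leq n1 dv)).
  rewrite big_filter [RHS]big_mkcond; apply: eq_big_nat => b /andP[b1 _].
  case: ifP => dv.
    rewrite big_mkcond (bigD1_seq (n %/ b)%N) ?iota_uniq //=; last first.
      by rewrite mem_index_iota divn_gt0 // (dvdn_leq n1 dv) (leq_ltn_trans (leq_div _ _)).
    rewrite divnK // eqxx big1 ?addr0 // => a ne.
    by case: eqP => // E; case/eqP: ne; rewrite E mulnK.
  by rewrite big1 // => a /eqP E; move: dv; rewrite E dvdn_mull.
have FI n : (0 < n)%N -> 0 <= F n * isq R n.
  by move=> n0; rewrite mulr_ge0 ?isq_ge0 //; case: (F0 n n0).
have L := @sum_increasing_le (fun n => F n * isq R n) (fun k => ((k * W).+1 ^ 2)%N) K FI.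
have {}L := L _ _.
have L1 : \sum_(0 <= k < K) ((k * W).+1%:R)^-1 <= \sum_(1 <= n < N.+1) F n * isq R n.
  apply: (le_trans _ (le_trans (L _ _) _)) => //.
  - apply: ler_sum => k _.
    have [|_ h] := F0 ((k * W).+1 ^ 2)%N; first by rewrite expn_gt0.
    have {}h : 1 <= F ((k * W).+1 ^ 2)%N.
      by apply: (h (k * W).+1) => //; rewrite -addn1 coprime_sym /coprime gcdnMDl gcdn1.
    by rewrite isq_sqr ler_peMl // invr_ge0.
  - by move=> k; rewrite ltn_exp2r // ltnS mulSn; lia.
  - rewrite -/Y -/N (@big_nat_recr _ _ _ N 1); last exact: N0.
    by rewrite lerDl; apply: FI; exact: N0.
rewrite ger0_norm; last by apply: le_trans L1; apply: sumr_ge0 => k _; rewrite invr_ge0.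
apply/negP; rewrite -ltNge; apply: lt_le_trans L1; apply: le_lt_trans hK.
by rewrite /B natrD natrX natrM.
Qed.

End CharactersSum.

End HarmonicProgression.

(** * Classes containing products of split primes, up to squares *)

Module TwoClasses.
Import Classical ClassicalEpsilon all_boot all_order all_algebra cyclic realalg zify ring lra RealCharacters HarmonicProgression.
Set Implicit Arguments. Unset Strict Implicit. Unset Printing Implicit Defensive.
Import Order.TTheory GRing.Theory Num.Theory.
Local Open Scope ring_scope.

(** Allows a finite set of residues to be carved out, and a largest one to be chosen, by a property
    that need not be decidable. *)
Definition asb (P : Prop) : bool := if excluded_middle_informative P then true else false.
Lemma asbP P : reflect P (asb P).
Proof. by rewrite /asb; case: excluded_middle_informative => h; constructor. Qed.

Lemma coprime_inverse_mod W g : (0 < W)%N -> coprime g W ->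
  exists2 s, coprime s W & (g * s = 1 %[mod W])%N.
Proof.
move=> W0 cg; exists (g ^ (totient W).-1)%N; first by rewrite coprimeXl.
have t0 : (0 < totient W)%N by rewrite totient_gt0.
by rewrite -expnS prednK // Euler_exp_totient.
Qed.

Section SplitGenerate.
Variables (R : rcfType) (W : nat).
Hypothesis W0 : (0 < W)%N.
Variable c : nat -> R.
Hypothesis hc : real_char W c.

(** The free square [t ^ 2] turns the relevant group of classes into one of exponent two. *)
Definition split_class n := exists u t, [/\ (0 < u)%N, coprime t W, coprime u W,
  (u = n * t ^ 2 %[mod W])%N & forall p, prime p -> (p %| u)%N -> c p = 1].

Lemma split_classM m n : split_class m -> split_class n -> split_class (m * n).
Proof.
move=> [u [t [u0 ct cu Eu hu]]] [v [s [v0 cs cv Ev hv]]].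
exists (u * v)%N, (t * s)%N; split; rewrite ?muln_gt0 ?u0 ?coprimeMl ?ct ?cu //.
  by rewrite expnMn mulnACA -modnMm Eu Ev modnMm.
by move=> p pp; rewrite Euclid_dvdM // => /orP[/hu|/hv]; apply.
Qed.

Lemma split_class_mod m n : (m = n %[mod W])%N -> split_class m -> split_class n.
Proof.
move=> E [u [t [u0 ct cu Eu hu]]]; exists u, t; split => //.
by rewrite Eu -modnMml E modnMml.
Qed.

Lemma split_class_sqr m : coprime m W -> split_class (m ^ 2).
Proof.
move=> cm; have [s cs Es] := coprime_inverse_mod W0 cm.
exists 1%N, s; split; rewrite ?coprime1n //.
  by rewrite -expnMn -modnXm Es modnXm exp1n.
by move=> p pp; rewrite dvdn1 => /eqP p1; move: pp; rewrite p1.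
Qed.

(** Otherwise a largest multiplicatively closed set [K] of unit classes that contains the split
    classes and misses [w] would have index two. The character [psi] with kernel [K] is 1 at every
    prime with [c p = 1], while [psi w] and [psi w * c w] are both -1, against
    [two_chars_contra]. *)
Lemma split_class_char1 w : coprime w W -> c w = 1 -> split_class w.
Proof.
move=> cw cw1; apply: NNPP => nG.
pose inW n : 'I_W := Ordinal (ltn_pmod n W0).
have inWE m n : (m = n %[mod W])%N -> inW m = inW n by move=> E; apply/val_inj.
have inWK (x : 'I_W) : inW x = x by apply/val_inj; rewrite /= modn_small.
pose P (K : {set 'I_W}) := [/\ forall n, coprime n W -> split_class n -> inW n \in K,
   forall m n, inW m \in K -> inW n \in K -> inW (m * n)%N \in K,
   inW w \notin K & forall n, inW n \in K -> coprime n W].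
pose K0 := [set x : 'I_W | asb (coprime x W /\ split_class x)].
have K0E n : inW n \in K0 <-> coprime n W /\ split_class n.
  rewrite inE; split=> [/asbP[/= h1 h2]|[h1 h2]].
    rewrite coprime_modl in h1; split=> //.
    by apply: split_class_mod h2; rewrite modn_mod.
  by apply/asbP; rewrite /= coprime_modl; split=> //; apply: split_class_mod h2; rewrite modn_mod.
have PK0 : P K0.
  split.
  - by move=> n h1 h2; apply/K0E.
  - move=> m n /K0E[h1 h2] /K0E[h3 h4]; apply/K0E; rewrite coprimeMl h1 h3; split=> //.
    exact: split_classM.
  - by apply/negP => /K0E[].
  - by move=> n /K0E[].
have PK0' : asb (P K0) by apply/asbP.
case: (@arg_maxnP _ K0 (fun K => asb (P K)) (fun K => #|K|) PK0') => K /asbP[KG KM Kw Kc] Kmax.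
have K1 : inW 1%N \in K.
  by apply: KG; rewrite ?coprime1n // -[1%N](exp1n 2); apply: split_class_sqr; rewrite coprime1n.
have Ksq g : coprime g W -> inW (g ^ 2)%N \in K.
  by move=> cg; apply: KG; rewrite ?coprimeXl //; apply: split_class_sqr.
(* Squares lie in [K], so [K] together with [g K] is again closed; by maximality it must contain the
   forbidden class, necessarily in [g K]. *)
have out g : coprime g W -> inW g \notin K -> exists2 k : nat, inW k \in K & (g * k = w %[mod W])%N.
  move=> cg gK; apply: NNPP => nw.
  pose K' : {set 'I_W} := K :|: [set inW (g * nat_of_ord k)%N | k in K].
  have K'E n : inW n \in K' <-> inW n \in K \/ exists2 k : nat, inW k \in K & (n = g * k %[mod W])%N.
    rewrite inE; split=> [/orP[->|/imsetP[k kK E]]|[->//|[k kK E]]]; first by left.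
      by right; exists k; rewrite ?inWK //; move/(congr1 val): E.
    by apply/orP; right; apply/imsetP; exists (inW k) => //; apply: inWE; rewrite /= modnMmr.
  have PK' : asb (P K').
    apply/asbP; split.
    - by move=> n h1 h2; apply/K'E; left; apply: KG.
    - move=> m n /K'E[hm|[k kK Ek]] /K'E[hn|[l lK El]]; apply/K'E.
      + by left; apply: (KM).
      + right; exists (m * l)%N; first exact: KM.
        by rewrite -modnMmr El modnMmr mulnCA.
      + right; exists (k * n)%N; first exact: KM.
        by rewrite -modnMml Ek modnMml mulnA.
      + left; rewrite (inWE _ (g ^ 2 * (k * l))%N); first by apply: (KM); [apply: (Ksq)|apply: (KM)].
        by rewrite -modnMm Ek El modnMm mulnACA mulnn.
    - apply/negP => /K'E[h|[k kK E]]; first by rewrite h in Kw.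
      by apply: nw; exists k.
    - move=> n /K'E[/Kc//|[k kK E]]; rewrite -coprime_modl E coprime_modl coprimeMl cg.
      exact: Kc.
  have := Kmax _ PK'; apply/negP; rewrite -ltnNge; apply: proper_card; apply/properP.
  split; first exact: subsetUl.
  exists (inW g) => //; apply/K'E; right; exists 1%N => //; by rewrite muln1.
have Kdiv m n : coprime m W -> inW m \in K -> inW (m * n)%N \in K -> inW n \in K.
  move=> cm mK mnK; have [s cs Es] := coprime_inverse_mod W0 cm.
  rewrite (inWE n (m * (m * n) * s ^ 2)%N); first by apply: (KM); [apply: (KM)|apply: (Ksq)].
  have -> : (m * (m * n) * s ^ 2 = n * (m * s) ^ 2)%N by rewrite expnMn; lia.
  by rewrite -modnMmr -modnXm Es modnXm exp1n modnMmr muln1.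
pose psi n : R := if coprime n W then (if inW n \in K then 1 else -1) else 0.
have hpsi : real_char W psi.
  split.
  - by rewrite /psi coprime1n K1.
  - move=> m n; rewrite /psi coprimeMl; case cm: (coprime m W); rewrite ?mul0r //=.
    case cn: (coprime n W); rewrite ?mulr0 //=.
    case mK: (inW m \in K); case nK: (inW n \in K).
    + by rewrite KM // mulr1.
    + by case: ifP => [/(Kdiv _ _ cm mK)|]; rewrite ?nK // mul1r.
    + by rewrite mulnC; case: ifP => [/(Kdiv _ _ cn nK)|]; rewrite ?mK // mulr1.
    (* Both [m k] and [n l] are congruent to [w], so [m n] times the element [k l] of [K] is a
       square. *)
    + have [k kK Ek] := out m cm (negbT mK); have [l lK El] := out n cn (negbT nK).
      have klK : inW (k * l)%N \in K by apply: (KM).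
      rewrite (Kdiv (k * l)%N) ?mulrNN ?mulr1 //; first exact: Kc.
      rewrite (inWE _ (w ^ 2)%N); first exact: Ksq.
      have -> : (k * l * (m * n) = (m * k) * (n * l))%N by rewrite [LHS]mulnC mulnACA.
      by rewrite -modnMm Ek El modnMm.
  - move=> n; rewrite /psi (inWE (n + W)%N n) ?modnDr //.
    by rewrite [coprime (_ + _) _]coprime_sym /coprime gcdnDr gcdnC.
  - by move=> n; rewrite /psi => ->; case: ifP; auto.
  - by move=> n; rewrite /psi => /negbTE ->.
have psiw : psi w = -1 by rewrite /psi cw (negbTE Kw).
apply: (two_chars_contra W0 hc hpsi cw psiw cw); first by rewrite psiw cw1 mulr1.
move=> p pp cp cp1; rewrite /psi cp KG //.
exists p, 1%N; split; rewrite ?prime_gt0 ?coprime1n ?exp1n ?muln1 //.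
by move=> q qp; rewrite dvdn_prime2 // => /eqP ->.
Qed.

End SplitGenerate.

End TwoClasses.

(** * The Jacobi symbol for odd moduli and quadratic reciprocity *)

Module JacobiSymbol.
Import all_boot all_order all_algebra all_field cyclic zify ring lra.
Set Implicit Arguments. Unset Strict Implicit. Unset Printing Implicit Defensive.
Import Order.TTheory GRing.Theory Num.Theory.
Local Open Scope nat_scope.

Definition gres (a : int) (n k : nat) : nat := `|((a * k%:Z)%R %% n%:Z)%Z|.
Definition gsgn (a : int) (n k : nat) : bool := n./2 < gres a n k.
(** The absolute value of the least absolute residue of [a k] modulo [n]; [gsgn] records its
    sign. *)
Definition gfold (a : int) (n k : nat) : nat :=
  if gsgn a n k then n - gres a n k else gres a n k.
(* Gauss-Schering form of the Jacobi symbol: [jac a n] holds when (a/n) = -1. *)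
Definition jac (a : int) (n : nat) : bool := odd (\sum_(i < n./2) gsgn a n i.+1).

Lemma gres_spec a n k : odd n -> gres a n k < n /\ exists q : int, (a * k%:Z = q * n%:Z + (gres a n k)%:Z)%R.
Proof.
move=> on; have n0 : (0 < n%:Z)%R by case: n on.
have h1 := modz_ge0 (a * k%:Z)%R (lt0r_neq0 n0); have h2 := ltz_pmod (a * k%:Z)%R n0.
rewrite /gres; split; first by lia.
exists ((a * k%:Z)%R %/ n%:Z)%Z; rewrite {1}(divz_eq (a * k%:Z)%R n%:Z); lia.
Qed.

Lemma gres_uniq a n k (q : int) r : odd n -> r < n -> (a * k%:Z = q * n%:Z + r%:Z)%R -> gres a n k = r.
Proof.
move=> on rn E; have [h [q' E']] := gres_spec a k on.
have Eq : ((q - q') * n%:Z = (gres a n k)%:Z - r%:Z)%R by lia.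
have : (q - q' = 0)%R.
  have [lt|gt|->] := ltgtP (q - q')%R 0%R; last by [].
  - have h3 : ((q - q') * n%:Z <= - n%:Z)%R by nia.
    lia.
  - have h3 : ((q - q') * n%:Z >= n%:Z)%R by nia.
    lia.
by move=> e; rewrite e mul0r in Eq; lia.
Qed.

Lemma odd_halfE n : odd n -> n = (n./2).*2.+1.
Proof. by move=> on; rewrite -[LHS]odd_double_half on. Qed.

Lemma coprimez_prod n (a k q : int) : coprimez a n -> (a * k = q * n)%R -> exists l : int, (k = l * n)%R.
Proof.
move=> co E; have : (n %| k)%Z.
  by rewrite -(@Gauss_dvdzr n a k) 1?coprimez_sym // E dvdz_mull.
by case/dvdzP => l ->; exists l.
Qed.

Lemma gres_gt0 a n k : odd n -> coprimez a n -> 0 < k <= n./2 -> 0 < gres a n k.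
Proof.
move=> on co hk; have [h [q E]] := gres_spec a k on; rewrite lt0n; apply/eqP => z.
rewrite z addr0 in E; have [l El] := coprimez_prod co E.
have nE := odd_halfE on.
have [lt|gt|l0] := ltgtP l 0%R; last by rewrite l0 in El; lia.
  nia.
nia.
Qed.

Lemma gfold_range a n k : odd n -> coprimez a n -> 0 < k <= n./2 -> 0 < gfold a n k <= n./2.
Proof.
move=> on co hk; have h0 := gres_gt0 on co hk; have [h _] := gres_spec a k on.
by have nE := odd_halfE on; rewrite /gfold /gsgn; case: (ltnP n./2 (gres a n k)); lia.
Qed.

Lemma gfold_spec a n k : odd n ->
  exists q : int, (a * k%:Z = q * n%:Z + (-1) ^+ gsgn a n k * (gfold a n k)%:Z)%R.
Proof.
move=> on; have [h [q E]] := gres_spec a k on; rewrite /gfold; case: gsgn.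
  by exists (q + 1)%R; rewrite E expr1; lia.
by exists q; rewrite E expr0; lia.
Qed.

(** Equal absolute residues force [n] to divide [k - l] or [k + l]; the latter lies strictly between
    0 and [n]. *)
Lemma gfold_inj a n k l : odd n -> coprimez a n -> 0 < k <= n./2 -> 0 < l <= n./2 ->
  gfold a n k = gfold a n l -> k = l.
Proof.
move=> on co hk hl E; have [q Eq] := gfold_spec a k on; have [r Er] := gfold_spec a l on.
have nE := odd_halfE on.
rewrite E in Eq; set f : int := Posz (gfold a n l) in Eq Er.
have : (exists m : int, (k%:Z - l%:Z = m * n%:Z)%R) \/ (exists m : int, (k%:Z + l%:Z = m * n%:Z)%R).
  case: (gsgn a n k) Eq; case: (gsgn a n l) Er; rewrite ?expr1 ?expr0 => Er Eq.
  - by left; apply: (@coprimez_prod _ a _ (q - r)%R) => //; lia.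
  - by right; apply: (@coprimez_prod _ a _ (q + r)%R) => //; lia.
  - by right; apply: (@coprimez_prod _ a _ (q + r)%R) => //; lia.
  - by left; apply: (@coprimez_prod _ a _ (q - r)%R) => //; lia.
case=> [] [m Em]; have [lt|gt|m0] := ltgtP m 0%R.
- nia.
- nia.
- by rewrite m0 in Em; lia.
- nia.
- nia.
- by rewrite m0 in Em; lia.
Qed.

(** Folding permutes the half system [1 .. n/2]. Multiplicativity, Eisenstein's count and Gauss's
    lemma all rest on this. *)
Lemma gfold_reindex (R : Type) (idx : R) (op : Monoid.com_law idx) (F : nat -> R) a n :
  odd n -> coprimez a n ->
  \big[op/idx]_(i < n./2) F (gfold a n i.+1) = \big[op/idx]_(i < n./2) F i.+1.
Proof.
move=> on co.
have lt (i : 'I_n./2) : (gfold a n i.+1).-1 < n./2.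
  by have := @gfold_range a n i.+1 on co (ltn_ord i); lia.
pose g (i : 'I_n./2) := Ordinal (lt i).
have gI : injective g.
  move=> i j [] E; apply/val_inj/succn_inj; apply: (@gfold_inj a n i.+1 j.+1 on co (ltn_ord i) (ltn_ord j)).
  have := @gfold_range a n i.+1 on co (ltn_ord i).
  by have := @gfold_range a n j.+1 on co (ltn_ord j); lia.
rewrite [RHS](reindex_inj gI); apply: eq_bigr => i _ /=; congr F.
by have := @gfold_range a n i.+1 on co (ltn_ord i); lia.
Qed.

Lemma gsgnM a b n k : odd n -> coprimez a n -> coprimez b n -> 0 < k <= n./2 ->
  gsgn (a * b)%R n k = gsgn b n k (+) gsgn a n (gfold b n k).
Proof.
move=> on ca cb hk; have [q Eq] := gfold_spec b k on.
have hf := gfold_range on cb hk; have [h [r Er]] := gres_spec a (gfold b n k) on.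
have h0 := gres_gt0 on ca hf; have nE := odd_halfE on.
rewrite {1}/gsgn {2}/gsgn; case: (gsgn b n k) Eq; rewrite ?expr1 ?expr0 => Eq /=.
  have -> : gres (a * b)%R n k = n - gres a n (gfold b n k).
    apply: (@gres_uniq _ _ _ (a * q - r - 1)%R) => //; first by lia.
    by rewrite -mulrA Eq mulrDr; lia.
  by rewrite -leqNgt; lia.
have -> // : gres (a * b)%R n k = gres a n (gfold b n k).
apply: (@gres_uniq _ _ _ (a * q + r)%R) => //.
by rewrite -mulrA Eq mulrDr; lia.
Qed.

Lemma odd_sum_addb (I : finType) (F G : I -> bool) :
  odd (\sum_i (F i (+) G i)) = odd (\sum_i F i) (+) odd (\sum_i G i).
Proof.
rewrite -oddD -big_split /=; elim/big_rec2: _ => // i x y _ E.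
by rewrite !oddD E !oddb; case: (F i); case: (G i).
Qed.

Lemma jacM a b n : odd n -> coprimez a n -> coprimez b n -> jac (a * b)%R n = jac a n (+) jac b n.
Proof.
move=> on ca cb; rewrite addbC /jac -(gfold_reindex _ (fun k => gsgn a n k : nat) on cb) /=.
rewrite -odd_sum_addb; congr odd; apply: eq_bigr => i _.
by rewrite gsgnM // ltn_ord.
Qed.

Lemma jac_mod (a b : int) (n : nat) : (a = b %[mod Posz n])%Z -> jac a n = jac b n.
Proof.
move=> E; rewrite /jac; congr odd; apply: eq_bigr => i _; rewrite /gsgn /gres.
by rewrite -modzMml E modzMml.
Qed.

Lemma jac_sqr a n : odd n -> coprimez a n -> jac (a ^+ 2)%R n = false.
Proof. by move=> on ca; rewrite expr2 jacM // addbb. Qed.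

Lemma jacN1 n : odd n -> jac (- 1)%R n = odd n./2.
Proof.
move=> on; rewrite /jac; have nE := odd_halfE on.
rewrite (eq_bigr (fun=> 1)) => [|i _]; first by rewrite sum1_card card_ord.
have hi := ltn_ord i; rewrite /gsgn (@gres_uniq _ _ _ (-1)%R (n - i.+1)) //; try lia.
Qed.

Lemma jac2 n : odd n -> jac 2%:Z n = odd (n./2 - n./2./2).
Proof.
move=> on; rewrite /jac; have nE := odd_halfE on; set h := n./2 in nE *.
rewrite -(big_mkord xpredT (fun i => nat_of_bool (gsgn 2%:Z n i.+1))).
rewrite (@big_cat_nat _ _ _ h./2) //=; last by rewrite leq_half_double; lia.
rewrite big_nat big1 => [|i /andP[_ hi]]; last first.
  rewrite /gsgn (@gres_uniq _ _ _ 0%R (i.+1).*2) //; rewrite ?mul0r -/h; try lia.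
rewrite add0n big_nat (eq_bigr (fun=> 1)) => [|i /andP[h1 h2]].
  by rewrite -big_nat sum_nat_const_nat muln1.
rewrite /gsgn (@gres_uniq _ _ _ 0%R (i.+1).*2) //; rewrite -/h; try lia.
Qed.

(** Eisenstein's argument: as [a] and [n] are odd, [k] has the parity of the quotient plus the
    remainder of [a k] by [n], and folding changes the parity of the remainder exactly when [gsgn]
    holds. Summed over the half system, only quotients and signs survive. *)
Lemma jac_floor a n : odd n -> odd a -> coprime a n ->
  jac a%:Z n = odd (\sum_(i < n./2) (a * i.+1) %/ n).
Proof.
move=> on oa co; have ca : coprimez a%:Z n by [].
have nE := odd_halfE on.
have E : odd (\sum_(i < n./2) i.+1) =
   odd (\sum_(i < n./2) ((a * i.+1) %/ n)) (+) odd (\sum_(i < n./2) i.+1) (+) jac a%:Z n.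
  rewrite -{2}(gfold_reindex _ (fun k => k) on ca) /jac /=.
  have -> : odd (\sum_(i < n./2) i.+1) = odd (\sum_(i < n./2) a * i.+1).
    by rewrite -big_distrr oddM oa.
  rewrite -!oddD -!big_split /=; elim/big_rec2: _ => // i x y _ E.
  rewrite !oddD E; congr (_ (+) _).
  have hd := divn_eq (a * i.+1) n.
  have -> : gfold a%:Z n i.+1 = if n./2 < (a * i.+1) %% n then n - (a * i.+1) %% n else (a * i.+1) %% n.
    by rewrite /gfold /gsgn /gres -PoszM modz_nat.
  have -> : gsgn a%:Z n i.+1 = (n./2 < (a * i.+1) %% n).
    by rewrite /gsgn /gres -PoszM modz_nat.
  have hm : (a * i.+1) %% n < n by rewrite ltn_mod; case: (n) on.
  rewrite {1}hd oddD oddM on andbT.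
  case: ltnP => _; last by rewrite addbF.
  by rewrite oddB ?on 1?ltnW // -addbA [true (+) _]addbC -addbA addbb addbF.
by move: E; case: (odd (\sum_(i < n./2) i.+1)); case: (jac _ _); case: (odd _).
Qed.

(** Lattice points of a rectangle on the two sides of its diagonal; coprimality keeps the diagonal
    itself free of them. *)
Lemma lattice_count m n : odd m -> odd n -> coprime m n ->
  \sum_(i < n./2) (m * i.+1) %/ n + \sum_(j < m./2) (n * j.+1) %/ m = n./2 * m./2.
Proof.
move=> om on co; have mE := odd_halfE om; have nE := odd_halfE on.
have F a b (i : nat) : odd a -> odd b -> i < b./2 ->
   (a * i.+1) %/ b = \sum_(j < a./2) (b * j.+1 <= a * i.+1).
  move=> oa ob ib; have aE := odd_halfE oa; have bE := odd_halfE ob.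
  have b0 : 0 < b by case: (b) ob.
  have le : (a * i.+1) %/ b <= a./2.
    rewrite -ltnS ltn_divLR //; nia.
  rewrite -(big_mkord xpredT (fun j => nat_of_bool (b * j.+1 <= a * i.+1))).
  rewrite (@big_cat_nat _ _ _ ((a * i.+1) %/ b)) //= big_nat (eq_bigr (fun=> 1)) => [|j /andP[_ h]].
    rewrite -big_nat sum_nat_const_nat muln1 subn0 big_nat big1 ?addn0 // => j /andP[h _].
    by rewrite mulnC -leq_divRL // leqNgt ltnS h.
  by rewrite mulnC -leq_divRL // h.
have -> : \sum_(i < n./2) (m * i.+1) %/ n = \sum_(i < n./2) \sum_(j < m./2) (n * j.+1 <= m * i.+1).
  by apply: eq_bigr => i _; apply: F.
have -> : \sum_(i < m./2) (n * i.+1) %/ m = \sum_(i < m./2) \sum_(j < n./2) (m * j.+1 <= n * i.+1).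
  by apply: eq_bigr => i _; apply: F.
rewrite [X in _ + X]exchange_big -big_split /=.
rewrite (eq_bigr (fun=> m./2)) => [|i _]; first by rewrite sum_nat_const card_ord.
rewrite -big_split /= (eq_bigr (fun=> 1)) => [|j _]; first by rewrite sum1_card card_ord.
have hi := ltn_ord i; have hj := ltn_ord j.
case: (ltngtP (n * j.+1) (m * i.+1)) => // E.
have : n %| i.+1 by rewrite -(Gauss_dvdr _ (_ : coprime n m)) 1?coprime_sym // -E dvdn_mulr.
by move/(dvdn_leq (ltn0Sn _)); lia.
Qed.

Lemma jac_recip m n : odd m -> odd n -> coprime m n ->
  jac m%:Z n (+) jac n%:Z m = odd (m./2) && odd (n./2).
Proof.
move=> om on co; rewrite !jac_floor // 1?coprime_sym //.
by rewrite -oddD lattice_count // oddM andbC.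
Qed.

(** Both sides are compared after multiplication by the product of the half system, which is
    invertible modulo [p] and permuted by folding. *)
Lemma gauss_lemma p (a : int) : prime p -> odd p -> coprimez a p ->
  (a%:~R ^+ p./2 = (-1) ^+ jac a p :> 'F_p)%R.
Proof.
move=> pp op ca; have cp := pchar_Fp pp.
have h0 : (\prod_(i < p./2) (i.+1%:R : 'F_p) != 0)%R.
  apply/prodf_neq0 => i _; rewrite -(dvdn_pcharf cp); apply/negP => /(dvdn_leq (ltn0Sn _)).
  by have := ltn_ord i; have := odd_halfE op; lia.
apply: (mulIf h0); rewrite -[X in (_ = _ * X)%R](gfold_reindex _ (fun k => k%:R : 'F_p)%R op ca) /=.
have -> : (a%:~R ^+ p./2 = \prod_(i < p./2) a%:~R :> 'F_p)%R by rewrite prodr_const card_ord.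
have -> : ((-1) ^+ jac a p = \prod_(i < p./2) (-1) ^+ gsgn a p i.+1 :> 'F_p)%R.
  by rewrite prodrXr /jac signr_odd.
rewrite -!big_split /=; apply: eq_bigr => i _.
have [q] := gfold_spec a i.+1 op; move/(congr1 (fun z : int => z%:~R : 'F_p)%R).
rewrite intrM rmorphD !rmorphM /= rmorphXn rmorphN rmorph1 /= => ->.
by rewrite -[((Posz p)%:~R)%R]/(p%:R)%R (pcharf0 cp) mulr0 add0r.
Qed.

(** Write [x] as a power of a primitive root: the hypothesis makes the exponent even. *)
Lemma Fp_square_of_half p (x : 'F_p) : prime p -> odd p ->
  (x ^+ p./2 = 1)%R -> exists y : 'F_p, (y ^+ 2 = x)%R.
Proof.
move=> pp op xh; have pE := odd_halfE op; have p1 := prime_gt1 pp.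
pose rs := enum (predC1 (0%R : 'F_p)).
have size_rs : size rs = p.-1 by rewrite -cardE cardC1 card_Fp.
have x0 : (x != 0)%R.
  by apply/eqP => x0; move: xh; rewrite x0 expr0n; case: (p./2) pE p1 => [|k _ _ /eqP]; [lia|rewrite eq_sym oner_eq0].
have /hasP[z _ prz] : has p.-1.-primitive_root%R rs.
  apply: has_prim_root; [by lia| | |by rewrite size_rs].
  apply/allP => y; rewrite mem_enum => y0; rewrite unity_rootE -(inj_eq (mulfI y0)) -exprS mulr1.
    by rewrite prednK ?prime_gt0 // -[X in (_ ^+ X)%R](card_Fp pp) expf_card.
  exact: enum_uniq.
have xp : (x ^+ p.-1 = 1)%R by have -> : p.-1 = p./2 * 2 by [lia]; rewrite exprM xh expr1n.
have [[i hi] /= xi] := prim_rootP prz xp; clear hi.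
have : p.-1 %| i * p./2 by rewrite (prim_order_dvd prz) exprM -xi xh.
have -> : p.-1 = 2 * p./2 by lia.
rewrite dvdn_pmul2r; last by lia.
rewrite dvdn2 => ei; exists (z ^+ i./2)%R.
by rewrite -exprM muln2 even_halfK // -xi.
Qed.

Lemma jac_prime p (a : int) : prime p -> odd p -> coprimez a p -> jac a p = false ->
  exists x : int, (x ^+ 2 = a %[mod Posz p])%Z.
Proof.
move=> pp op ca ja; have := gauss_lemma pp op ca; rewrite ja expr0 => /(Fp_square_of_half pp op).
case=> y Ey; exists (Posz (val y)).
have cp := pchar_Fp pp.
apply/eqP; rewrite eqz_mod_dvd (dvdz_pcharf cp) rmorphB rmorphXn /= -Ey.
have -> : ((Posz (val y))%:~R = y :> 'F_p)%R.
  by rewrite -[LHS]/((val y)%:R)%R natr_Zp.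
by rewrite subrr.
Qed.

End JacobiSymbol.

(** * Periodicity in the denominator, and moduli with [- E] a square *)

Module SplitRepresentative.
Import ZArith all_boot all_order all_algebra all_field cyclic realalg zify ring lra RealCharacters HarmonicProgression TwoClasses JacobiSymbol.
Set Implicit Arguments. Unset Strict Implicit. Unset Printing Implicit Defensive.
Import Order.TTheory GRing.Theory Num.Theory.
Local Open Scope nat_scope.

Lemma coprime1z n : coprimez 1%R n.
Proof. by rewrite coprimezE coprime1n. Qed.

Lemma coprimeNz m n : coprimez (- m)%R n = coprimez m n.
Proof. by rewrite coprimezE abszN. Qed.

(** [par4] and [par8] are the exponents of the symbols of -1 and of 2 at an odd [n]. *)
Definition par4 (n : nat) : bool := n %% 4 == 3.
Definition par8 (n : nat) : bool := (n %% 8 == 3) || (n %% 8 == 5).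

Lemma odd_mod8 n : odd n -> [\/ n %% 8 = 1, n %% 8 = 3, n %% 8 = 5 | n %% 8 = 7].
Proof.
move=> on; have : n %% 8 < 8 by rewrite ltn_mod.
have : odd (n %% 8) by rewrite odd_mod.
by case: (n %% 8) => [|[|[|[|[|[|[|[|k]]]]]]]] //; constructor.
Qed.

Lemma par4E n : odd n -> odd n./2 = par4 n.
Proof. by move=> on; rewrite /par4; apply/idP/eqP; lia. Qed.

Lemma par8E n : odd n -> odd (n./2 - n./2./2) = par8 n.
Proof.
move=> on; rewrite /par8; have h := divn_eq n 8; set q := n %/ 8 in h.
have [E|E|E|E] := odd_mod8 on; rewrite E /= in h *; lia.
Qed.

Lemma par4_mod8 n : par4 n = par4 (n %% 8).
Proof. by rewrite /par4 modn_dvdm. Qed.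

Lemma par8_mod8 n : par8 n = par8 (n %% 8).
Proof. by rewrite /par8 modn_mod. Qed.

Lemma parM m n : odd m -> odd n ->
  par4 (m * n) = par4 m (+) par4 n /\ par8 (m * n) = par8 m (+) par8 n.
Proof.
move=> om on; rewrite !(par4_mod8 (m * n), par8_mod8 (m * n), par4_mod8 m, par8_mod8 m, par4_mod8 n, par8_mod8 n).
rewrite -modnMm.
by case: (odd_mod8 om) => ->; case: (odd_mod8 on) => ->.
Qed.

Lemma int_decomp (a : int) : (a != 0)%R -> exists (s : bool) (e b : nat),
  odd b /\ (a = (-1) ^+ s * 2%:Z ^+ e * b%:Z)%R.
Proof.
move=> a0; exists (a < 0)%R, (logn 2 `|a|), (`|a|)`_2^'.
have n0 : 0 < `|a| by rewrite absz_gt0.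
split; first by rewrite -[odd _]negbK -dvdn2 -p'natE ?part_pnat.
rewrite -mulrA.
have -> : (2%:Z ^+ logn 2 `|a| * Posz (`|a|`_2^')%N = `|a|%:Z)%R.
  by rewrite -[Posz 2]natz -natrX natz -PoszM -p_part partnC.
by rewrite {1}[a]intEsign.
Qed.

Lemma jac_decomp (s : bool) e b n : odd n -> coprimez ((-1) ^+ s * 2%:Z ^+ e * b%:Z)%R n ->
  jac ((-1) ^+ s * 2%:Z ^+ e * b%:Z)%R n = (s && par4 n) (+) ((odd e && par8 n) (+) jac b%:Z n).
Proof.
move=> on; rewrite !coprimezMl => /andP[/andP[c1 c2] c3].
rewrite !jacM ?coprimezMl ?c1 ?c2 // -addbA; congr (_ (+) (_ (+) _)).
  have j1 : jac 1%R n = false by rewrite -(expr1n _ 2) jac_sqr // coprime1z.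
  by case: s {c1} => /=; rewrite ?expr1 ?expr0 // jacN1 // par4E.
have c2n : coprimez 2%:Z n by rewrite coprimezE coprime2n.
elim: e {c2} => [|e IH].
  by rewrite expr0 -(expr1n _ 2) jac_sqr // coprime1z.
rewrite exprS jacM // ?coprimezXl // IH jac2 // par8E //=.
by case: (par8 n); case: (odd e).
Qed.

Lemma coprimez_odd_part (a : int) n (s : bool) e b : odd n -> (a = (-1) ^+ s * 2%:Z ^+ e * b%:Z)%R ->
  coprimez a n -> coprime b n.
Proof. by move=> _ ->; rewrite coprimezMl => /andP[]. Qed.

(** The symbol is visibly periodic in [a], whereas a character modulo [W] needs periodicity in [n].
    Once the sign and the power of 2 are split off, reciprocity exchanges the two roles. *)
Lemma jac_period (a : int) n n' : odd n -> odd n' -> (a != 0)%R -> coprimez a n -> coprimez a n' ->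
  n = n' %[mod 8 * `|a|] -> jac a n = jac a n'.
Proof.
move=> on on' a0 ca ca' E; have [s [e [b [ob Ea]]]] := int_decomp a0.
have cb := coprimez_odd_part on Ea ca; have cb' := coprimez_odd_part on' Ea ca'.
rewrite Ea in ca ca' *; rewrite !jac_decomp //.
have E8 : n = n' %[mod 8].
  by rewrite -(modn_dvdm n (dvdn_mulr `|a| (dvdnn 8))) E modn_dvdm // dvdn_mulr.
have Eb : n = n' %[mod b].
  have d : b %| 8 * `|a|.
    by rewrite Ea abszM dvdn_mull // dvdn_mull.
  by rewrite -(modn_dvdm n d) E modn_dvdm.
congr (_ (+) (_ (+) _)).
- by rewrite par4_mod8 E8 -par4_mod8.
- by rewrite par8_mod8 E8 -par8_mod8.
have r1 := jac_recip ob on cb; have r2 := jac_recip ob on' cb'.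
have Ej : jac n%:Z b = jac n'%:Z b by apply: jac_mod; rewrite !modz_nat Eb.
have E4 : odd n./2 = odd n'./2 by rewrite !par4E // par4_mod8 E8 -par4_mod8.
by move: r1 r2; rewrite Ej E4 => <- /addIb.
Qed.

(** Reciprocity for the odd part of [a] reduces this to multiplicativity in the numerator. *)
Lemma jac_mulr (a : int) m n : odd m -> odd n -> (a != 0)%R -> coprimez a m -> coprimez a n ->
  jac a (m * n) = jac a m (+) jac a n.
Proof.
move=> om on a0 ca ca'; have [s [e [b [ob Ea]]]] := int_decomp a0.
have cb := coprimez_odd_part om Ea ca; have cb' := coprimez_odd_part on Ea ca'.
have omn : odd (m * n) by rewrite oddM om.
have camn : coprimez a (m * n)%N by rewrite PoszM coprimezMr ca.
have cbmn : coprime b (m * n) by rewrite coprimeMr cb.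
rewrite Ea in ca ca' camn *; rewrite !jac_decomp //.
have [-> ->] := parM om on.
have r1 := jac_recip ob om cb; have r2 := jac_recip ob on cb'.
have r3 := jac_recip ob omn cbmn.
rewrite PoszM jacM // in r3; try by rewrite coprimez_sym.
move: r1 r2 r3; rewrite !par4E //; have [-> _] := parM om on.
case: (jac b m); case: (jac b n); case: (jac b (m * n)%N); case: (jac m b); case: (jac n b);
  case: (par4 b); case: (par4 m); case: (par4 n) => //=;
  case: (odd e); case: (par8 m); case: (par8 n); case: s {Ea ca ca' camn} => //.
Qed.

(** One prime [p] is split off at a time. If it does not divide the cofactor, the Chinese remainder
    theorem combines the two roots; if it does, the root for the cofactor is improved. *)
Lemma sqrt_mod_lift (E : int) u : odd u -> coprimez E u ->
  (forall p, prime p -> p %| u -> exists x : int, (p%:Z %| (x ^+ 2 + E)%R)%Z) ->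
  exists x : int, (u%:Z %| (x ^+ 2 + E)%R)%Z.
Proof.
have [k] := ubnP u; elim: k u => // k IH u ltk ou cu hp.
have u0 : 0 < u by case: (u) ou.
have [u1|u1] := leqP u 1.
  by exists 0%R; have -> : u = 1 by [lia]; rewrite dvd1z.
set p := pdiv u; have pp : prime p by apply: pdiv_prime.
have pu : p %| u := pdiv_dvd u; have [m Em] := dvdnP pu.
have m0 : 0 < m by move: u0; rewrite Em muln_gt0 => /andP[].
have om : odd m by move: ou; rewrite Em oddM => /andP[].
have op : odd p by move: ou; rewrite Em oddM => /andP[].
have cm : coprimez E m by move: cu; rewrite Em PoszM coprimezMr => /andP[].
have cp : coprimez E p by move: cu; rewrite Em PoszM coprimezMr => /andP[].
have mk : m < k.
  have : m * 2 <= u; last by lia.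
  by rewrite Em leq_mul // prime_gt1.
have mu : m %| u by rewrite Em dvdn_mulr.
have [x /dvdzP[q Ex]] := IH m mk om cm (fun p' pp' pm => hp p' pp' (dvdn_trans pm mu)).
have [xp hxp] := hp p pp pu.
have c2p : coprimez 2%:Z p by rewrite coprimezE coprime2n.
have [pm|pm] := boolP (p %| m); last first.
  have cpm : coprimez p m by rewrite coprimezE /= prime_coprime.
  exists (zchinese p m xp x); rewrite Em mulnC PoszM Gauss_dvdz //.
  apply/andP; split.
    have := zchinese_modl cpm xp x; move/eqP; rewrite eqz_mod_dvd => h.
    have -> : (zchinese p m xp x ^+ 2 + E = (xp ^+ 2 + E) +
        (zchinese p m xp x - xp) * (zchinese p m xp x + xp))%R by ring.
    by rewrite rpredD // dvdz_mulr.
  have := zchinese_modr cpm xp x; move/eqP; rewrite eqz_mod_dvd => h.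
  have -> : (zchinese p m xp x ^+ 2 + E = (x ^+ 2 + E) +
      (zchinese p m xp x - x) * (zchinese p m xp x + x))%R by ring.
  by rewrite rpredD // ?dvdz_mulr // Ex dvdz_mull.
have cx : coprimez (2%:Z * x)%R p.
  rewrite coprimezMl c2p /= coprimez_sym coprimezE /= prime_coprime //; apply/negP => px.
  have : (p%:Z %| E)%Z.
    have -> : E = (q * m%:Z - x * x)%R by rewrite -Ex; ring.
    by rewrite rpredB // dvdz_mull.
  move=> pE; have : (p%:Z %| gcdz E p)%Z by rewrite dvdz_gcd pE dvdzz.
  by rewrite (eqP cp) dvdz1 /= => /eqP p1; move: pp; rewrite p1.
have [[a b] /= Eab] := coprimezP _ _ cx.
have [m' Em'] := dvdnP pm.
(* Newton step: [a] inverts [2 x] modulo [p], and since [p] divides [m] the quadratic error is a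
   multiple of [p m]. *)
exists (x - m%:Z * (a * q))%R; rewrite Em mulnC PoszM.
have -> : ((x - m%:Z * (a * q)) ^+ 2 + E = p%:Z * m%:Z * (b * q + m'%:Z * (a * q) ^+ 2))%R.
  have -> : ((x - m%:Z * (a * q)) ^+ 2 + E = (x ^+ 2 + E) - a * (2%:Z * x) * m%:Z * q +  m%:Z * m%:Z * (a * q) ^+ 2)%R by ring.
  have -> : (a * (2%:Z * x) = 1 - b * p%:Z)%R by rewrite -Eab; ring.
  by rewrite Ex {3}Em' PoszM; ring.
by rewrite dvdz_mulr.
Qed.

(** By periodicity the symbol of [- E] is a real character modulo [W]. The prime factors of the [u]
    given by [split_class_char1] have symbol 1, so [- E] is a square modulo each of them and hence
    modulo [u]. *)
Lemma split_representative E W w : 0 < E -> 8 * E %| W -> 0 < W -> coprime w W ->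
  jac (- E%:Z)%R w = false ->
  exists u t, [/\ 0 < u, coprime u W, coprime t W, u = w * t ^ 2 %[mod W] &
    exists x : int, (u%:Z %| (x ^+ 2 + E%:Z)%R)%Z].
Proof.
move=> E0 dW W0 cw jw.
have EW : E %| W by apply: dvdn_trans dW; rewrite dvdn_mull.
have unit n : coprime n W -> odd n /\ coprimez (- E%:Z)%R n.
  move=> cn; split.
    rewrite -[odd n]negbK -dvdn2; apply/negP => n2.
    have : 2 %| gcdn n W by rewrite dvdn_gcd n2 (dvdn_trans _ dW) // dvdn_mulr.
    by rewrite (eqP cn).
  by rewrite coprimeNz coprimez_sym coprimezE /= (coprime_dvdr EW).
have EN0 : (- E%:Z != 0)%R by rewrite oppr_eq0 eqz_nat -lt0n.
pose c n : realalg := (if coprime n W then (-1) ^+ jac (- E%:Z)%R n else 0)%R.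
have hc : real_char W c.
  split.
  - rewrite /c coprime1n; case: (jac _ _) (jac_mulr (m := 1) (n := 1) isT isT EN0) => //.
    by rewrite coprimezE coprimen1 => /(_ isT isT).
  - move=> m n; rewrite /c coprimeMl; case cm: (coprime m W); rewrite ?mul0r //=.
    case cn: (coprime n W); rewrite ?mulr0 //.
    have [om em] := unit _ cm; have [on en] := unit _ cn.
    by rewrite jac_mulr // signr_addb.
  - move=> n; rewrite /c.
    have -> : coprime (n + W) W = coprime n W by rewrite [LHS]coprime_sym /coprime gcdnDr gcdnC.
    case cn: (coprime n W) => //; have [on en] := unit _ cn.
    have cnW : coprime (n + W) W by rewrite coprime_sym /coprime gcdnDr gcdnC.
    have [onW enW] := unit _ cnW; congr ((-1) ^+ nat_of_bool _)%R; apply: jac_period => //.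
    by rewrite abszN /= -(modnDmr n) (eqP dW) addn0.
  - by move=> n; rewrite /c => ->; case: (jac _ _); auto.
  - by move=> n; rewrite /c => /negbTE ->.
have [u [t [u0 ct cu Eu hu]]] : split_class W c w.
  by apply: split_class_char1 => //; rewrite /c cw jw.
exists u, t; split=> //; have [ou eu] := unit _ cu.
apply: sqrt_mod_lift => //; first by rewrite -coprimeNz.
move=> p pp pu; have cp : coprime p W by apply: coprime_dvdl pu cu.
have [op ep] := unit _ cp.
have jp : jac (- E%:Z)%R p = false.
  have := hu p pp pu; rewrite /c cp; case: (jac _ _) => // /eqP.
  by rewrite expr1 eq_sym -subr_eq0 opprK -mulr2n pnatr_eq0.
have [x /eqP Ex] := jac_prime pp op ep jp.
by exists x; move: Ex; rewrite eqz_mod_dvd opprK.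
Qed.

End SplitRepresentative.

(** * The auxiliary modulus of Ankeny's argument *)

Module AnkenyClass.
Import ZArith Znumtheory all_boot all_order all_algebra all_field zify ssrZ ring lra RealCharacters HarmonicProgression TwoClasses JacobiSymbol SplitRepresentative.
Set Implicit Arguments. Unset Strict Implicit. Unset Printing Implicit Defensive.
Import Order.TTheory GRing.Theory Num.Theory.
Local Open Scope nat_scope.

Lemma jac_of_sqrt (E x : int) n : odd n -> coprimez E n ->
  (n%:Z %| (x ^+ 2 + E)%R)%Z -> jac (- E)%R n = false.
Proof.
move=> on cE h.
have Em : (- E = x ^+ 2 %[mod n%:Z])%Z.
  apply/eqP; rewrite eqz_mod_dvd -rpredN; suff -> : (- (- E - x ^+ 2) = x ^+ 2 + E)%R by [].
  by ring.
rewrite (jac_mod Em) jac_sqr //.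
rewrite coprimez_sym -(@coprimez_pexpr 2) // coprimezE.
have /eqP : (gcdz n (x ^+ 2)%R = gcdz n E).
  have /dvdzP[q Eq] := h.
  have -> : (x ^+ 2 = q * n%:Z + - E)%R by rewrite -Eq; ring.
  by rewrite gcdzMDl gcdzN.
by rewrite coprimez_sym in cE; rewrite (eqP cE) => /eqP [] /eqP.
Qed.

Lemma dvdz_succ_of_mod k D : 0 < D -> k %% D = D - 1 -> (Posz D %| (Posz k + 1)%R)%Z.
Proof.
move=> D0 E; apply/dvdzP; exists (Posz (k %/ D).+1).
by have := divn_eq k D; rewrite E; move: (k %/ D) => q; nia.
Qed.

(** Relations known for the pair [n1], [u] are transferred to [D1] and a new [u']. The class of [u']
    is prescribed, up to a common square, as [u] modulo [M] and [- 1 / g] modulo [D1]; reciprocity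
    shows that this class [w] has the symbol that [split_representative] asks for. *)
Lemma ankeny_class_nat (M D1 n1 g B u : nat) (x y : int) :
  0 < M -> 0 < D1 -> 0 < g -> 0 < B -> 8 * B %| M -> 8 * g %| M ->
  coprime D1 M -> coprime n1 M -> coprime u M -> coprime u n1 ->
  D1 = n1 %[mod 8 * g] ->
  (u%:Z %| (x ^+ 2 + n1%:Z * B%:Z)%R)%Z -> (n1%:Z %| (y ^+ 2 + g%:Z * u%:Z)%R)%Z ->
  exists u' t, [/\ 0 < u', coprime u' (M * D1), coprime t (M * D1),
     u' = u * t ^ 2 %[mod M] & D1 %| g * u' + t ^ 2 ] /\
     exists x' : int, (u'%:Z %| (x' ^+ 2 + D1%:Z * B%:Z)%R)%Z.
Proof.
move=> M0 D0 g0 B0 dB dg cD cn cu cun ED hx hy.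
have two_odd n : coprime n M -> odd n.
  move=> c; rewrite -[odd n]negbK -dvdn2; apply/negP => n2.
  have : 2 %| gcdn n M by rewrite dvdn_gcd n2 (dvdn_trans _ dB) // dvdn_mulr.
  by rewrite (eqP c).
have [oD on ou] := And3 (two_odd _ cD) (two_odd _ cn) (two_odd _ cu).
have gM : g %| M by apply: dvdn_trans dg; rewrite dvdn_mull.
have BM : B %| M by apply: dvdn_trans dB; rewrite dvdn_mull.
have cgD : coprime g D1 by rewrite coprime_sym; apply: coprime_dvdr gM cD.
have cgn : coprime g n1 by rewrite coprime_sym; apply: coprime_dvdr gM cn.
have cBu : coprime B u by rewrite coprime_sym; apply: coprime_dvdr BM cu.
have [gi cgi Egi] := coprime_inverse_mod D0 cgD.
pose a := gi * (D1 - 1).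
have Ega : g * a = D1 - 1 %[mod D1] by rewrite /a mulnA -modnMml Egi modnMml mul1n.
have cMD : coprime M D1 by rewrite coprime_sym.
pose w := chinese M D1 u a.
have wM : w = u %[mod M] by apply: chinese_modl.
have wD : w = a %[mod D1] by apply: chinese_modr.
have gw : g * w = D1 - 1 %[mod D1] by rewrite -modnMmr wD modnMmr.
have cwM : coprime w M by rewrite -coprime_modl wM coprime_modl.
have cwD : coprime w D1.
  suff : coprime (g * w) D1 by rewrite coprimeMl => /andP[].
  by rewrite -coprime_modl gw coprime_modl subn1 coprime_sym coprimenP.
have ow := two_odd _ cwM.
have W0 : 0 < M * D1 by rewrite muln_gt0 M0.
have ga : (g%:Z * w%:Z = - 1 %[mod D1%:Z])%Z.
  rewrite -PoszM; apply/eqP; rewrite eqz_mod_dvd opprK.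
  by apply: dvdz_succ_of_mod => //; rewrite gw modn_small // subn1 ltn_predL.
have jw : jac (- (D1 * B)%:Z)%R w = false.
  have cDw : coprimez D1%:Z w by rewrite coprimez_sym.
  have cBw : coprimez (- B%:Z)%R w by rewrite coprimeNz coprimezE /= coprime_sym (coprime_dvdr BM).
  have cBu' : coprimez (- B%:Z)%R u by rewrite coprimeNz.
  have cnu : coprimez n1%:Z u by rewrite coprimez_sym.
  (* The symbol wanted at [w] and its known counterpart at [u] split into symbols that correspond by
     periodicity. The two reciprocity signs are equal because [D1], [n1] and likewise [w], [u] agree
     modulo 8. *)
  have e1 : jac (- (D1 * B)%:Z)%R w = jac (- B%:Z)%R w (+) jac D1%:Z w.
    by rewrite -jacM // PoszM; congr jac; ring.
  have e2 : false = jac (- B%:Z)%R u (+) jac n1%:Z u.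
    rewrite -jacM // -(jac_of_sqrt ou _ hx) ?coprimezMl ?cnu //.
    by congr jac; ring.
  have BN0 : (- B%:Z != 0)%R by rewrite oppr_eq0 eqz_nat -lt0n.
  have e3 : jac (- B%:Z)%R w = jac (- B%:Z)%R u.
    apply: jac_period => //; rewrite abszN /=.
    by rewrite -(modn_dvdm w dB) wM modn_dvdm.
  have gN0 : (- g%:Z != 0)%R by rewrite oppr_eq0 eqz_nat -lt0n.
  have cgD' : coprimez (- g%:Z)%R D1 by rewrite coprimeNz.
  have cgn' : coprimez (- g%:Z)%R n1 by rewrite coprimeNz.
  have e4 : jac (- g%:Z)%R D1 = jac (- g%:Z)%R n1 by apply: jac_period => //; rewrite abszN.
  have e5 : false = jac (- g%:Z)%R n1 (+) jac u%:Z n1.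
    have cgu : coprimez (g%:Z * u%:Z)%R n1 by rewrite coprimezMl !coprimezE /= cgn cun.
    rewrite -jacM // -(jac_of_sqrt on cgu hy).
    by congr jac; ring.
  have e6 : false = jac (- g%:Z)%R D1 (+) jac w%:Z D1.
    rewrite -jacM // -(jac_sqr oD (coprime1z _)); apply: jac_mod.
    rewrite expr1n mulNr; apply/eqP; rewrite eqz_mod_dvd.
    by move/eqP: ga; rewrite eqz_mod_dvd opprK [in X in _ -> X]opprK addrC.
  have r1 := jac_recip oD ow (_ : coprime D1 w); rewrite coprime_sym in r1; have {}r1 := r1 cwD.
  have r2 := jac_recip on ou (_ : coprime n1 u); rewrite coprime_sym in r2; have {}r2 := r2 cun.
  have p8 m n : m = n %[mod 8] -> par4 m = par4 n by move=> E; rewrite par4_mod8 E -par4_mod8.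
  have q1 : par4 D1 = par4 n1.
    by apply: p8; rewrite -(modn_dvdm D1 (dvdn_mulr g (dvdnn 8))) ED modn_dvdm // dvdn_mulr.
  have q2 : par4 w = par4 u.
    apply: p8; have d8 : 8 %| M by apply: dvdn_trans dB; rewrite dvdn_mulr.
    by rewrite -(modn_dvdm w d8) wM modn_dvdm.
  rewrite !par4E // q1 q2 in r1 r2.
  move: e1 e2 e5 e6 r1 r2; rewrite e3 e4 => ->.
  case: (jac _ u); case: (jac _ w); case: (jac _ u); case: (jac _ n1); case: (jac _ n1);
    case: (jac _ D1); case: (_ && _) => //.
have EB0 : 0 < D1 * B by rewrite muln_gt0 D0.
have dW : 8 * (D1 * B) %| M * D1 by rewrite mulnCA mulnC dvdn_mul.
have cwW : coprime w (M * D1) by rewrite coprimeMr cwM.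
have [u' [t [u'0 cu' ct Eu' [x' hx']]]] := split_representative EB0 dW W0 cwW jw.
exists u', t; split; last by exists x'; rewrite -PoszM.
split=> //.
  by rewrite -(modn_dvdm u' (dvdn_mulr D1 (dvdnn M))) Eu' modn_dvdm ?dvdn_mulr // -modnMml wM modnMml.
have E1 : u' = w * t ^ 2 %[mod D1].
  by rewrite -(modn_dvdm u' (dvdn_mull M (dvdnn D1))) Eu' modn_dvdm // dvdn_mull.
rewrite /dvdn -modnDml -modnMmr E1 modnMmr modnDml mulnA -modnDml -modnMml gw modnMml modnDml.
by rewrite -{2}[t ^ 2]mul1n -mulnDl subnK // modnMr.
Qed.

Lemma of_nat_dvd (a b : nat) : (Z.divide (Z.of_nat a) (Z.of_nat b)) <-> a %| b.
Proof.
split=> [[q E]|/dvdnP[q ->]]; last by exists (Z.of_nat q); lia.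
have [b0|b0] := posnP b; first by rewrite b0 dvdn0.
have q0 : Z.le 0 q by nia.
by apply/dvdnP; exists (Z.to_nat q); lia.
Qed.

Lemma of_nat_coprime (a b : nat) : Z.gcd (Z.of_nat a) (Z.of_nat b) = Zpos xH <-> coprime a b.
Proof.
split=> h.
  rewrite /coprime -dvdn1; apply/of_nat_dvd; rewrite -[Z.of_nat 1]h.
  by apply: Z.gcd_greatest; apply/of_nat_dvd; [apply: dvdn_gcdl|apply: dvdn_gcdr].
have g0 := Z.gcd_nonneg (Z.of_nat a) (Z.of_nat b).
have [[da Ea] [db Eb]] := (Z.gcd_divide_l (Z.of_nat a) (Z.of_nat b), Z.gcd_divide_r (Z.of_nat a) (Z.of_nat b)).
move: g0 Ea Eb; move: (Z.gcd _ _) => g g0 Ea Eb.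
have [G EG] : exists G, g = Z.of_nat G by exists (Z.to_nat g); lia.
have : G %| gcdn a b.
  by rewrite dvdn_gcd; apply/andP; split; apply/of_nat_dvd; rewrite -EG; [exists da|exists db].
by rewrite (eqP h) dvdn1 => /eqP G1; rewrite EG G1.
Qed.

Lemma of_int_dvd (a : nat) (x : int) : (a%:Z %| x)%Z <-> Z.divide (Z.of_nat a) (Z_of_int x).
Proof.
split=> [/dvdzP[q ->]|[q E]]; first by exists (Z_of_int q); lia.
by apply/dvdzP; exists (int_of_Z q); lia.
Qed.

Local Close Scope nat_scope.
Local Open Scope Z_scope.

Lemma ankeny_class (M D1 n1 g B u x y : Z) :
  (0 < M -> 0 < D1 -> 0 < n1 -> 0 < g -> 0 < B -> 0 < u -> (8 * B | M) -> (8 * g | M) ->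
  Z.gcd D1 M = 1 -> Z.gcd n1 M = 1 -> Z.gcd u M = 1 -> Z.gcd u n1 = 1 ->
  (8 * g | D1 - n1) -> (u | x * x + n1 * B) -> (n1 | y * y + g * u) ->
  exists u' t x', 0 < u' /\ Z.gcd u' (M * D1) = 1 /\ Z.gcd t (M * D1) = 1 /\
    (M | u' - u * (t * t)) /\ (D1 | g * u' + t * t) /\ (u' | x' * x' + D1 * B)).
Proof.
have nat_of z : 0 < z -> exists2 n : nat, z = Z.of_nat n & (0 < n)%N.
  by move=> z0; exists (Z.to_nat z); lia.
move=> /nat_of[M' -> M0] /nat_of[D1' -> D0] /nat_of[n1' -> n0] /nat_of[g' -> g0].
move=> /nat_of[B' -> B0] /nat_of[u'' -> u0] dB dg /of_nat_coprime cD /of_nat_coprime cn.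
move=> /of_nat_coprime cu /of_nat_coprime cun ED hx hy.
have e8 b : 8 * Z.of_nat b = Z.of_nat (8 * b)%N by lia.
rewrite !e8 in dB dg ED; move/of_nat_dvd in dB; move/of_nat_dvd in dg.
have ED' : (D1' = n1' %[mod 8 * g'])%N.
  have : ((8 * g')%N%:Z %| (D1'%:Z - n1'%:Z)%R)%Z.
    by apply/of_int_dvd; have -> : Z_of_int (D1'%:Z - n1'%:Z)%R = Z.of_nat D1' - Z.of_nat n1' by lia.
  by rewrite -eqz_mod_dvd !modz_nat => /eqP [].
have {}hx : (u''%:Z %| (int_of_Z x ^+ 2 + n1'%:Z * B'%:Z)%R)%Z.
  by apply/of_int_dvd; have -> : Z_of_int (int_of_Z x ^+ 2 + n1'%:Z * B'%:Z)%R = x * x + Z.of_nat n1' * Z.of_nat B' by lia.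
have {}hy : (n1'%:Z %| (int_of_Z y ^+ 2 + g'%:Z * u''%:Z)%R)%Z.
  by apply/of_int_dvd; have -> : Z_of_int (int_of_Z y ^+ 2 + g'%:Z * u''%:Z)%R = y * y + Z.of_nat g' * Z.of_nat u'' by lia.
have [u' [t [[u'0 cu' ct Eu' dD] [x' hx']]]] :=
  ankeny_class_nat M0 D0 g0 B0 dB dg cD cn cu cun ED' hx hy.
exists (Z.of_nat u'), (Z.of_nat t), (Z_of_int x'); split; first by lia.
have eM : Z.of_nat M' * Z.of_nat D1' = Z.of_nat (M' * D1')%N by lia.
rewrite eM; split; first by apply/of_nat_coprime.
split; first by apply/of_nat_coprime.
split.
  have : (M'%:Z %| (u'%:Z - (u'' * t ^ 2)%N%:Z)%R)%Z by rewrite -eqz_mod_dvd !modz_nat Eu'.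
  move/of_int_dvd; have -> // : Z_of_int (u'%:Z - (u'' * t ^ 2)%N%:Z)%R =
    Z.of_nat u' - Z.of_nat u'' * (Z.of_nat t * Z.of_nat t) by lia.
split.
  have -> : Z.of_nat g' * Z.of_nat u' + Z.of_nat t * Z.of_nat t = Z.of_nat (g' * u' + t ^ 2)%N by lia.
  by apply/of_nat_dvd.
move/of_int_dvd: hx'; have -> // : Z_of_int (x' ^+ 2 + D1'%:Z * B'%:Z)%R =
  Z_of_int x' * Z_of_int x' + Z.of_nat D1' * Z.of_nat B' by lia.
Qed.

End AnkenyClass.

(** * Ternary quadratic forms and values prime to a given number *)

Module TernaryForms.
Import ZArith Znumtheory Lia all_boot all_order all_algebra zify AnkenyClass.
Set Implicit Arguments. Unset Strict Implicit. Unset Printing Implicit Defensive.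
Local Close Scope nat_scope.
Local Open Scope Z_scope.

Lemma prime_divisor n : 1 < n -> exists p, Znumtheory.prime p /\ (p | n).
Proof.
move=> n1; have n0 : 0 <= n by lia.
move: n n0 n1; apply: (Z_lt_induction (fun n => 1 < n -> exists p, Znumtheory.prime p /\ (p | n))).
move=> n IH n1; case: (prime_dec n) => [pn|npn]; first by exists n; split=> //; exists 1; lia.
have [k [hk kn]] := not_prime_divide n n1 npn.
have [p [pp pk]] := IH k ltac:(lia) ltac:(lia).
by exists p; split=> //; apply: Z.divide_trans pk kn.
Qed.

Lemma rel_prime_by_primes a b : b <> 0 ->
  (forall p, Znumtheory.prime p -> (p | a) -> (p | b) -> False) -> rel_prime a b.
Proof.
move=> b0 h; apply/Zgcd_1_rel_prime.
have g0 := Z.gcd_nonneg a b; have gz : Z.gcd a b <> 0 by move/Z.gcd_eq_0_r.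
case: (Z_lt_dec 1 (Z.gcd a b)) => [g1|]; last by lia.
have [p [pp pg]] := prime_divisor g1; case: (h p pp).
  by apply: Z.divide_trans pg (Z.gcd_divide_l a b).
by apply: Z.divide_trans pg (Z.gcd_divide_r a b).
Qed.

Lemma rel_prime_prime a b p : rel_prime a b -> Znumtheory.prime p -> (p | a) -> (p | b) -> False.
Proof.
move=> [_ _ h] pp pa pb; have := h p pa pb; have := prime_ge_2 p pp => p2 /Z.divide_1_r_nonneg.
by lia.
Qed.

(** The gcd with [a] is divided out of [N] and collected in [N2] until it becomes 1. *)
Lemma coprime_split N a : 0 < N -> exists N1 N2, 0 < N1 /\ 0 < N2 /\ N = N1 * N2 /\
  rel_prime N1 a /\ rel_prime N1 N2 /\ (forall p, Znumtheory.prime p -> (p | N2) -> (p | a)).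
Proof.
move=> N0; have N0' : 0 <= N by lia.
move: N N0' N0; apply: (Z_lt_induction (fun N => 0 < N -> _)) => N IH N0.
have g0 := Z.gcd_nonneg N a.
have gz : Z.gcd N a <> 0 by move/Z.gcd_eq_0_l; lia.
case: (Z.eq_dec (Z.gcd N a) 1) => [g1|g1].
  exists N, 1; do 3 (split; first by lia); split; first by apply/Zgcd_1_rel_prime.
  split; first by apply: rel_prime_sym; apply: rel_prime_1.
  move=> p pp /Z.divide_1_r_nonneg; have := prime_ge_2 p pp; lia.
have [N' EN] := Z.gcd_divide_l N a.
have [N1 [N2 [h1 [h2 [E [r1 [r2 hp]]]]]]] := IH N' ltac:(nia) ltac:(nia).
have hp' p : Znumtheory.prime p -> (p | N2 * Z.gcd N a) -> (p | a).
  move=> pp /(prime_mult p pp)[/(hp p pp)//|pg].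
  by apply: Z.divide_trans pg (Z.gcd_divide_r N a).
exists N1, (N2 * Z.gcd N a); split=> //; split; first by nia.
split; first by rewrite {1}EN E; ring.
split=> //; split=> //.
apply: rel_prime_by_primes => [|p pp p1 p2]; first by nia.
by apply: (rel_prime_prime r1 pp p1); apply: hp'.
Qed.

Lemma prime_not_div_1 p : Znumtheory.prime p -> (p | 1) -> False.
Proof. by move=> pp /Z.divide_1_r_nonneg; have := prime_ge_2 p pp; lia. Qed.

(** The primes of [N] are sorted into those not dividing [al] (in [N1]), those dividing [al] but not
    [ga] (in [N3]) and those dividing both (in [N4]). At [y = N3], [z = N1] exactly one of the three
    terms is nonzero modulo each of them. *)
Lemma binary_represents_coprime al be ga N : 0 < N -> Z.gcd (Z.gcd al be) ga = 1 ->
  exists y z, Z.gcd y z = 1 /\ rel_prime (al * y * y + be * y * z + ga * z * z) N.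
Proof.
move=> N0 g1.
have [N1 [N2 [h1 [h2 [E [r1 [r2 hp]]]]]]] := coprime_split al N0.
have [N3 [N4 [h3 [h4 [E' [r3 [r4 hq]]]]]]] := coprime_split ga h2.
exists N3, N1; split.
  apply/Zgcd_1_rel_prime; apply: (rel_prime_div _ _ _ (rel_prime_sym _ _ r2)).
  by exists N4; lia.
apply: rel_prime_by_primes => [|p pp p1]; first by lia.
rewrite E E' => /(prime_mult p pp)[pN1|/(prime_mult p pp)[pN3|pN4]].
- have : (p | al * N3 * N3).
    have -> : al * N3 * N3 = (al * N3 * N3 + be * N3 * N1 + ga * N1 * N1) - N1 * (be * N3 + ga * N1) by ring.
    by apply: Z.divide_sub_r p1 _; apply: Z.divide_mul_l.
  have n3 : ~ (p | N3).
    by move=> p3; apply: (rel_prime_prime r2 pp pN1); rewrite E'; apply: Z.divide_mul_l.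
  move=> /(prime_mult p pp)[/(prime_mult p pp)[pa|]|] //.
  exact: (rel_prime_prime r1 pp pN1 pa).
- have : (p | ga * N1 * N1).
    have -> : ga * N1 * N1 = (al * N3 * N3 + be * N3 * N1 + ga * N1 * N1) - N3 * (be * N1 + al * N3) by ring.
    by apply: Z.divide_sub_r p1 _; apply: Z.divide_mul_l.
  have n1 : ~ (p | N1).
    move=> q1; apply: (rel_prime_prime r2 pp q1); rewrite E'; exact: Z.divide_mul_l.
  move=> /(prime_mult p pp)[/(prime_mult p pp)[pa|]|] //.
  exact: (rel_prime_prime r3 pp pN3 pa).
- have pal : (p | al) by apply: (hp p pp); rewrite E'; apply: Z.divide_mul_r.
  have pga : (p | ga) by apply: hq.
  have : (p | be * N3 * N1).
    have -> : be * N3 * N1 = (al * N3 * N3 + be * N3 * N1 + ga * N1 * N1) - (al * (N3 * N3) + ga * (N1 * N1)) by ring.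
    by apply: Z.divide_sub_r p1 _; apply: Z.divide_add_r; apply: Z.divide_mul_l.
  move=> /(prime_mult p pp)[/(prime_mult p pp)[pbe|p3]|q1].
  + apply: (prime_not_div_1 pp); rewrite -g1; apply: Z.gcd_greatest => //.
    exact: Z.gcd_greatest.
  + exact: (rel_prime_prime r4 pp p3 pN4).
  + apply: (rel_prime_prime r2 pp q1); rewrite E'; exact: Z.divide_mul_r.
Qed.

Lemma crt a b p q : rel_prime a b -> exists z, (a | z - p) /\ (b | z - q).
Proof.
move=> /rel_prime_bezout[u v E]; exists (p * (v * b) + q * (u * a)); split.
  by exists (u * (q - p)); have -> : v * b = 1 - u * a by [lia]; ring.
by exists (v * (p - q)); have -> : u * a = 1 - v * b by [lia]; ring.
Qed.

Record vec := Vec { vx : Z; vy : Z; vz : Z }.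
Record mat := Mat { mc1 : vec; mc2 : vec; mc3 : vec }.
(* [Form a b c r s t] is a x^2 + b y^2 + c z^2 + 2 r x y + 2 s x z + 2 t y z. *)
Record form := Form { fa : Z; fb : Z; fc : Z; fr : Z; fs : Z; ft : Z }.

Definition val f v := fa f * vx v * vx v + fb f * vy v * vy v + fc f * vz v * vz v
  + 2 * fr f * vx v * vy v + 2 * fs f * vx v * vz v + 2 * ft f * vy v * vz v.
Definition bil f v w := fa f * vx v * vx w + fb f * vy v * vy w + fc f * vz v * vz w
  + fr f * (vx v * vy w + vy v * vx w) + fs f * (vx v * vz w + vz v * vx w)
  + ft f * (vy v * vz w + vz v * vy w).
Definition app P v := Vec (vx (mc1 P) * vx v + vx (mc2 P) * vy v + vx (mc3 P) * vz v)
  (vy (mc1 P) * vx v + vy (mc2 P) * vy v + vy (mc3 P) * vz v)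
  (vz (mc1 P) * vx v + vz (mc2 P) * vy v + vz (mc3 P) * vz v).
Definition mmul P Q := Mat (app P (mc1 Q)) (app P (mc2 Q)) (app P (mc3 Q)).
Definition act f P := Form (val f (mc1 P)) (val f (mc2 P)) (val f (mc3 P))
  (bil f (mc1 P) (mc2 P)) (bil f (mc1 P) (mc3 P)) (bil f (mc2 P) (mc3 P)).
Definition fdet f := fa f * fb f * fc f + 2 * fr f * fs f * ft f
  - fa f * ft f * ft f - fb f * fs f * fs f - fc f * fr f * fr f.
Definition mdet P := vx (mc1 P) * (vy (mc2 P) * vz (mc3 P) - vz (mc2 P) * vy (mc3 P))
  - vx (mc2 P) * (vy (mc1 P) * vz (mc3 P) - vz (mc1 P) * vy (mc3 P))
  + vx (mc3 P) * (vy (mc1 P) * vz (mc2 P) - vz (mc1 P) * vy (mc2 P)).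
Definition pd f := 0 < fa f /\ 0 < fa f * fb f - fr f * fr f /\ 0 < fdet f.
Definition feq m f g := (m | fa f - fa g) /\ (m | fb f - fb g) /\ (m | fc f - fc g) /\
  (m | fr f - fr g) /\ (m | fs f - fs g) /\ (m | ft f - ft g).

Ltac forms := unfold act, mmul, app, val, bil, fdet, mdet; cbn [vx vy vz mc1 mc2 mc3 fa fb fc fr fs ft].

Lemma val_act f P v : val (act f P) v = val f (app P v).
Proof. by forms; ring. Qed.
Lemma bil_act f P v w : bil (act f P) v w = bil f (app P v) (app P w).
Proof. by forms; ring. Qed.
Lemma app_mmul P Q v : app (mmul P Q) v = app P (app Q v).
Proof. by forms; congr Vec; ring. Qed.
Lemma act_mmul f P Q : act f (mmul P Q) = act (act f P) Q.
Proof. by rewrite /act -!val_act -!bil_act. Qed.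
Lemma fdet_act f P : fdet (act f P) = fdet f * (mdet P * mdet P).
Proof. by forms; ring. Qed.
Lemma mdet_mmul P Q : mdet (mmul P Q) = mdet P * mdet Q.
Proof. by forms; ring. Qed.

(** Successive completion of squares, cleared of denominators by the factor [a * h]. *)
Lemma pd_val f v : pd f -> v <> Vec 0 0 0 -> 0 < val f v.
Proof.
case: f => a b c r s t [/= a0 [h0 d0]] v0; case: v v0 => x y z v0.
set h := a * b - r * r in h0; set d := fdet _ in d0.
have E : a * h * val (Form a b c r s t) (Vec x y z) =
   h * ((a * x + r * y + s * z) * (a * x + r * y + s * z)) +
   ((h * y + (a * t - r * s) * z) * (h * y + (a * t - r * s) * z) + a * d * (z * z)).
  by rewrite /h /d; forms; ring.
have ah : 0 < a * h by nia.
have ad : 0 < a * d by nia.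
have sq x' : 0 <= x' * x' by nia.
suff : 0 < a * h * val (Form a b c r s t) (Vec x y z) by nia.
rewrite E; case: (Z.eq_dec z 0) => [z0|z0].
  rewrite z0 !Z.mul_0_r !Z.add_0_r; case: (Z.eq_dec y 0) => [y0|y0].
    rewrite y0 !Z.mul_0_r !Z.add_0_r.
    have x0 : x <> 0 by move=> x0; apply: v0; rewrite x0 y0 z0.
    have : 0 < (a * x) * (a * x) by nia.
    nia.
  have : 0 < (h * y) * (h * y) by nia.
  have := sq (a * x + r * y); nia.
have : 0 < z * z by nia.
have := sq (a * x + r * y + s * z); have := sq (h * y + (a * t - r * s) * z); nia.
Qed.

Lemma pd_act f P : pd f -> mdet P <> 0 -> pd (act f P).
Proof.
move=> hf dP; have nz v : v <> Vec 0 0 0 -> app P v <> Vec 0 0 0.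
  case: v => x y z v0 E0; apply: v0; case: P dP E0 => [[a b c] [d k l] [g h i]]; forms => dP [e1 e2 e3].
  set D := _ - _ + _ in dP.
  have Ex : D * x = (k * i - l * h) * (a * x + d * y + g * z) - (d * i - l * g) * (b * x + k * y + h * z)
     + (d * h - k * g) * (c * x + l * y + i * z) by rewrite /D; ring.
  have Ey : D * y = - (b * i - c * h) * (a * x + d * y + g * z) + (a * i - c * g) * (b * x + k * y + h * z)
     - (a * h - b * g) * (c * x + l * y + i * z) by rewrite /D; ring.
  have Ez : D * z = (b * l - c * k) * (a * x + d * y + g * z) - (a * l - c * d) * (b * x + k * y + h * z)
     + (a * k - b * d) * (c * x + l * y + i * z) by rewrite /D; ring.
  rewrite e1 e2 e3 !Z.mul_0_r in Ex Ey Ez.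
  by congr Vec; nia.
have pos v : v <> Vec 0 0 0 -> 0 < val (act f P) v by move=> v0; rewrite val_act; apply: pd_val => //; apply: nz.
have a0 : 0 < fa (act f P).
  have -> : fa (act f P) = val (act f P) (Vec 1 0 0).
    by case: (act f P) => a b c r s t; forms; ring.
  by apply: pos.
have dd : 0 < mdet P * mdet P by nia.
split=> //; split; last by rewrite fdet_act; case: hf => _ [_ h]; apply: Z.mul_pos_pos.
(* This vector has the value [a (a b - r^2)], which gives the sign of the second minor. *)
have := pos (Vec (- fr (act f P)) (fa (act f P)) 0); move: a0.
case: (act f P) => a b c r s t /= a0; rewrite /val /= => h.
have {}h : 0 < a * (a * b - r * r).
  have -> : a * (a * b - r * r) = a * - r * - r + b * a * a + c * 0 * 0 + 2 * r * - r * a + 2 * s * - r * 0 + 2 * t * a * 0 by ring.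
  by apply: h => [[]]; lia.
nia.
Qed.

End TernaryForms.

(** * Schur complements and forms with prescribed first coefficient *)

Module HermiteForms.
Import ZArith Znumtheory Lia all_boot zify AnkenyClass TernaryForms.
Set Implicit Arguments. Unset Strict Implicit. Unset Printing Implicit Defensive.
Local Close Scope nat_scope.
Local Open Scope Z_scope.

Lemma rel_prime_smooth a m M : M <> 0 -> rel_prime a m ->
  (forall p, Znumtheory.prime p -> (p | M) -> (p | m)) -> rel_prime a M.
Proof.
move=> M0 r h; apply: rel_prime_by_primes => // p pp pa pM.
exact: (rel_prime_prime r pp pa (h p pp pM)).
Qed.

Lemma rel_prime_divide_mul a b c : rel_prime a b -> (a | c) -> (b | c) -> (a * b | c).
Proof.
move=> r [q ->] h; have [k ->] : (b | q) by apply: (Gauss b a); [rewrite Z.mul_comm|apply: rel_prime_sym].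
by exists k; ring.
Qed.

Definition content1 v := Z.gcd (Z.gcd (vx v) (vy v)) (vz v) = 1.

(** Two nested Bezout identities: one for [x], [y] with gcd [g], one for [g] and [z]. *)
Lemma content1_unimodular v : content1 v -> exists U, mdet U = 1 /\ mc1 U = v.
Proof.
case: v => x y z; rewrite /content1 /= => h.
have [u v Euv] := Zis_gcd_bezout _ _ _ (Zgcd_is_gcd x y).
have /Zgcd_1_rel_prime/rel_prime_bezout[p q Epq] := h.
have [x' Ex] := Z.gcd_divide_l x y; have [y' Ey] := Z.gcd_divide_r x y.
move: (Z.gcd x y) Euv Epq Ex Ey h => g Euv Epq Ex Ey _.
case: (Z.eq_dec g 0) => [g0|g0].
  have [x0 y0] : x = 0 /\ y = 0 by rewrite Ex Ey g0 !Z.mul_0_r.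
  have z1 : z * z = 1 by rewrite g0 in Epq; have : (z | 1) by [exists q; lia]; move/Z.divide_1_r; lia.
  exists (Mat (Vec x y z) (Vec z 0 0) (Vec 0 1 0)); split=> //.
  by rewrite x0 y0; forms; lia.
have Ex1 : u * x' + v * y' = 1.
  have : g * (u * x' + v * y') = g * 1 by rewrite -{2}Euv {1}Ex {1}Ey; ring.
  by move/Z.mul_reg_l; apply.
exists (Mat (Vec x y z) (Vec (- v) u 0) (Vec (- x' * q) (- y' * q) p)); split=> //.
transitivity (q * z * (u * x' + v * y') + p * (u * x + v * y)); first by forms; ring.
by rewrite Ex1 Euv; lia.
Qed.

Lemma coprime_completion y z : Z.gcd y z = 1 -> exists p q, y * q - z * p = 1.
Proof.
move/Zgcd_1_rel_prime/rel_prime_bezout => [u v E].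
by exists (- v), u; lia.
Qed.

(** Completing the square in the first variable turns [fa f] times the form into a square plus
    [hb1 y^2 + 2 hb2 y z + hb3 z^2]. *)
Definition hb1 f := fa f * fb f - fr f * fr f.
Definition hb2 f := fa f * ft f - fr f * fs f.
Definition hb3 f := fa f * fc f - fs f * fs f.

Lemma hb_det f : hb1 f * hb3 f - hb2 f * hb2 f = fa f * fdet f.
Proof. by rewrite /hb1 /hb2 /hb3 /fdet; ring. Qed.

(* Write the Schur complement of the first variable as [gm] times a primitive
   binary form and move a value of the latter prime to [N] to the first place. *)
Lemma schur_first_value f N : pd f -> 0 < N -> exists V gm u,
  mdet V = 1 /\ mc1 V = Vec 1 0 0 /\ 0 < gm /\ 0 < u /\ rel_prime u N /\
  hb1 (act f V) = gm * u /\ (gm | hb1 f) /\ (gm | 2 * hb2 f) /\ (gm | hb3 f).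
Proof.
move=> [a0 [h0 d0]] N0.
set g := Z.gcd (Z.gcd (hb1 f) (2 * hb2 f)) (hb3 f).
have g0 : 0 < g.
  have := Z.gcd_nonneg (Z.gcd (hb1 f) (2 * hb2 f)) (hb3 f).
  suff : g <> 0 by rewrite -/g; lia.
  by move=> /Z.gcd_eq_0_l /Z.gcd_eq_0_l; rewrite /hb1; lia.
have [k3 E3] : (g | hb3 f) := Z.gcd_divide_r _ _.
have gg : (g | Z.gcd (hb1 f) (2 * hb2 f)) := Z.gcd_divide_l _ _.
have [k1 E1] : (g | hb1 f) := Z.divide_trans _ _ _ gg (Z.gcd_divide_l _ _).
have [k2 E2] : (g | 2 * hb2 f) := Z.divide_trans _ _ _ gg (Z.gcd_divide_r _ _).
have g1 : Z.gcd (Z.gcd k1 k2) k3 = 1.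
  have : g * Z.gcd (Z.gcd k1 k2) k3 = g.
    rewrite -{2}[g]/(Z.gcd (Z.gcd (hb1 f) (2 * hb2 f)) (hb3 f)) E1 E2 E3.
    by rewrite !Z.gcd_mul_mono_r !(Z.abs_eq g) ?Z.gcd_mul_mono_r ?(Z.abs_eq g); lia.
  nia.
have [y [z [gyz r]]] := binary_represents_coprime N0 g1.
have [p [q Epq]] := coprime_completion gyz.
exists (Mat (Vec 1 0 0) (Vec 0 y z) (Vec 0 p q)), g, (k1 * y * y + k2 * y * z + k3 * z * z).
have EV : hb1 (act f (Mat (Vec 1 0 0) (Vec 0 y z) (Vec 0 p q))) =
    hb1 f * y * y + (2 * hb2 f) * y * z + hb3 f * z * z.
  by rewrite /hb1 /hb2 /hb3; forms; ring.
have EU : hb1 (act f (Mat (Vec 1 0 0) (Vec 0 y z) (Vec 0 p q))) =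
    g * (k1 * y * y + k2 * y * z + k3 * z * z).
  by rewrite EV E1 E2 E3; ring.
have dV : mdet (Mat (Vec 1 0 0) (Vec 0 y z) (Vec 0 p q)) = 1 by forms; lia.
split=> //; split=> //; split=> //; split.
  have [_ [h _]] : pd (act f (Mat (Vec 1 0 0) (Vec 0 y z) (Vec 0 p q))).
    by apply: pd_act => //; rewrite dV.
  have {}h : 0 < g * (k1 * y * y + k2 * y * z + k3 * z * z) by rewrite -EU.
  by move: h; move: (k1 * y * y + k2 * y * z + k3 * z * z) => w; nia.
split=> //; split=> //.
split; first by exists k1. split; first by exists k2. by exists k3.
Qed.

(** A form with first coefficient [D] is rebuilt from a Schur complement [gm u'], [h2'], [h3'] and
    entries [r'], [s']. It has to be shown that its other coefficients are integral and congruent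
    modulo [m] to those of the old form twisted by the diagonal matrix [1], [ta], [ta']. Modulo [M2]
    all data imitate the old form; modulo [D1] the choices [r' = ta] and [s' = - h2' ta'] make the
    numerators vanish. *)
Section Assemble.
Variables (m dl D1 n1 n0 a b c r s t gm u De : Z).
Variables (u' ta ta' h2' r' s' h3' : Z).
Let M3 := 8 * m * dl * dl * De.
Let M2 := gm * M3.
Hypotheses (Edl : 0 < dl) (EM2 : 0 < M2) (hgm : 0 < gm).
Hypotheses (rD : rel_prime D1 M2) (ru : rel_prime u M2).
Hypothesis En : n0 = dl * n1.
Hypothesis E1 : n0 * b - r * r = gm * u.
Let h2 := n0 * t - r * s.
Let h3 := n0 * c - s * s.
Hypothesis Edet : gm * u * h3 - h2 * h2 = n0 * De.
Let D := dl * D1.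
Hypotheses (ED : (M2 | D - n0)) (Hu' : (M2 | u' - u * (ta * ta))) (Hta : (M2 * D1 | ta * ta' - 1)).
Hypotheses (Hu'D : (D1 | gm * u' + ta * ta)) (rDu : rel_prime D1 (gm * u')).
Hypotheses (Hh2 : (M2 | h2' - h2)) (Hr : (M2 | r' - r * ta)) (HrD : (D1 | r' - ta)).
Hypotheses (Hs : (M2 | s' - s * ta')) (HsD : (D1 | s' + h2' * ta')).
Hypothesis Hh3 : gm * u' * h3' = h2' * h2' + D * De.

Lemma dl_M3 : (dl | M3). Proof. by exists (8 * m * dl * De); rewrite /M3; ring. Qed.
Lemma M3_M2 : (M3 | M2). Proof. by exists gm. Qed.
Lemma rDdl : rel_prime dl D1.
Proof.
apply: (rel_prime_div M2); first exact: rel_prime_sym.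
by apply: Z.divide_trans dl_M3 M3_M2.
Qed.

Lemma Hta1 : (M3 | ta * ta' - 1).
Proof. by apply: Z.divide_trans Hta; apply: Z.divide_trans M3_M2 _; apply: Z.divide_factor_l. Qed.
Lemma HtaD : (D1 | ta * ta' - 1).
Proof. by apply: Z.divide_trans Hta; apply: Z.divide_factor_r. Qed.

(** Integrality is checked separately at [D1] and at [dl]. Dividing by [D] loses precision only at
    the primes of [dl], and [M3] has powers of [dl] to spare. *)
Lemma entry_quotient h x y : (D1 | h) -> (M3 | h - n0 * (x * y)) ->
  exists q, D * q = h /\ (m | q - x * y).
Proof.
move=> hD hM.
have hdl : (dl | h).
  have -> : h = (h - n0 * (x * y)) + n0 * (x * y) by ring.
  apply: Z.divide_add_r; first exact: Z.divide_trans dl_M3 hM.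
  by rewrite En -Z.mul_assoc; apply: Z.divide_factor_l.
have [q Eq] := rel_prime_divide_mul rDdl hdl hD.
exists q; split; first by rewrite Eq /D; ring.
have rm : rel_prime m D1.
  apply: (rel_prime_div M2); first exact: rel_prime_sym.
  by exists (gm * (8 * dl * dl * De)); rewrite /M2 /M3; ring.
apply: (Gauss _ D1) => //.
have [k Ek] := hM; have [l El] := ED.
exists (8 * dl * De * (k - gm * l * (x * y))).
have : dl * (D1 * (q - x * y)) = dl * (8 * dl * De * (k - gm * l * (x * y)) * m).
  have -> : dl * (D1 * (q - x * y)) = q * (dl * D1) - D * (x * y) by rewrite /D; ring.
  have -> : D = n0 + l * M2 by lia.
  rewrite -Eq; have -> : h = n0 * (x * y) + k * M3 by lia.
  by rewrite /M2 /M3; ring.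
by move/Z.mul_reg_l; apply; lia.
Qed.

Lemma entry_b : exists q, D * q = gm * u' + r' * r' /\ (m | q - b * (ta * ta)).
Proof.
apply: entry_quotient.
  have -> : gm * u' + r' * r' = (gm * u' + ta * ta) + (r' - ta) * (r' + ta) by ring.
  by apply: Z.divide_add_r => //; apply: Z.divide_mul_l.
have [k Ek] := Hu'; have [l El] := Hr.
exists (gm * (gm * k + l * (r' + r * ta))).
have -> : n0 * (b * (ta * ta)) = (gm * u + r * r) * (ta * ta) by rewrite -E1; ring.
have -> : gm * u' + r' * r' - (gm * u + r * r) * (ta * ta) =
  gm * (u' - u * (ta * ta)) + (r' - r * ta) * (r' + r * ta) by ring.
by rewrite Ek El /M2; ring.
Qed.

Lemma entry_t : exists q, D * q = h2' + r' * s' /\ (m | q - t * 1).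
Proof.
apply: entry_quotient.
  have -> : h2' + r' * s' = (r' - ta) * s' + ta * (s' + h2' * ta') - h2' * (ta * ta' - 1) by ring.
  apply: Z.divide_sub_r; last by apply: Z.divide_mul_r; exact: HtaD.
  by apply: Z.divide_add_r; [apply: Z.divide_mul_l|apply: Z.divide_mul_r].
have [k Ek] := Hh2; have [l El] := Hr; have [j Ej] := Hs; have [i Ei] := Hta1.
exists (gm * k + gm * l * s' + r * ta * (gm * j) + r * s * i).
have -> : h2' + r' * s' - n0 * (t * 1) = (h2' - h2) + (r' - r * ta) * s' + r * ta * (s' - s * ta') + r * s * (ta * ta' - 1).
  by rewrite /h2; ring.
by rewrite Ek El Ej Ei /M2; ring.
Qed.

(** [h3] is determined by the determinant relation; cancelling [gm] there costs the factor by which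
    [M2] exceeds [M3], and [u] is prime to [M3]. *)
Lemma h3_congr : (M3 | h3' - h3 * (ta' * ta')).
Proof.
have ruM3 : rel_prime M3 u.
  by apply: (rel_prime_div M2 _ M3 (rel_prime_sym _ _ ru)); exact: M3_M2.
apply: (Gauss _ u) => //.
have [k Ek] := Hu'; have [l El] := Hh2; have [j Ej] := ED; have [i Ei] := Hta1.
have A : u' * h3' - u * h3 = M3 * (l * (h2' + h2) + j * De).
  have : gm * (u' * h3' - u * h3) = gm * (M3 * (l * (h2' + h2) + j * De)).
    have -> : gm * (u' * h3' - u * h3) = (gm * u' * h3') - (gm * u * h3) by ring.
    have -> : gm * u * h3 = h2 * h2 + n0 * De by lia.
    rewrite Hh3; have -> : h2' * h2' + D * De - (h2 * h2 + n0 * De) = (h2' - h2) * (h2' + h2) + (D - n0) * De by ring.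
    by rewrite El Ej /M2; ring.
  by move/Z.mul_reg_l; apply; lia.
exists ((l * (h2' + h2) + j * De - gm * k * h3') * (ta' * ta') - u * h3' * i * (ta * ta' + 1)).
have -> : u * (h3' - h3 * (ta' * ta')) =
  (u' * h3' - u * h3) * (ta' * ta') - (u' - u * (ta * ta)) * h3' * (ta' * ta')
   - u * h3' * (ta * ta' - 1) * (ta * ta' + 1) by ring.
by rewrite A Ek Ei /M2; ring.
Qed.

Lemma entry_c : exists q, D * q = h3' + s' * s' /\ (m | q - c * (ta' * ta')).
Proof.
apply: entry_quotient.
  apply: (Gauss _ (gm * u')) => //.
  have -> : gm * u' * (h3' + s' * s') = gm * u' * h3' + gm * u' * (s' * s') by ring.
  rewrite Hh3.
  have -> : h2' * h2' + D * De + gm * u' * (s' * s') =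
    D * De + (s' + h2' * ta') * (s' - h2' * ta') * (gm * u')
    + (gm * u' + ta * ta) * (h2' * ta' * (h2' * ta')) - h2' * h2' * (ta * ta' + 1) * (ta * ta' - 1) by ring.
  apply: Z.divide_sub_r; last by apply: Z.divide_mul_r; exact: HtaD.
  apply: Z.divide_add_r; last by apply: Z.divide_mul_l.
  apply: Z.divide_add_r; last by do 2 apply: Z.divide_mul_l.
  by apply: Z.divide_mul_l; rewrite /D; apply: Z.divide_factor_r.
have [k Ek] := h3_congr; have [l El] := Hs.
exists (k + gm * l * (s' + s * ta')).
have -> : h3' + s' * s' - n0 * (c * (ta' * ta')) =
  (h3' - h3 * (ta' * ta')) + (s' - s * ta') * (s' + s * ta') by rewrite /h3; ring.
by rewrite Ek El /M2; ring.
Qed.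

End Assemble.

End HermiteForms.

(** * A locally equivalent form that represents D *)

Module AnkenyTernary.
Import ZArith Znumtheory Lia all_boot zify AnkenyClass TernaryForms HermiteForms.
Set Implicit Arguments. Unset Strict Implicit. Unset Printing Implicit Defensive.
Local Close Scope nat_scope.
Local Open Scope Z_scope.

Lemma prime_mul_smooth p m x y : Znumtheory.prime p -> ((p | x) -> (p | m)) -> ((p | y) -> (p | m)) ->
  (p | x * y) -> (p | m).
Proof. by move=> pp hx hy /(prime_mult p pp)[]. Qed.

Lemma gcd1_rel_prime a b : Z.gcd a b = 1 -> rel_prime a b.
Proof. by move/Zgcd_1_rel_prime. Qed.

(** With [x0] as first basis vector, [f] has a first coefficient [n0] congruent to [D]. Replacing
    [n0] by [D], with the determinant and the residues modulo [m] kept, calls for a new Schur entry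
    [gm u'] with [u'] congruent to [u] times a square; [ankeny_class] supplies it and the diagonal
    twist by [ta], [v1] absorbs the square. The clause [mc1 P = x0] lets a linear form be followed
    later. *)
Theorem ankeny f m D : pd f -> 0 < m -> (2 * fdet f | m) -> 0 < D ->
  exists M0, 0 < M0 /\ (forall p, Znumtheory.prime p -> (p | M0) -> (p | m)) /\ forall x0, (M0 | val f x0 - D) -> content1 x0 ->
  exists f' P, pd f' /\ fdet f' = fdet f /\ fa f' = D /\ feq m f' (act f P) /\
    rel_prime (mdet P) m /\ mc1 P = x0.
Proof.
move=> hf m0 dm D0; have De0 : 0 < fdet f by case: hf => _ [].
have m2 : (2 | m) by apply: Z.divide_trans dm; apply: Z.divide_factor_l.
have mDe : (fdet f | m) by apply: Z.divide_trans dm; apply: Z.divide_factor_r.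
have [D1 [dl [D10 [dl0 [ED [rDm [rDdl hdl]]]]]]] := coprime_split m D0.
set De := fdet f in De0 mDe *.
(* This is [8 m dl^2 De] times [4 dl De]. The second factor is a multiple of the still unknown [gm],
   by [ggm] below, so congruence modulo [M0] implies congruence modulo [M2]. *)
exists (32 * m * dl * dl * dl * De * De); split; first by do ! apply: Z.mul_pos_pos.
split.
  move=> p pp; have e32 : 32 = 2 * 2 * 2 * 2 * 2 by [].
  rewrite e32; do ! (apply: (prime_mul_smooth pp) => //); try exact: hdl.
  1-7: by move=> h; first [apply: Z.divide_trans h m2|apply: Z.divide_trans h mDe].
move=> x0 [k Ek] cx.
have [U [dU U1]] := content1_unimodular cx.
set n1 := D1 + 32 * m * dl * dl * De * De * k.
have En : val f x0 = dl * n1 by rewrite /n1; lia.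
have hf1 : pd (act f U) by apply: pd_act => //; rewrite dU.
have Ea1 : fa (act f U) = val f x0 by rewrite -U1.
have n00 : 0 < val f x0 by rewrite -Ea1; case: hf1.
have n10 : 0 < n1 by nia.
have rn1m : rel_prime n1 m.
  apply: rel_prime_by_primes => [|p pp pn pm]; first by lia.
  apply: (rel_prime_prime rDm pp _ pm).
  have -> : D1 = n1 - m * (32 * dl * dl * De * De * k) by rewrite /n1; ring.
  by apply: Z.divide_sub_r => //; apply: Z.divide_mul_l.
have N0 : 0 < 2 * m * n1 by nia.
have [V [gm [u [dV [V1 [gm0 [u0 [ru [Eh [g1 [g2 g3]]]]]]]]]]] := schur_first_value hf1 N0.
have EUV : act f (mmul U V) = act (act f U) V := act_mmul f U V.
have dUV : mdet (mmul U V) = 1 by rewrite mdet_mmul dU dV.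
have c1UV : mc1 (mmul U V) = x0.
  rewrite /= V1 -U1; case: (U) => [[? ? ?] [? ? ?] [? ? ?]]; forms; congr Vec; ring.
have hf0 : pd (act f (mmul U V)) by apply: pd_act => //; rewrite dUV.
have Ea : fa (act f (mmul U V)) = dl * n1 by rewrite -En -c1UV.
have Ed1 : fdet (act f U) = De by rewrite fdet_act dU /De; ring.
have Ed : fdet (act f (mmul U V)) = De by rewrite fdet_act dUV /De; ring.
rewrite -EUV in Eh.
(* A prime not dividing [m] but dividing the whole Schur complement is odd and, by [hb_det], divides
   the first coefficient. Then it divides [fr] and [fs], hence the determinant and [m]. *)
have gsm p : Znumtheory.prime p -> (p | gm) -> (p | m).
  move=> pp pg; case: (Zdivide_dec p m) => // pm; exfalso; apply: (pm).
  have p2 : ~ (p | 2) by move=> h; apply: pm; apply: Z.divide_trans h m2.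
  have ph1 := Z.divide_trans _ _ _ pg g1; have ph3 := Z.divide_trans _ _ _ pg g3.
  have ph2 : (p | hb2 (act f U)) by have := Z.divide_trans _ _ _ pg g2; move/(prime_mult p pp) => [].
  have pn : (p | fa (act f U)).
    have : (p | fa (act f U) * De).
      rewrite -Ed1 -hb_det; apply: Z.divide_sub_r; first exact: Z.divide_mul_l.
      exact: Z.divide_mul_l.
    by move/(prime_mult p pp) => [//|pDe]; case: pm; apply: Z.divide_trans pDe mDe.
  have sq w z : (p | fa (act f U) * w - z * z) -> (p | z).
    move=> h; have : (p | z * z).
      have -> : z * z = fa (act f U) * w - (fa (act f U) * w - z * z) by ring.
      by apply: Z.divide_sub_r h; apply: Z.divide_mul_l.
    by move/(prime_mult p pp) => [].
  have pr := sq _ _ ph1; have ps := sq _ _ ph3.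
  apply: Z.divide_trans mDe; rewrite -Ed1 /fdet.
  have -> : forall a b c r s t, a * b * c + 2 * r * s * t - a * t * t - b * s * s - c * r * r =
     a * (b * c - t * t) + s * (2 * r * t - b * s) - r * (c * r) by move=> *; ring.
  apply: Z.divide_sub_r; last exact: Z.divide_mul_l.
  by apply: Z.divide_add_r; apply: Z.divide_mul_l.
have dsm p : Znumtheory.prime p -> (p | dl) -> (p | m) by apply: hdl.
have Dsm p : (p | De) -> (p | m) by move=> h; apply: Z.divide_trans h mDe.
have sm2 p : (p | 2) -> (p | m) by move=> h; apply: Z.divide_trans h m2.
pose M2 := gm * (8 * m * dl * dl * De).
have M20 : 0 < M2 by rewrite /M2; do ! apply: Z.mul_pos_pos.
have M2sm p : Znumtheory.prime p -> (p | M2) -> (p | m).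
  move=> pp; have e8 : 8 = 2 * 2 * 2 by [].
  rewrite /M2 e8; do ! (apply: (prime_mul_smooth pp) => //); auto.
have rM a : rel_prime a m -> rel_prime a M2.
  by move=> h; apply: rel_prime_smooth M2sm => //; lia.
have rum : rel_prime u m.
  apply: rel_prime_sym; apply: (rel_prime_div (2 * m * n1)); first exact: rel_prime_sym.
  by exists (2 * n1); ring.
have run : rel_prime u n1.
  apply: rel_prime_sym; apply: (rel_prime_div (2 * m * n1)); first exact: rel_prime_sym.
  by exists (2 * m); ring.
have ggm : (gm | 4 * dl * De).
  have rg : rel_prime gm n1.
    apply: rel_prime_by_primes => [|p pp pg pn]; first by lia.
    exact: (rel_prime_prime rn1m pp pn (gsm p pp pg)).
  apply: (Gauss _ n1) => //.
  have -> : n1 * (4 * dl * De) = 4 * (fa (act f U) * fdet (act f U)) by rewrite Ea1 En Ed1; ring.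
  rewrite -hb_det; have -> : 4 * (hb1 (act f U) * hb3 (act f U) - hb2 (act f U) * hb2 (act f U)) =
    hb1 (act f U) * (4 * hb3 (act f U)) - (2 * hb2 (act f U)) * (2 * hb2 (act f U)) by ring.
  by apply: Z.divide_sub_r; apply: Z.divide_mul_l.
have [e Ee] := ggm.
set f0 := act f (mmul U V) in hf0 Ea Ed Eh.
have Eh' : fa f0 * fb f0 - fr f0 * fr f0 = gm * u by rewrite -Eh.
have Ehd : gm * u * hb3 f0 - hb2 f0 * hb2 f0 = fa f0 * De by rewrite -Eh hb_det Ed.
have gD1 : Z.gcd D1 M2 = 1 by apply/Zgcd_1_rel_prime; apply: rM.
have gn1 : Z.gcd n1 M2 = 1 by apply/Zgcd_1_rel_prime; apply: rM.
have gu : Z.gcd u M2 = 1 by apply/Zgcd_1_rel_prime; apply: rM.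
have gun : Z.gcd u n1 = 1 by apply/Zgcd_1_rel_prime.
have B0 : 0 < dl * De by nia.
have d1 : (8 * (dl * De) | M2) by exists (gm * m * dl); rewrite /M2; ring.
have d2 : (8 * gm | M2) by exists (m * dl * dl * De); rewrite /M2; ring.
have d3 : (8 * gm | D1 - n1).
  exists (- e * m * dl * De * k); rewrite /n1.
  have -> : D1 - (D1 + 32 * m * dl * dl * De * De * k) = - (8 * m * dl * De * k * (4 * dl * De)) by ring.
  by rewrite Ee; ring.
have d4 : (u | hb2 f0 * hb2 f0 + n1 * (dl * De)).
  exists (gm * hb3 f0).
  have -> : n1 * (dl * De) = fa f0 * De by rewrite Ea; ring.
  by rewrite -Ehd; ring.
have d5 : (n1 | fr f0 * fr f0 + gm * u).
  exists (dl * fb f0); rewrite -Eh' Ea; ring.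
have [u' [ta [x' [u'0 [gu' [gta [Hu' [Hu'D Hx']]]]]]]] :=
  ankeny_class M20 D10 n10 gm0 B0 u0 d1 d2 gD1 gn1 gu gun d3 d4 d5.
have [v1 [v2 Ev]] : exists v1 v2, ta * v1 - M2 * D1 * v2 = 1.
  have [p q Epq] := rel_prime_bezout _ _ (gcd1_rel_prime gta).
  by exists p, (- q); lia.
have ru'W := gcd1_rel_prime gu'.
have ru'M : rel_prime M2 u'.
  by apply: (rel_prime_div (M2 * D1)); [apply: rel_prime_sym|apply: Z.divide_factor_l].
have ru'D : rel_prime D1 u'.
  by apply: (rel_prime_div (M2 * D1)); [apply: rel_prime_sym|apply: Z.divide_factor_r].
(* The residue [x'] modulo [u'] makes [u'] divide [h2' * h2' + D De], so that [h3'] can be solved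
   for. *)
have [h2' [Hh2 Hh2x]] := crt (hb2 f0) x' ru'M.
have rMD : rel_prime M2 D1 by apply: rel_prime_sym; apply: rM.
have [r' [Hr HrD]] := crt (fr f0 * ta) ta rMD.
have [s' [Hs HsD]] := crt (fs f0 * v1) (- (h2' * v1)) rMD.
have {}HsD : (D1 | s' + h2' * v1) by have := HsD; have -> : s' - - (h2' * v1) = s' + h2' * v1 by ring.
have Hta : (M2 * D1 | ta * v1 - 1) by exists v2; lia.
have EDn : (M2 | dl * D1 - fa f0).
  exists (- e * k).
  rewrite Ea /n1 /M2.
  have -> : dl * D1 - dl * (D1 + 32 * m * dl * dl * De * De * k) = - (8 * m * dl * dl * De * k * (4 * dl * De)) by ring.
  by rewrite Ee; ring.
have gM2 : (gm | M2) by apply: Z.divide_factor_l.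
have [h3' Hh3] : exists h3', gm * u' * h3' = h2' * h2' + dl * D1 * De.
  have hu : (u' | h2' * h2' + dl * D1 * De).
    have -> : h2' * h2' + dl * D1 * De = (h2' - x') * (h2' + x') + (x' * x' + D1 * (dl * De)) by ring.
    by apply: Z.divide_add_r => //; apply: Z.divide_mul_l.
  have hg : (gm | h2' * h2' + dl * D1 * De).
    have -> : h2' * h2' + dl * D1 * De = (h2' - hb2 f0) * (h2' + hb2 f0) +
       (dl * D1 - fa f0) * De + (hb2 f0 * hb2 f0 + fa f0 * De) by ring.
    have -> : hb2 f0 * hb2 f0 + fa f0 * De = gm * (u * hb3 f0) by lia.
    apply: Z.divide_add_r; last by apply: Z.divide_factor_l.
    by apply: Z.divide_add_r; apply: Z.divide_mul_l; apply: Z.divide_trans gM2 _.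
  have rgu : rel_prime gm u' by apply: (rel_prime_div M2).
  have [q Eq] := rel_prime_divide_mul rgu hg hu.
  by exists q; rewrite Eq; ring.
have rDu : rel_prime D1 (gm * u').
  by apply: rel_prime_mult => //; apply: rel_prime_sym; apply: (rel_prime_div M2).
have rD2 : rel_prime D1 M2 by apply: rM.
have ru2 : rel_prime u M2 by apply: rM.
have [b' [Eb Hb]] : exists q, dl * D1 * q = gm * u' + r' * r' /\ (m | q - fb f0 * (ta * ta)).
  by eapply entry_b; eassumption.
have [t' [Et Ht]] : exists q, dl * D1 * q = h2' + r' * s' /\ (m | q - ft f0 * 1).
  by eapply entry_t; eassumption.
have [c' [Ec Hc]] : exists q, dl * D1 * q = h3' + s' * s' /\ (m | q - fc f0 * (v1 * v1)).
  apply: (@entry_c m dl D1 n1 (fa f0) (fc f0) (fr f0) (fs f0) (ft f0) gm u De u' ta v1 h2' s' h3') => //.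
have mM2 : (m | M2) by exists (gm * (8 * dl * dl * De)); rewrite /M2; ring.
pose f' := Form (dl * D1) b' c' r' s' t'.
have hb1f' : hb1 f' = gm * u' by rewrite /hb1 /=; lia.
have hb2f' : hb2 f' = h2' by rewrite /hb2 /=; lia.
have hb3f' : hb3 f' = h3' by rewrite /hb3 /=; lia.
have df' : fdet f' = De.
  have := hb_det f'; rewrite hb1f' hb2f' hb3f' Hh3 /=.
  have -> : h2' * h2' + dl * D1 * De - h2' * h2' = dl * D1 * De by ring.
  by move/Z.mul_reg_l => ->; nia.
exists f', (mmul (mmul U V) (Mat (Vec 1 0 0) (Vec 0 ta 0) (Vec 0 0 v1))).
split.
  split; first exact: Z.mul_pos_pos.
  by split; [rewrite -/(hb1 f') hb1f'; apply: Z.mul_pos_pos|rewrite df'].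
split=> //; split; first by rewrite /f' /= ED Z.mul_comm.
split.
  rewrite act_mmul -/f0.
  have -> : act f0 (Mat (Vec 1 0 0) (Vec 0 ta 0) (Vec 0 0 v1)) =
    Form (fa f0) (fb f0 * (ta * ta)) (fc f0 * (v1 * v1)) (fr f0 * ta) (fs f0 * v1) (ft f0 * (ta * v1)).
    by case: (f0) => *; forms; congr Form; ring.
  rewrite /feq /=; split; first exact: Z.divide_trans mM2 EDn.
  split=> //; split=> //; split; first exact: Z.divide_trans mM2 Hr.
  split; first exact: Z.divide_trans mM2 Hs.
  have -> : t' - ft f0 * (ta * v1) = (t' - ft f0 * 1) - ft f0 * (ta * v1 - 1) by ring.
  apply: Z.divide_sub_r => //; apply: Z.divide_mul_r.
  by apply: Z.divide_trans mM2 _; apply: Z.divide_trans Hta; apply: Z.divide_factor_l.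
split.
  have -> : mdet (mmul (mmul U V) (Mat (Vec 1 0 0) (Vec 0 ta 0) (Vec 0 0 v1))) = ta * v1.
    by rewrite mdet_mmul dUV; forms; ring.
  have -> : ta * v1 = 1 + M2 * D1 * v2 by lia.
  have [q Eq] := mM2; apply: bezout_rel_prime.
  by apply: (Bezout_intro _ _ _ 1 (- q * D1 * v2)); rewrite Eq; ring.
rewrite -c1UV; case: (mmul U V) => [[? ? ?] [? ? ?] [? ? ?]]; forms; congr Vec; ring.
Qed.

End AnkenyTernary.

(** * Reduction, enumeration and local separation of classes *)

Module FormReduction.
Import ZArith Znumtheory Lia List Bool all_boot zify AnkenyClass TernaryForms HermiteForms.
Set Implicit Arguments. Unset Strict Implicit. Unset Printing Implicit Defensive.
Local Close Scope nat_scope.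
Local Open Scope Z_scope.

Definition dot u v := vx u * vx v + vy u * vy v + vz u * vz v.
Definition vcong q u v := (q | vx u - vx v) /\ (q | vy u - vy v) /\ (q | vz u - vz v).
Definition unimodular U := mdet U = 1 \/ mdet U = -1.

Lemma unimodular_surjective U v : unimodular U -> exists w, app U w = v.
Proof.
case: U v => [[a b c] [d k l] [g h i]] [x y z] hU.
set D := mdet (Mat (Vec a b c) (Vec d k l) (Vec g h i)) in hU.
have D1 : D * D = 1 by rewrite /unimodular -/D in hU; nia.
exists (Vec (D * ((k * i - l * h) * x - (d * i - l * g) * y + (d * h - k * g) * z))
            (D * (- (b * i - c * h) * x + (a * i - c * g) * y - (a * h - b * g) * z))
            (D * ((b * l - c * k) * x - (a * l - c * d) * y + (a * k - b * d) * z))).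
transitivity (Vec (D * D * x) (D * D * y) (D * D * z)); last by rewrite D1 !Z.mul_1_l.
by rewrite /D; forms; congr Vec; ring.
Qed.

Lemma unimodular_mul U V : unimodular U -> unimodular V -> unimodular (mmul U V).
Proof. by rewrite /unimodular mdet_mmul => [[->|->]] [->|->]; lia. Qed.

Lemma feq_act m f g U : feq m f g -> feq m (act f U) (act g U).
Proof.
case: f g U => a b c r s t [a' b' c' r' s' t'] [[x1 y1 z1] [x2 y2 z2] [x3 y3 z3]].
move=> [[k1 e1] [[k2 e2] [[k3 e3] [[k4 e4] [[k5 e5] [k6 e6]]]]]]; move: e1 e2 e3 e4 e5 e6 => /= e1 e2 e3 e4 e5 e6.
have -> : a = a' + k1 * m by lia.
have -> : b = b' + k2 * m by lia.
have -> : c = c' + k3 * m by lia.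
have -> : r = r' + k4 * m by lia.
have -> : s = s' + k5 * m by lia.
have -> : t = t' + k6 * m by lia.
pose F := Form k1 k2 k3 k4 k5 k6.
rewrite /feq; forms; do ! split.
- by exists (val F (Vec x1 y1 z1)); rewrite /F; forms; ring.
- by exists (val F (Vec x2 y2 z2)); rewrite /F; forms; ring.
- by exists (val F (Vec x3 y3 z3)); rewrite /F; forms; ring.
- by exists (bil F (Vec x1 y1 z1) (Vec x2 y2 z2)); rewrite /F; forms; ring.
- by exists (bil F (Vec x1 y1 z1) (Vec x3 y3 z3)); rewrite /F; forms; ring.
- by exists (bil F (Vec x2 y2 z2) (Vec x3 y3 z3)); rewrite /F; forms; ring.
Qed.

Lemma feq_val m f g v : feq m f g -> (m | val f v - val g v).
Proof.
move=> h; have [] := feq_act (Mat v v v) h; done.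
Qed.

Lemma val_cong q f u v : vcong q u v -> (q | val f u - val f v).
Proof.
case: f u v => a b c r s t [x y z] [x' y' z'] [[i hi] [[j hj] [k hk]]].
move: hi hj hk => /= hi hj hk.
have -> : x = x' + i * q by lia.
have -> : y = y' + j * q by lia.
have -> : z = z' + k * q by lia.
exists (2 * bil (Form a b c r s t) (Vec x' y' z') (Vec i j k) + q * val (Form a b c r s t) (Vec i j k)).
by forms; ring.
Qed.

Lemma app_cong_inj q P u v : rel_prime (mdet P) q -> vcong q (app P u) (app P v) -> vcong q u v.
Proof.
case: P u v => [[a b c] [d k l] [g h i]] [x y z] [x' y' z'] hr [[i1 h1] [[i2 h2] [i3 h3]]].
move: h1 h2 h3; forms; move: hr; forms; set D := _ - _ + _ => hr h1 h2 h3.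
have hr' := rel_prime_sym _ _ hr.
rewrite /vcong /=; do ! split; apply: (Gauss _ D) => //.
- exists ((k * i - l * h) * i1 - (d * i - l * g) * i2 + (d * h - k * g) * i3).
  transitivity ((k * i - l * h) * (i1 * q) - (d * i - l * g) * (i2 * q) + (d * h - k * g) * (i3 * q)).
    by rewrite -h1 -h2 -h3 /D; ring.
  by ring.
- exists (- (b * i - c * h) * i1 + (a * i - c * g) * i2 - (a * h - b * g) * i3).
  transitivity (- (b * i - c * h) * (i1 * q) + (a * i - c * g) * (i2 * q) - (a * h - b * g) * (i3 * q)).
    by rewrite -h1 -h2 -h3 /D; ring.
  by ring.
- exists ((b * l - c * k) * i1 - (a * l - c * d) * i2 + (a * k - b * d) * i3).
  transitivity ((b * l - c * k) * (i1 * q) - (a * l - c * d) * (i2 * q) + (a * k - b * d) * (i3 * q)).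
    by rewrite -h1 -h2 -h3 /D; ring.
  by ring.
Qed.

Section Reduction.

(** Hermite reduction: the Schur complement is Gauss reduced, and the signs of the second and third
    basis vectors are spent on making [fr] and [fs] nonnegative. *)
Definition reduced f := (0 <= fr f /\ 2 * fr f <= fa f) /\ (0 <= fs f /\ 2 * fs f <= fa f) /\
  fa f <= fb f /\ fa f <= fc f /\ hb1 f <= hb3 f /\ (- hb1 f <= 2 * hb2 f /\ 2 * hb2 f <= hb1 f).

Lemma balanced_residue a r : 0 < a -> exists j, - a <= 2 * (r + j * a) /\ 2 * (r + j * a) <= a.
Proof.
move=> a0; exists (- ((2 * r + a) / (2 * a))).
have := Z.div_mod (2 * r + a) (2 * a) ltac:(lia); have := Z.mod_pos_bound (2 * r + a) (2 * a) ltac:(lia).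
by set q := _ / _ => ? ?; split; nia.
Qed.

Lemma half_residue a r : 0 < a ->
  exists j e, (e = 1 \/ e = -1) /\ 0 <= e * (r + j * a) /\ 2 * (e * (r + j * a)) <= a.
Proof.
move=> a0; have [j [h1 h2]] := balanced_residue r a0.
case: (Z_le_dec 0 (r + j * a)) => h; [exists j, 1|exists j, (-1)]; lia.
Qed.

Lemma pd_hb3 f : pd f -> 0 < hb3 f.
Proof.
move=> [a0 [h0 d0]]; have := hb_det f; rewrite -/(hb1 f) in h0.
have : 0 < fa f * fdet f by nia.
have : 0 <= hb2 f * hb2 f by nia.
nia.
Qed.

Lemma unimodular_pd f U : unimodular U -> pd f -> pd (act f U).
Proof. by move=> hU hf; apply: pd_act => //; case: hU => ->. Qed.

Lemma binary_reduction f : pd f -> exists U, unimodular U /\ fa (act f U) = fa f /\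
  hb1 (act f U) <= hb3 (act f U) /\ (- hb1 (act f U) <= 2 * hb2 (act f U) /\ 2 * hb2 (act f U) <= hb1 (act f U)).
Proof.
move=> hf; have h0 : 0 <= hb1 f by case: hf => _ [h _]; rewrite /hb1; lia.
move E : (hb1 f) h0 => n h0; move: n h0 f hf E.
apply: (Z_lt_induction (fun n => forall f, pd f -> hb1 f = n -> _)) => n IH f hf E.
have hp : 0 < hb1 f by case: hf => _ [h _].
have [j hj] := balanced_residue (hb2 f) hp.
pose U := Mat (Vec 1 0 0) (Vec 0 1 0) (Vec 0 j 1).
have uU : unimodular U by left.
have hU : pd (act f U) by apply: unimodular_pd.
have e0 : fa (act f U) = fa f by case: (f) => *; rewrite /U; forms; ring.
have e1 : hb1 (act f U) = hb1 f by case: (f) => *; rewrite /U /hb1; forms; ring.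
have e2 : hb2 (act f U) = hb2 f + j * hb1 f by case: (f) => *; rewrite /U /hb1 /hb2; forms; ring.
case: (Z_le_dec (hb1 (act f U)) (hb3 (act f U))) => h3.
  by exists U; rewrite e1 e2 in h3 *.
pose W := Mat (Vec 1 0 0) (Vec 0 0 1) (Vec 0 1 0).
have uW : unimodular W by right.
have hW : pd (act (act f U) W) by apply: unimodular_pd.
have w0 : fa (act (act f U) W) = fa f by rewrite -e0; case: (act f U) => *; rewrite /W; forms; ring.
have w1 : hb1 (act (act f U) W) = hb3 (act f U) by case: (act f U) => *; rewrite /W /hb1 /hb3; forms; ring.
have p3 := pd_hb3 hU.
have [V [uV [V0 hV]]] := IH (hb3 (act f U)) ltac:(lia) _ hW w1.
exists (mmul (mmul U W) V); rewrite !act_mmul; split; last by rewrite V0.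
by do ! apply: unimodular_mul.
Qed.

(** Descent on the first coefficient, which drops whenever a smaller diagonal entry is swapped in.
    Adding multiples of the first basis vector to the others keeps the Schur complement, so its
    reduction is not spoiled. *)
Theorem reduction f : pd f -> exists U, unimodular U /\ reduced (act f U).
Proof.
move=> hf; have h0 : 0 <= fa f by case: hf; lia.
move E : (fa f) h0 => n h0; move: n h0 f hf E.
apply: (Z_lt_induction (fun n => forall f, pd f -> fa f = n -> _)) => n IH f hf E.
have [U [uU [U0 hU]]] := binary_reduction hf.
have pU := unimodular_pd uU hf.
set g := act f U in U0 hU pU; have a0 : 0 < fa g by case: pU.
have [j [e [he [hj1 hj2]]]] := half_residue (fr g) a0.
have [k [e' [he' [hk1 hk2]]]] := half_residue (fs g) a0.
pose V := Mat (Vec 1 0 0) (Vec (j * e) e 0) (Vec (k * e') 0 e').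
have ee : e * e = 1 by lia.
have ee' : e' * e' = 1 by lia.
have dV : mdet V = e * e' by rewrite /V; forms; ring.
have uV : unimodular V by rewrite /unimodular dV; lia.
have v0 : fa (act g V) = fa g by case: (g) => *; rewrite /V; forms; ring.
have v1 : fr (act g V) = e * (fr g + j * fa g) by case: (g) => *; rewrite /V; forms; ring.
have v2 : fs (act g V) = e' * (fs g + k * fa g) by case: (g) => *; rewrite /V; forms; ring.
have v3 : hb1 (act g V) = (e * e) * hb1 g by case: (g) => *; rewrite /V /hb1; forms; ring.
have v4 : hb3 (act g V) = (e' * e') * hb3 g by case: (g) => *; rewrite /V /hb3; forms; ring.
have v5 : hb2 (act g V) = (e * e') * hb2 g by case: (g) => *; rewrite /V /hb2; forms; ring.
rewrite ee in v3; rewrite ee' in v4.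
have pV := unimodular_pd uV pU.
have v6 : - hb1 g <= 2 * hb2 (act g V) <= hb1 g by rewrite v5; case: he => ->; case: he' => ->; lia.
have sw W : unimodular W -> fa (act (act g V) W) < fa g -> exists U0, unimodular U0 /\ reduced (act f U0).
  move=> uW hW; have pW := unimodular_pd uW pV.
  have [X [uX hX]] := IH (fa (act (act g V) W)) ltac:(case: (pW); lia) _ pW erefl.
  exists (mmul (mmul (mmul U V) W) X); rewrite !act_mmul -/g; split=> //.
  by do ! apply: unimodular_mul.
case: (Z_lt_dec (fb (act g V)) (fa g)) => hb.
  apply: (sw (Mat (Vec 0 1 0) (Vec 1 0 0) (Vec 0 0 1))); first by right.
  by apply: Z.le_lt_trans hb; case: (act g V) => *; forms; lia.
case: (Z_lt_dec (fc (act g V)) (fa g)) => hc.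
  apply: (sw (Mat (Vec 0 0 1) (Vec 0 1 0) (Vec 1 0 0))); first by right.
  by apply: Z.le_lt_trans hc; case: (act g V) => *; forms; lia.
exists (mmul U V); rewrite act_mmul -/g; split; first exact: unimodular_mul.
by rewrite /reduced; lia.
Qed.

End Reduction.

(* Under [vm_compute] the arguments of [&&] and [||] are evaluated eagerly, those of [if] are not. *)
Fixpoint anyb (A : Type) (p : A -> bool) l := if l is x :: l' then if p x then true else anyb p l' else false.

Lemma anybP (A : Type) (p : A -> bool) l : anyb p l -> exists x, In x l /\ p x.
Proof.
elim: l => [//|x l IH] /=; case E : (p x); first by exists x; split=> //; left.
by move=> /IH[y [h1 h2]]; exists y; split=> //; right.
Qed.

Fixpoint for_range (lo : Z) (n : nat) (p : Z -> bool) : bool :=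
  if n is S n' then if p lo then for_range (lo + 1) n' p else false else true.

Lemma for_rangeP lo n p : for_range lo n p -> forall x, lo <= x < lo + Z.of_nat n -> p x.
Proof.
elim: n lo => [|n IH] lo /=; first by lia.
case h0 : (p lo) => // /IH h x hx; case: (Z.eq_dec x lo) => [->//|nx].
by apply: h; lia.
Qed.

Definition for_upto hi p := for_range 0 (Z.to_nat hi) p.
Lemma for_uptoP hi p : for_upto hi p -> forall x, 0 <= x < hi -> p x.
Proof. by move=> h x hx; apply: (for_rangeP h); lia. Qed.

Section Enumeration.
Variables (S d : Z).

(** All forms in question have Schur coefficients divisible by [S] and determinant [S * S * d]. The
    search runs over the quotients, which satisfy [h1 * h3 - h2 * h2 = a * d]; then [r] and [s]
    determine the form. *)
Definition enum_last (p : form -> bool) a h2 h3 b r s :=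
  if ((S * h3 + s * s) mod a =? 0) && ((S * h2 + r * s) mod a =? 0)
  then let c := (S * h3 + s * s) / a in
    if a <=? c then p (Form a b c r s ((S * h2 + r * s) / a)) else true
  else true.
Definition enum_r p a h1 h2 h3 r :=
  if (S * h1 + r * r) mod a =? 0 then
    let b := (S * h1 + r * r) / a in
    if a <=? b then for_upto (a / 2 + 1) (enum_last p a h2 h3 b r) else true
  else true.
Definition enum_h2 p a h1 h2 :=
  if (a * d + h2 * h2) mod h1 =? 0 then
    let h3 := (a * d + h2 * h2) / h1 in
    if h1 <=? h3 then for_upto (a / 2 + 1) (enum_r p a h1 h2 h3) else true
  else true.
Definition enum_h1 p a h1 :=
  if 3 * (a * a) <=? 4 * S * h1 then
    for_range (- (h1 / 2)) (Z.to_nat (2 * (h1 / 2) + 1)) (enum_h2 p a h1) else true.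
Definition enum_a p a := for_range 1 (Z.to_nat (Z.sqrt (4 * a * d / 3))) (enum_h1 p a).
Definition enum_forms amax p := for_range 1 (Z.to_nat amax) (enum_a p).

Lemma div_exact_if x a q : 0 < a -> x = a * q -> (x mod a =? 0) = true /\ x / a = q.
Proof.
move=> a0 ->; rewrite Z.mul_comm Z_mod_mult; split=> //; apply: Z_div_mult_full; lia.
Qed.

Lemma mul_cancel_le x y : 0 < S -> x * S <= y * S -> x <= y.
Proof. by move=> S0 h; apply/(Z.mul_le_mono_pos_r x y S S0). Qed.
Lemma sqr_half_le h k : - h <= 2 * k -> 2 * k <= h -> 4 * (k * k) <= h * h.
Proof. by nia. Qed.
Lemma sqr_le_mul x y : 0 < x -> x <= y -> x * x <= x * y.
Proof. by nia. Qed.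
(** Hermite's bound: [h1] is eliminated from the binary bounds for the form in the first two
    variables and for the Schur complement. *)
Lemma reduced_first_bound a h1 : 0 < a -> 0 <= h1 -> 0 < S ->
  3 * (h1 * h1) <= 4 * (a * d) -> 3 * (a * a) <= 4 * S * h1 -> 27 * (a * a * a) <= 64 * (S * S * d).
Proof.
move=> a0 h0 S0 b1 b2.
have : 9 * (a * a * (a * a)) <= 16 * (S * S * (h1 * h1)).
  have -> : 16 * (S * S * (h1 * h1)) = (4 * S * h1) * (4 * S * h1) by ring.
  have -> : 9 * (a * a * (a * a)) = (3 * (a * a)) * (3 * (a * a)) by ring.
  by apply: Z.mul_le_mono_nonneg; nia.
have : 16 * (S * S) * (3 * (h1 * h1)) <= 16 * (S * S) * (4 * (a * d)).
  by apply: Z.mul_le_mono_nonneg_l => //; nia.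
move=> x1 x2; have x3 : a * (27 * (a * a * a)) <= a * (64 * (S * S * d)) by lia.
by apply: (Zmult_le_reg_r _ _ a); [apply: Z.lt_gt|rewrite Z.mul_comm (Z.mul_comm (64 * _))].
Qed.
Lemma cube_lt_cancel a b : 0 <= b -> a * a * a < (b + 1) * (b + 1) * (b + 1) -> a <= b.
Proof.
move=> b0 h; case: (Z_le_dec a b) => [//|na]; exfalso.
have q1 : b + 1 <= a by lia.
have q2 : (b + 1) * (b + 1) <= a * a by nia.
have : (b + 1) * (b + 1) * (b + 1) <= a * a * a by nia.
lia.
Qed.

Lemma enum_formsP amax p f : 0 < S -> 0 < d -> 0 <= amax ->
  64 * (S * S * d) < 27 * ((amax + 1) * (amax + 1) * (amax + 1)) ->
  enum_forms amax p -> pd f -> fdet f = S * S * d -> reduced f ->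
  (S | hb1 f) -> (S | hb2 f) -> (S | hb3 f) -> p f.
Proof.
move=> S0 d0 am0 ham he hf; have [a0 [h0 _]] := hf; have p3 := pd_hb3 hf.
have Edet := hb_det f.
case: f hf a0 h0 p3 Edet => a b c r s t; rewrite /reduced /hb1 /hb2 /hb3; cbn [fa fb fc fr fs ft].
move=> hf a0 h0 p3 Edet ED; rewrite ED in Edet.
move=> [[r0 r1] [[s0 s1] [ab [ac [h13 h2]]]]].
move=> [h1 E1] [k2 E2] [h3 E3]; rewrite ?E1 ?E2 ?E3 in h0 p3 h13 h2 Edet.
have h10 : 0 < h1 by apply/(Z.mul_pos_cancel_r h1 S S0); lia.
have hh : h1 <= h3 by apply: (mul_cancel_le S0); lia.
have k2b1 : - h1 <= 2 * k2 by apply: (mul_cancel_le S0); lia.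
have k2b2 : 2 * k2 <= h1 by apply: (mul_cancel_le S0); lia.
have det2 : h1 * h3 = a * d + k2 * k2.
  have : S * S * (h1 * h3) = S * S * (a * d + k2 * k2) by lia.
  by move/Z.mul_reg_l; apply; lia.
have b1 : 3 * (h1 * h1) <= 4 * (a * d).
  by have := sqr_half_le k2b1 k2b2; have := sqr_le_mul h10 hh; lia.
have b2 : 3 * (a * a) <= 4 * S * h1.
  have ra : - a <= 2 * r by lia.
  by have := sqr_half_le ra r1; have := sqr_le_mul a0 ab; lia.
have h1n : 0 <= h1 by lia.
have b3 := reduced_first_bound a0 h1n S0 b1 b2.
have aM : a <= amax by apply: cube_lt_cancel => //; lia.
have h1M : h1 <= Z.sqrt (4 * a * d / 3).
  rewrite -(Z.sqrt_square h1) //; apply: Z.sqrt_le_mono.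
  by apply: Z.div_le_lower_bound; lia.
have /(for_rangeP)/(_ h1 ltac:(lia)) := for_rangeP he (x := a) ltac:(lia).
rewrite /enum_h1 (proj2 (Z.leb_le _ _) b2); cbv iota.
have hd := Z.div_mod h1 2 ltac:(lia); have hm := Z.mod_pos_bound h1 2 ltac:(lia).
move/for_rangeP/(_ k2 ltac:(lia)); rewrite /enum_h2.
have [-> ->] := div_exact_if h10 (esym det2); cbv iota zeta.
rewrite (proj2 (Z.leb_le _ _) hh); cbv iota zeta.
have ad := Z.div_mod a 2 ltac:(lia); have am := Z.mod_pos_bound a 2 ltac:(lia).
move/for_uptoP/(_ r ltac:(lia)); rewrite /enum_r.
have Eb : S * h1 + r * r = a * b by lia.
have [-> ->] := div_exact_if a0 Eb; cbv iota zeta.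
rewrite (proj2 (Z.leb_le _ _) ab); cbv iota zeta.
move/for_uptoP/(_ s ltac:(lia)); rewrite /enum_last.
have Ec : S * h3 + s * s = a * c by lia.
have Et : S * k2 + r * s = a * t by lia.
have [-> ->] := div_exact_if a0 Ec; have [-> ->] := div_exact_if a0 Et; rewrite andb_true_l; cbv iota zeta.
by rewrite (proj2 (Z.leb_le _ _) ac).
Qed.

End Enumeration.

Definition zrange q := List.map Z.of_nat (List.seq 0 (Z.to_nat q)).
Definition box q := List.flat_map (fun x => List.flat_map (fun y =>
  List.map (fun z => Vec x y z) (zrange q)) (zrange q)) (zrange q).

Lemma in_zrange q x : In x (zrange q) <-> 0 <= x < q.
Proof.
rewrite /zrange List.in_map_iff; split.
  by move=> [n [<- /List.in_seq h]]; lia.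
by move=> h; exists (Z.to_nat x); split; [lia|apply/List.in_seq; lia].
Qed.

Lemma in_box q v : In v (box q) <-> (0 <= vx v < q) /\ (0 <= vy v < q) /\ (0 <= vz v < q).
Proof.
rewrite /box List.in_flat_map; split.
  move=> [x [/in_zrange hx /List.in_flat_map[y [/in_zrange hy /List.in_map_iff[z [<- /in_zrange hz]]]]]].
  by [].
case: v => x y z /= [hx [hy hz]]; exists x; split; first exact/in_zrange.
apply/List.in_flat_map; exists y; split; first exact/in_zrange.
apply/List.in_map_iff; exists z; split=> //; exact/in_zrange.
Qed.

Lemma nodup_map_in (A B : Type) (g : A -> B) l : List.NoDup l ->
  (forall x y, In x l -> In y l -> g x = g y -> x = y) -> List.NoDup (List.map g l).
Proof.
elim: l => [|x l IH] h hg /=; first exact: List.NoDup_nil.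
inversion h as [|? ? nx nl]; subst; apply: List.NoDup_cons.
  move=> /List.in_map_iff[y [E hy]]; apply: nx.
  by rewrite (hg x y) //; [left|right].
by apply: IH => // y z hy hz; apply: hg; right.
Qed.

Lemma nodup_zrange q : List.NoDup (zrange q).
Proof. by apply: nodup_map_in; [exact: List.seq_NoDup|move=> x y _ _; lia]. Qed.

Lemma nodup_flat_map (A B : Type) (f : A -> list B) (key : B -> A) l : List.NoDup l ->
  (forall x, List.NoDup (f x)) -> (forall x y, In y (f x) -> key y = x) -> List.NoDup (List.flat_map f l).
Proof.
move=> + hf hk; elim: l => [|x l IH] h; first exact: List.NoDup_nil.
inversion h as [|? ? nx nl]; subst; rewrite /=; apply: List.NoDup_app => //; first exact: IH.
move=> y /hk hy /List.in_flat_map[z [hz /hk hyz]]; apply: nx.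
by rewrite -hy hyz.
Qed.

Lemma nodup_box q : List.NoDup (box q).
Proof.
apply: (nodup_flat_map (key := vx)); first exact: nodup_zrange.
  move=> x; apply: (nodup_flat_map (key := vy)); first exact: nodup_zrange.
    by move=> y; apply: nodup_map_in; [exact: nodup_zrange|move=> z z' _ _ []].
  by move=> y v /List.in_map_iff[z [<- _]].
by move=> x v /List.in_flat_map[y [_ /List.in_map_iff[z [<- _]]]].
Qed.

Definition vmod q v := Vec (vx v mod q) (vy v mod q) (vz v mod q).
Lemma vmod_cong q v : 0 < q -> vcong q (vmod q v) v.
Proof.
move=> q0; case: v => x y z.
have h w : (q | w mod q - w) by exists (- (w / q)); have := Z.div_mod w q ltac:(lia); lia.
by split; [exact: h|split; exact: h].
Qed.
Lemma vmod_box q v : 0 < q -> In (vmod q v) (box q).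
Proof. by move=> q0; apply/in_box; have h w := Z.mod_pos_bound w q q0; split; [|split]; apply: h. Qed.

Lemma vcong_sym q u v : vcong q u v -> vcong q v u.
Proof.
have h x y : (q | x - y) -> (q | y - x) by move=> [k E]; exists (- k); lia.
by move=> [? [? ?]]; split; [|split]; apply: h.
Qed.
Lemma vcong_trans q u v w : vcong q u v -> vcong q v w -> vcong q u w.
Proof.
have h x y z : (q | x - y) -> (q | y - z) -> (q | x - z) by move=> [k E] [l E']; exists (k + l); lia.
by move=> [? [? ?]] [? [? ?]]; split; [|split]; eapply h; eassumption.
Qed.
Lemma mod_eq_cong q x y : 0 < q -> (q | x - y) -> x mod q = y mod q.
Proof.
move=> q0 [k E]; have -> : x = y + k * q by lia.
exact: Z_mod_plus_full.
Qed.

Lemma vcong_box q u v : In u (box q) -> In v (box q) -> vcong q u v -> u = v.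
Proof.
have h x y : 0 <= x < q -> 0 <= y < q -> (q | x - y) -> x = y.
  by move=> hx hy hd; rewrite -(Z.mod_small x q hx) -(Z.mod_small y q hy); apply: mod_eq_cong => //; lia.
case: u v => x y z [x' y' z'] /in_box[? [? ?]] /in_box[? [? ?]] [? [? ?]].
by congr Vec; apply: h.
Qed.

(** Horner form with the part independent of [z] shared, because these lists are evaluated in the
    kernel. *)
Definition residues f q := let zs := zrange q in List.flat_map (fun x => List.flat_map (fun y =>
  let A := (fa f * x + 2 * fr f * y) * x + fb f * y * y in let L := 2 * (fs f * x + ft f * y) in
  List.map (fun z => (A + z * (L + fc f * z)) mod q) zs) zs) zs.

Lemma map_flat_map (A B C : Type) (g : B -> C) (h : A -> list B) l :
  List.map g (List.flat_map h l) = List.flat_map (fun x => List.map g (h x)) l.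
Proof. by elim: l => //= x l IH; rewrite List.map_app IH. Qed.

Lemma residuesE f q : residues f q = List.map (fun v => val f v mod q) (box q).
Proof.
rewrite /residues /box map_flat_map; apply: List.flat_map_ext => x.
rewrite map_flat_map; apply: List.flat_map_ext => y.
rewrite List.map_map; apply: List.map_ext => z; congr (_ mod q); rewrite /val; cbn [vx vy vz]; ring.
Qed.

Definition occ r l := List.length (List.filter (Z.eqb r) l).

Lemma filter_map_length (A B : Type) (g : A -> B) (p : B -> bool) l :
  List.length (List.filter p (List.map g l)) = List.length (List.filter (fun x => p (g x)) l).
Proof. by elim: l => //= x l IH; case: (p (g x)) => //=; rewrite IH. Qed.

(* Reducing [P v] modulo [q] injects the solutions of [f v = r] into those of [g v = r]. *)
Lemma occ_le f g P q m r : 0 < q -> (q | m) -> rel_prime (mdet P) m -> feq m f (act g P) ->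
  (occ r (residues f q) <= occ r (residues g q))%coq_nat.
Proof.
move=> q0 qm hP hfg; rewrite /occ !residuesE !filter_map_length.
have hP' : rel_prime (mdet P) q.
  by apply: rel_prime_sym; apply: (rel_prime_div _ _ _ _ qm); apply: rel_prime_sym.
rewrite -(List.length_map (fun v => vmod q (app P v)) (List.filter (fun x => r =? val f x mod q) (box q))).
apply: List.NoDup_incl_length.
  apply: nodup_map_in; first by apply: List.NoDup_filter; exact: nodup_box.
  move=> u v /List.filter_In[hu _] /List.filter_In[hv _] E.
  apply: (vcong_box hu hv); apply: (app_cong_inj hP').
  apply: vcong_trans (vmod_cong _ q0); rewrite -E; apply: vcong_sym; exact: vmod_cong.
move=> w /List.in_map_iff[v [<- /List.filter_In[hv /Z.eqb_eq ->]]].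
apply/List.filter_In; split; first exact: vmod_box.
apply/Z.eqb_eq; apply: mod_eq_cong => //.
have -> : val f v - val g (vmod q (app P v)) = (val f v - val (act g P) v) + (val g (app P v) - val g (vmod q (app P v))).
  by rewrite val_act; ring.
apply: Z.divide_add_r; first by apply: Z.divide_trans qm _; apply: feq_val.
by apply: val_cong; apply: vcong_sym; apply: vmod_cong.
Qed.

Definition histogram q lg := List.map (fun r => (r, occ r lg)) (zrange q).
(** One residue taken more often than by [g] shows that a form is not in the genus of [g]. *)
Definition exceeds lf hist := anyb (fun rn : Z * nat => Nat.ltb rn.2 (occ rn.1 lf)) hist.

Lemma exceedsP f g P q m : 0 < q -> (q | m) -> rel_prime (mdet P) m -> feq m f (act g P) ->
  exceeds (residues f q) (histogram q (residues g q)) = false.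
Proof.
move=> q0 qm hP hfg; apply/negP => /anybP[_ [/List.in_map_iff[r [<- _]] /Nat.ltb_lt]] /=.
by have := occ_le r q0 qm hP hfg; lia.
Qed.

End FormReduction.

(** * Hensel lifting and primitive solutions modulo composite numbers *)

Module LocalSolutions.
Import ZArith Znumtheory Lia List Bool all_boot zify AnkenyClass TernaryForms HermiteForms FormReduction.
Set Implicit Arguments. Unset Strict Implicit. Unset Printing Implicit Defensive.
Local Close Scope nat_scope.
Local Open Scope Z_scope.

Definition vadd v t e := Vec (vx v + t * vx e) (vy v + t * vy e) (vz v + t * vz e).

Lemma val_vadd f v t e : val f (vadd v t e) = val f v + t * (2 * bil f v e) + t * t * val f e.
Proof. by case: f v e => *; rewrite /vadd; forms; ring. Qed.
Lemma bil_vadd f v t e : bil f (vadd v t e) e = bil f v e + t * val f e.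
Proof. by case: f v e => *; rewrite /vadd; forms; ring. Qed.
Lemma vcong_vadd q v t e : (q | t) -> vcong q (vadd v t e) v.
Proof.
move=> [k ->]; split; [|split].
- by exists (k * vx e); rewrite /=; ring.
- by exists (k * vy e); rewrite /=; ring.
- by exists (k * vz e); rewrite /=; ring.
Qed.

Definition primitive_at p v := ~ ((p | vx v) /\ (p | vy v) /\ (p | vz v)).

Lemma primitive_cong p u v : vcong p u v -> primitive_at p v -> primitive_at p u.
Proof.
have h x y : (p | x - y) -> (p | x) -> (p | y).
  by move=> h1 h2; have -> : y = x - (x - y) by [ring]; exact: Z.divide_sub_r h2 h1.
move=> [h1 [h2 h3]] hv [u1 [u2 u3]]; apply: hv; split; [|split].
- exact: h h1 u1.
- exact: h h2 u2.
- exact: h h3 u3.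
Qed.

Section Hensel.
Variables (p : Z) (f : form) (r : Z) (v e : vec) (s j : nat).
Hypothesis pp : Znumtheory.prime p.
Let pw n := p ^ Z.of_nat n.

Lemma pwD a b : pw (a + b)%N = pw a * pw b.
Proof. by rewrite /pw Nat2Z.inj_add Z.pow_add_r //; lia. Qed.
Lemma pw1 : pw 1 = p.
Proof. by rewrite /pw Z.pow_1_r. Qed.
Lemma pwS n : pw n.+1 = p * pw n.
Proof. by rewrite -addn1 pwD pw1; ring. Qed.
Hypothesis grad_s : (pw s | 2 * bil f v e).
Hypothesis grad_s1 : ~ (pw s.+1 | 2 * bil f v e).
Hypothesis start : (pw (s + s.+1 + j)%N | val f v - r).

(** [pw s] is the exact power of [p] in the derivative along [e]. From precision [2 s + 1 + j] on,
    each correction is divisible by [pw (s + 1 + j)], so its square is negligible and the residue of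
    a linear form modulo that power is preserved. *)
Lemma hensel n : exists t, (pw (s.+1 + j)%N | t) /\ (pw (s + s.+1 + j + n)%N | val f (vadd v t e) - r).
Proof.
elim: n => [|n [t [ht [w hw]]]].
  exists 0; split; first exact: Z.divide_0_r.
  by rewrite addn0 val_vadd; have -> : val f v + 0 * (2 * bil f v e) + 0 * 0 * val f e - r = val f v - r by ring.
have [g Eg] := grad_s; have [q Eq] := ht.
set g1 := g + q * p * pw j * (2 * val f e).
have Eg1 : 2 * bil f (vadd v t e) e = g1 * pw s.
  rewrite bil_vadd /g1; have -> : 2 * (bil f v e + t * val f e) = 2 * bil f v e + t * (2 * val f e) by ring.
  by rewrite Eg Eq -addn1 !pwD pw1; ring.
have pg1 : ~ (p | g1).
  move=> [k Ek]; apply: grad_s1; exists (k - q * pw j * (2 * val f e)).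
  rewrite -addn1 pwD pw1 Eg; have -> : g = k * p - q * p * pw j * (2 * val f e) by lia.
  by ring.
have [a b Eab] := rel_prime_bezout _ _ (prime_rel_prime p pp g1 pg1).
set P := pw (s.+1 + j + n)%N.
(* [b] inverts the unit part [g1] of the derivative modulo [p], and [w] is the digit to be
   cancelled. *)
exists (t + P * (- w * b)); split.
  apply: Z.divide_add_r => //; apply: Z.divide_mul_l.
  by rewrite /P (pwD (s.+1 + j)); apply: Z.divide_factor_l.
exists (w * a + pw (j + n)%N * (w * b) * (w * b) * val f e).
have -> : vadd v (t + P * (- w * b)) e = vadd (vadd v t e) (P * (- w * b)) e.
  by rewrite /vadd /=; congr Vec; ring.
rewrite val_vadd Eg1.
have -> : val f (vadd v t e) + P * (- w * b) * (g1 * pw s) + P * (- w * b) * (P * (- w * b)) * val f e - r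
  = (val f (vadd v t e) - r) - P * pw s * (w * (b * g1)) + P * P * ((w * b) * (w * b) * val f e) by ring.
rewrite hw; have -> : b * g1 = 1 - a * p by lia.
rewrite /P !pwD !pwS; ring.
Qed.

End Hensel.

(** The residue of [lin] is kept along with the value: it later decides whether the differences come
    from an integral quadruple. *)
Definition local_solution f D lin st B p := forall n : nat, exists z,
  (p ^ Z.of_nat n | val f z - D) /\ primitive_at p z /\ (st | dot lin z - B).

Lemma divide_sub_trans q u v w : (q | u - v) -> (q | v - w) -> (q | u - w).
Proof. by move=> [k E] [l E']; exists (k + l); lia. Qed.

Lemma dot_cong q lin u v : vcong q u v -> (q | dot lin u - dot lin v).
Proof.
move=> [[a ha] [[b hb] [c hc]]]; exists (vx lin * a + vy lin * b + vz lin * c).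
have -> : dot lin u - dot lin v = vx lin * (vx u - vx v) + vy lin * (vy u - vy v) + vz lin * (vz u - vz v).
  by rewrite /dot; ring.
by rewrite ha hb hc; ring.
Qed.

Lemma local_solutionI p f D lin st B v e (s j : nat) : Znumtheory.prime p ->
  (p ^ Z.of_nat s | 2 * bil f v e) -> ~ (p ^ Z.of_nat s.+1 | 2 * bil f v e) ->
  (p ^ Z.of_nat (s + s.+1 + j) | val f v - D) -> primitive_at p v ->
  (st | p ^ Z.of_nat (s.+1 + j)) -> (st | dot lin v - B) -> local_solution f D lin st B p.
Proof.
move=> pp h1 h2 h3 hv hst hl n.
have [t [ht hn]] := hensel pp h1 h2 h3 n.
exists (vadd v t e); split.
  apply: Z.divide_trans hn; rewrite Nat2Z.inj_add Z.pow_add_r; [|lia|lia].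
  exact: Z.divide_factor_r.
split.
  apply: primitive_cong hv; apply: vcong_vadd; apply: Z.divide_trans ht.
  by rewrite addSn Nat2Z.inj_succ Z.pow_succ_r; [apply: Z.divide_factor_l|lia].
have -> : dot lin (vadd v t e) - B = (dot lin (vadd v t e) - dot lin v) + (dot lin v - B) by ring.
apply: Z.divide_add_r => //; apply: dot_cong; apply: vcong_vadd.
exact: Z.divide_trans hst ht.
Qed.

Definition primes_list ps := List.NoDup ps /\ forall p, In p ps -> Znumtheory.prime p.
Definition prodz (l : list Z) := List.fold_right Z.mul 1 l.
Definition powers N ps := List.map (fun p => p ^ Z.of_nat N) ps.

Lemma primes_list_cons p ps : primes_list (p :: ps) -> Znumtheory.prime p /\ ~ In p ps /\ primes_list ps.
Proof.
move=> [h1 h2]; inversion h1; subst; split; first by apply: h2; left.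
by split=> //; split=> // q hq; apply: h2; right.
Qed.

Lemma prodz_pos N ps : primes_list ps -> 0 < prodz (powers N ps).
Proof.
elim: ps => [|p ps IH] //= /primes_list_cons[pp [_ h]]; apply: Z.mul_pos_pos; last exact: IH.
by apply: Z.pow_pos_nonneg; have := prime_ge_2 p pp; lia.
Qed.

Lemma prime_pow_div p q N : Znumtheory.prime p -> (p | q ^ Z.of_nat N) -> (p | q).
Proof.
move=> pp; elim: N => [|N IH]; first by move/(prime_not_div_1 pp).
by rewrite Nat2Z.inj_succ Z.pow_succ_r; [move/(prime_mult p pp)=> []//|lia].
Qed.

Lemma prime_div_prodz p N ps : Znumtheory.prime p -> primes_list ps -> (p | prodz (powers N ps)) -> In p ps.
Proof.
move=> pp; elim: ps => [|q ps IH] /=; first by move=> _ /(prime_not_div_1 pp).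
move=> /primes_list_cons[pq [_ h]] /(prime_mult p pp)[/(prime_pow_div pp)|/(IH h)]; last by right.
by move=> hpq; left; symmetry; apply: prime_div_prime.
Qed.

Lemma prodz_coprime p N ps : primes_list (p :: ps) -> rel_prime (p ^ Z.of_nat N) (prodz (powers N ps)).
Proof.
move=> /primes_list_cons[pp [np h]]; apply: rel_prime_by_primes => [|q pq /(prime_pow_div pq) q1 q2].
  by have := prodz_pos N h; lia.
apply: np; have -> : p = q by symmetry; apply: prime_div_prime.
exact: prime_div_prodz q2.
Qed.

Lemma in_prodz p N ps : In p ps -> (p ^ Z.of_nat N | prodz (powers N ps)).
Proof.
elim: ps => [//|q ps IH] /= [->|/IH h]; first exact: Z.divide_factor_l.
exact: Z.divide_mul_r.
Qed.

Lemma prodz_divide N ps X : primes_list ps -> (forall p, In p ps -> (p ^ Z.of_nat N | X)) ->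
  (prodz (powers N ps) | X).
Proof.
elim: ps => [|p ps IH] h hX /=; first exact: Z.divide_1_l.
apply: rel_prime_divide_mul; first exact: prodz_coprime.
  by apply: hX; left.
have [_ [_ h']] := primes_list_cons h; apply: IH => // q hq; apply: hX; by right.
Qed.

Lemma divide_mul2 a b c d : (a | b) -> (c | d) -> (a * c | b * d).
Proof. by move=> [k ->] [l ->]; exists (k * l); ring. Qed.

Lemma smooth_divides ps M : primes_list ps -> 0 < M ->
  (forall p, Znumtheory.prime p -> (p | M) -> In p ps) -> exists N, (M | prodz (powers N ps)).
Proof.
move=> hps M0; have M0' : 0 <= M by lia.
move: M M0' M0; apply: (Z_lt_induction (fun M => 0 < M -> _)) => M IH M0 hM.
case: (Z_lt_dec 1 M) => [M1|]; last first.
  by move=> ?; have -> : M = 1 by [lia]; exists 0%N; apply: Z.divide_1_l.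
have [p [pp pM]] := prime_divisor M1; have pin := hM p pp pM; have p2 := prime_ge_2 p pp.
have [M' EM] := pM.
have [N hN] := IH M' ltac:(nia) ltac:(nia) ltac:(move=> q pq qM; apply: hM => //; rewrite EM; exact: Z.divide_mul_l).
exists N.+1%N; rewrite EM.
have -> : prodz (powers N.+1%N ps) = prodz (powers N ps) * prodz (powers 1 ps).
  have cons K q l : prodz (powers K (q :: l)) = q ^ Z.of_nat K * prodz (powers K l) by [].
  elim: (ps) => [//|q l El]; rewrite !cons El Nat2Z.inj_succ Z.pow_succ_r; last by lia.
  by rewrite -[Z.of_nat 1]/1 Z.pow_1_r; ring.
apply: divide_mul2 => //; have := @in_prodz p 1 ps pin; by rewrite Z.pow_1_r.
Qed.

Lemma vcrt a b u v : rel_prime a b -> exists w, vcong a w u /\ vcong b w v.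
Proof.
move=> r; have [x [x1 x2]] := crt (vx u) (vx v) r; have [y [y1 y2]] := crt (vy u) (vy v) r.
by have [z [z1 z2]] := crt (vz u) (vz v) r; exists (Vec x y z).
Qed.

Lemma vcong_divide q q' u v : (q' | q) -> vcong q u v -> vcong q' u v.
Proof. by move=> h [h1 [h2 h3]]; split; [|split]; eapply Z.divide_trans; eassumption. Qed.

Lemma crt_list (R : Z -> vec -> Prop) N ps : primes_list ps -> (forall p, In p ps -> exists z, R p z) ->
  exists x, forall p, In p ps -> exists z, R p z /\ vcong (p ^ Z.of_nat N) x z.
Proof.
elim: ps => [|p ps IH] h hR; first by exists (Vec 0 0 0).
have [_ [_ h']] := primes_list_cons h.
have [y hy] : exists y, forall p, In p ps -> exists z, R p z /\ vcong (p ^ Z.of_nat N) y z.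
  by apply: IH => // q hq; apply: hR; right.
have [z hz] := hR p (or_introl erefl).
have [x [x1 x2]] := vcrt z y (prodz_coprime N h).
exists x => q /= [<-|hq]; first by exists z.
have [z' [r' c']] := hy q hq; exists z'; split=> //; apply: vcong_trans c'.
by apply: vcong_divide x2; apply: in_prodz.
Qed.

(** [t] is the part of [g] prime to [z], so that every prime of [g] divides exactly one of [z] and
    [Q * t]. *)
Lemma coprime_shift z Q g : g <> 0 ->
  (forall p, Znumtheory.prime p -> (p | Q) -> (p | z) -> (p | g) -> False) ->
  exists t, Z.gcd g (z + Q * t) = 1.
Proof.
move=> g0 h; have ag : 0 < Z.abs g by lia.
have [g1 [g2 [g10 [g20 [E [r1 [r2 h2]]]]]]] := coprime_split z ag.
exists g1; apply/Zgcd_1_rel_prime; apply: rel_prime_sym; apply: rel_prime_by_primes => // p pp p1 p2.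
have : (p | g1 * g2) by rewrite -E; apply/Z.divide_abs_r.
move/(prime_mult p pp) => [q1|q2].
- apply: (rel_prime_prime r1 pp q1).
  have -> : z = (z + Q * g1) - Q * g1 by ring.
  by apply: Z.divide_sub_r => //; apply: Z.divide_mul_r.
- have pz := h2 p pp q2.
  have : (p | Q * g1).
    have -> : Q * g1 = (z + Q * g1) - z by ring.
    exact: Z.divide_sub_r.
  move/(prime_mult p pp) => [pQ|pg]; first exact: (h p pp pQ pz p2).
  exact: (rel_prime_prime r2 pp pg q2).
Qed.

Theorem global_solution f D lin (st : Z -> Z) B ps M : primes_list ps -> 0 < M ->
  (forall p, Znumtheory.prime p -> (p | M) -> In p ps) ->
  (forall p, In p ps -> (st p | p ^ 2)) ->
  (forall p, In p ps -> local_solution f D lin (st p) B p) ->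
  exists x, (M | val f x - D) /\ content1 x /\ forall p, In p ps -> (st p | dot lin x - B).
Proof.
move=> hps M0 hM hst hloc.
have [N hN] := smooth_divides hps M0 hM.
(* The two extra powers preserve primitivity at [p] and the residue modulo [st p], a divisor of
   [p ^ 2], even if [N] is 0. *)
have [y hy] := crt_list N.+2%N hps (fun p hp => hloc p hp N.+2%N).
set Q := prodz (powers N.+2%N ps).
have pw p k : (k <= N.+2)%N -> (p ^ Z.of_nat k | p ^ Z.of_nat N.+2%N).
  move=> hk; have -> : (N.+2 = k + (N.+2 - k))%N by rewrite subnKC.
  by rewrite Nat2Z.inj_add Z.pow_add_r; [exact: Z.divide_factor_l|lia|lia].
have pdiv p : Znumtheory.prime p -> (p | Q) -> In p ps by move=> pp; apply: prime_div_prodz.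
have Q0 : 0 < Q by apply: prodz_pos.
have prim p : In p ps -> primitive_at p y.
  move=> hp; have [z [[_ [pz _]] c]] := hy p hp; apply: primitive_cong pz.
  by apply: vcong_divide c; have := pw p 1%N isT; rewrite Z.pow_1_r.
(* A nonzero first coordinate keeps the gcd with the second one nonzero, as [coprime_shift]
   requires. *)
have [a [aQ a0]] : exists a, (Q | a - vx y) /\ a <> 0.
  case: (Z.eq_dec (vx y) 0) => h; last by exists (vx y); rewrite Z.sub_diag; split=> //; apply: Z.divide_0_r.
  by exists Q; rewrite h; split; [exists 1|]; lia.
have g0 : Z.gcd a (vy y) <> 0 by move/Z.gcd_eq_0_l.
have [t ht] : exists t, Z.gcd (Z.gcd a (vy y)) (vz y + Q * t) = 1.
  apply: coprime_shift => // p pp pQ pz pg; apply: (prim p (pdiv p pp pQ)).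
  have pa : (p | a) by apply: Z.divide_trans pg (Z.gcd_divide_l _ _).
  split; last by split=> //; apply: Z.divide_trans pg (Z.gcd_divide_r _ _).
  have -> : vx y = a - (a - vx y) by ring.
  by apply: Z.divide_sub_r => //; apply: Z.divide_trans pQ aQ.
have xy : vcong Q (Vec a (vy y) (vz y + Q * t)) y.
  split; first exact: aQ.
  by split; [rewrite /= Z.sub_diag; apply: Z.divide_0_r|exists t; rewrite /=; ring].
exists (Vec a (vy y) (vz y + Q * t)); split; last split=> //.
  apply: Z.divide_trans hN _; apply: prodz_divide => // p hp.
  have [z [[hz _] c]] := hy p hp.
  have c' : vcong (p ^ Z.of_nat N) (Vec a (vy y) (vz y + Q * t)) z.
    apply: (vcong_divide (q := p ^ Z.of_nat N.+2%N)); first by apply: pw; lia.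
    by apply: vcong_trans c; apply: vcong_divide xy; apply: in_prodz.
  apply: divide_sub_trans (val_cong f c') _.
  by apply: Z.divide_trans hz; apply: pw; lia.
move=> p hp; have [z [[_ [_ lz]] c]] := hy p hp.
have s2 : (st p | p ^ Z.of_nat N.+2%N) by apply: Z.divide_trans (hst p hp) _; apply: (pw p 2%N).
have c' : vcong (st p) (Vec a (vy y) (vz y + Q * t)) z.
  apply: vcong_divide s2 _; apply: vcong_trans c; apply: vcong_divide xy; exact: in_prodz.
exact: divide_sub_trans (dot_cong lin c') lz.
Qed.

End LocalSolutions.

(** * The window for B and nonnegativity of the coordinates *)

Module Windows.
Import ZArith Znumtheory Lia List Bool MSetPositive all_boot zify AnkenyClass TernaryForms HermiteForms AnkenyTernary FormReduction LocalSolutions.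
Set Implicit Arguments. Unset Strict Implicit. Unset Printing Implicit Defensive.
Local Close Scope nat_scope.
Local Open Scope Z_scope.

Lemma mod0_divide x q : q <> 0 -> (x mod q =? 0) = true -> (q | x).
Proof. by move=> q0 /Z.eqb_eq; apply (Z.mod_divide x q q0). Qed.

Fixpoint coprime_all (l : list Z) : bool :=
  if l is x :: l' then (Z.gcd x (prodz l') =? 1) && coprime_all l' else true.

Lemma coprime_all_divide l X : coprime_all l -> (forall x, In x l -> (x | X)) -> (prodz l | X).
Proof.
elim: l => [|x l IH] /=; first by move=> _ _; apply: Z.divide_1_l.
move=> /andP[/Z.eqb_eq h1 h2] h; apply: rel_prime_divide_mul; first exact/Zgcd_1_rel_prime.
  by apply: h; left.
by apply: IH => // y hy; apply: h; right.
Qed.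

Lemma in_divide_prodz x l : In x l -> (x | prodz l).
Proof.
elim: l => [//|y l IH] /= [->|/IH h]; first exact: Z.divide_factor_l.
exact: Z.divide_mul_r.
Qed.

Lemma crt_family (A : Type) (mo : A -> Z) (R : A -> Z -> Prop) ls :
  coprime_all (List.map mo ls) -> (forall l, In l ls -> exists z, R l z) ->
  exists x, forall l, In l ls -> exists z, R l z /\ (mo l | x - z).
Proof.
elim: ls => [|l ls IH] /=; first by exists 0.
move=> /andP[/Z.eqb_eq h1 h2] hR.
have [y hy] := IH h2 (fun l' h => hR l' (or_intror h)).
have [z hz] := hR l (or_introl erefl).
have [x [x1 x2]] : exists x, (mo l | x - z) /\ (prodz (List.map mo ls) | x - y).
  by apply: crt; apply/Zgcd_1_rel_prime.
exists x => l' [<-|hl']; first by exists z.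
have [z' [r' c']] := hy l' hl'; exists z'; split=> //; apply: divide_sub_trans c'.
by apply: Z.divide_trans x2; apply: in_divide_prodz; apply: List.in_map.
Qed.

(** Union bound over [ls]: each bad candidate adds at least one to the sum of the counts. *)
Lemma pigeonhole (A B : Type) (bad : A -> B -> bool) (bound : A -> nat) ls ks :
  (forall l, In l ls -> (List.length (List.filter (bad l) ks) <= bound l)%N) ->
  (List.fold_right (fun l n => (bound l + n)%N) 0%N ls < List.length ks)%N ->
  exists k, In k ks /\ forall l, In l ls -> bad l k = false.
Proof.
move=> hb; suff : (List.fold_right (fun l n => (List.length (List.filter (bad l) ks) + n)%N) 0%N ls < List.length ks)%N ->
  exists k, In k ks /\ forall l, In l ls -> bad l k = false.
  move=> h h'; apply: h; apply: leq_ltn_trans h'.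
  elim: ls hb => [//|l ls IH] hb /=; apply: leq_add; first by apply: hb; left.
  by apply: IH => l' hl'; apply: hb; right.
elim: ks {hb} => [|k ks IH] /=; first by rewrite ltn0.
case E : (List.existsb (fun l => bad l k) ls); last first.
  move=> _; exists k; split; first by left.
  move=> l hl; apply/negP => hlk; move/negP: (negbT E); apply.
  by apply/List.existsb_exists; exists l.
move=> h; have [|k' [hk' hl]] := IH; last by exists k'; split=> //; right.
suff : (List.fold_right (fun l n => (List.length (List.filter (bad l) ks) + n)%N) 0%N ls <
  List.fold_right (fun l n => (List.length (if bad l k then k :: List.filter (bad l) ks else List.filter (bad l) ks) + n)%N) 0%N ls)%N.
  by move=> h2; exact: leq_trans h2 h.
have mono (ls0 : list A) : (List.fold_right (fun l n => (List.length (List.filter (bad l) ks) + n)%N) 0%N ls0 <=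
  List.fold_right (fun l n => (List.length (if bad l k then k :: List.filter (bad l) ks else List.filter (bad l) ks) + n)%N) 0%N ls0)%N.
  elim: ls0 => [//|l ls' IH'] /=; apply: leq_add => //; case: (bad l k) => //=.
elim: ls {IH h} E => [//|l ls IH] /=.
case: (bad l k) => /=.
  by move=> _; rewrite addSn ltnS; apply: leq_add.
by move=> /IH h; rewrite ltn_add2l.
Qed.

(** With [3 A = 2 N + B] the conditions read [(S - 1) A < (B + 1)^2], which makes the coordinates
    nonnegative, and [B^2 < S A], which makes the ternary value positive. They confine [B] between
    about [sqrt (2 (S - 1) N / 3)] and [sqrt (2 S N / 3)]; [b0] is a threshold of the first, and the
    bound on [N] leaves room for [w] values. *)
Lemma window S N w : 4 <= S <= 15 -> 1 <= w -> 3 * w * (S - 1) * (2 * w + 1) + 5 * (w * w) <= N ->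
  exists b0, 1 <= b0 /\ forall B, b0 <= B < b0 + w ->
    (S - 1) * (2 * N + B) < 3 * ((B + 1) * (B + 1)) /\ 3 * (B * B) < S * (2 * N + B).
Proof.
move=> hS w1 hN.
have N1 : 14 <= N by nia.
pose P b := (S - 1) * (2 * N + b) < 3 * ((b + 1) * (b + 1)).
have [b0 [hb0 hm]] : exists b0, 0 <= b0 /\ P b0 /\ (b0 = 0 \/ ~ P (b0 - 1)).
  have hP : P (Z.of_nat (Z.to_nat (6 * S * N))) by rewrite /P; nia.
  move: hP; elim: (Z.to_nat _) => [|n IH] h; first by exists 0; split=> //; split=> //; left.
  case: (Z_lt_dec ((S - 1) * (2 * N + Z.of_nat n)) (3 * ((Z.of_nat n + 1) * (Z.of_nat n + 1)))) => hn.
    exact: IH.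
  exists (Z.of_nat n.+1); split; first by lia.
  split=> //; right; have -> : Z.of_nat n.+1 - 1 = Z.of_nat n by lia.
  exact: hn.
case: hm => hP [b00|hm]; first by exfalso; move: hP; rewrite /P b00; nia.
have b2 : 2 <= b0.
  case: (Z_le_dec 2 b0) => // nb; exfalso; move: hP; rewrite /P.
  have : b0 = 0 \/ b0 = 1 by lia.
  by case=> ->; nia.
have up : 3 * (b0 * b0) <= (S - 1) * (2 * N + b0 - 1).
  by move: hm; rewrite /P; have -> : b0 - 1 + 1 = b0 by [ring]; lia.
have key : 6 * b0 * w + 3 * (w * w) <= 2 * N.
  case: (Z_le_dec (6 * b0 * w + 3 * (w * w)) (2 * N)) => // nk; exfalso.
  set X := (S - 1) * (2 * w + 1) + w.
  have bX : b0 < X.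
    case: (Z_lt_dec b0 X) => // nb; exfalso.
    have e1 : b0 * X <= b0 * b0 by apply: Z.mul_le_mono_nonneg_l; lia.
    have e2 : (S - 1) * (2 * N + b0 - 1) <= (S - 1) * (6 * b0 * w + 3 * (w * w) + b0) by apply: Z.mul_le_mono_nonneg_l; lia.
    have e3 : 3 * w * ((S - 1) * (2 * w + 1)) <= 3 * w * b0 by apply: Z.mul_le_mono_nonneg_l; lia.
    have e4 : 0 < (S - 1) * b0 by apply: Z.mul_pos_pos; lia.
    have e6 : 0 < w * (S - 1) by apply: Z.mul_pos_pos; lia.
    have e5 : 0 <= (S - 1) * (w * w) by apply: Z.mul_nonneg_nonneg; [lia|apply: Z.mul_nonneg_nonneg; lia].
    rewrite /X in e1; lia.
  have : 6 * b0 * w <= 6 * X * w by apply: Z.mul_le_mono_nonneg_r; lia.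
  rewrite /X; lia.
exists b0; split; first by lia.
move=> B [hB1 hB2]; have [j Ej] : exists j, B = b0 + j by exists (B - b0); lia.
have j0 : 0 <= j by lia.
have jw : j < w by lia.
rewrite Ej; split.
  move: hP; rewrite /P => hP.
  have : (S - 1) * j <= 6 * (b0 + 1) * j by apply: Z.mul_le_mono_nonneg_r; lia.
  have : 0 <= j * j by apply: Z.square_nonneg.
  lia.
have : 6 * b0 * j <= 6 * b0 * w by apply: Z.mul_le_mono_nonneg_l; lia.
have : j * j <= w * w by apply: Z.mul_le_mono_nonneg; lia.
have : 0 <= S * j by apply: Z.mul_nonneg_nonneg; lia.
have : 0 < S - 1 by lia.
lia.
Qed.

(** If [x <= -1], the other three terms sum to at least [B + 1], which the weighted Cauchy-Schwarz
    inequality forbids. *)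
Lemma coordinate_nonneg a b c d x y z u A B :
  1 <= a -> 0 < b -> 0 < c -> 0 < d -> 0 <= B -> 0 <= A ->
  a * x + b * y + c * z + d * u = B -> a * (x * x) + b * (y * y) + c * (z * z) + d * (u * u) = A ->
  (a + b + c + d - 1) * A < (B + 1) * (B + 1) -> 0 <= x.
Proof.
move=> a1 b0 c0 d0 B0 A0 EB EA h; case: (Z_le_dec 0 x) => // nx; exfalso.
have cs : (B - a * x) * (B - a * x) <= (b + c + d) * (A - a * (x * x)).
  have -> : B - a * x = b * y + c * z + d * u by lia.
  have -> : A - a * (x * x) = b * (y * y) + c * (z * z) + d * (u * u) by lia.
  have : 0 <= b * c * ((y - z) * (y - z)) + b * d * ((y - u) * (y - u)) + c * d * ((z - u) * (z - u)).
    by do ! apply: Z.add_nonneg_nonneg; (apply: Z.mul_nonneg_nonneg; [apply: Z.mul_nonneg_nonneg; lia|exact: Z.square_nonneg]).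
  have -> : (b + c + d) * (b * (y * y) + c * (z * z) + d * (u * u)) = (b * y + c * z + d * u) * (b * y + c * z + d * u) +
    (b * c * ((y - z) * (y - z)) + b * d * ((y - u) * (y - u)) + c * d * ((z - u) * (z - u))) by ring.
  by lia.
have h1 : (B + 1) * (B + 1) <= (B - a * x) * (B - a * x).
  have : B + 1 <= B - a * x by nia.
  by nia.
have h2 : (b + c + d) * (A - a * (x * x)) <= (b + c + d) * A by apply: Z.mul_le_mono_nonneg_l; nia.
have h3 : (b + c + d) * A <= (a + b + c + d - 1) * A by apply: Z.mul_le_mono_nonneg_r; lia.
lia.
Qed.

End Windows.

(** * Local conditions on N and B in decidable form *)

Module LocalConditions.
Import ZArith Znumtheory Lia List Bool MSetPositive all_boot zify AnkenyClass TernaryForms HermiteForms AnkenyTernary FormReduction LocalSolutions Windows.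
Set Implicit Arguments. Unset Strict Implicit. Unset Printing Implicit Defensive.
Local Close Scope nat_scope.
Local Open Scope Z_scope.

Record quad := Quad { q1 : Z; q2 : Z; q3 : Z; q4 : Z }.
Definition qsum a := q1 a + q2 a + q3 a + q4 a.
Definition qprod a := q1 a * q2 a * q3 a * q4 a.
Definition qlin a := Vec (q1 a) (q2 a) (q3 a).
Definition qsq a := Form (q1 a) (q2 a) (q3 a) 0 0 0.
(* Lagrange: [S * sum a_i x_i^2 - (sum a_i x_i)^2] depends only on the differences [x_i - x_4]. *)
Definition jform a := let S := qsum a in
  Form (q1 a * (S - q1 a)) (q2 a * (S - q2 a)) (q3 a * (S - q3 a))
       (- (q1 a * q2 a)) (- (q1 a * q3 a)) (- (q2 a * q3 a)).
Definition qpos a := 0 < q1 a /\ 0 < q2 a /\ 0 < q3 a /\ 0 < q4 a.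

Lemma bil_jform a u v : bil (jform a) u v = qsum a * bil (qsq a) u v - dot (qlin a) u * dot (qlin a) v.
Proof. by rewrite /jform /qsum /qsq /qlin /dot; forms; ring. Qed.
Lemma val_bil f v : val f v = bil f v v.
Proof. by forms; ring. Qed.
Lemma val_jform a v : val (jform a) v = qsum a * val (qsq a) v - dot (qlin a) v * dot (qlin a) v.
Proof. by rewrite !val_bil bil_jform. Qed.
Lemma fdet_jform a : fdet (jform a) = qsum a * qsum a * qprod a.
Proof. by rewrite /jform /qsum /qprod; forms; ring. Qed.
Lemma pd_jform a : qpos a -> pd (jform a).
Proof.
move=> [h1 [h2 [h3 h4]]]; split; last split.
- by rewrite /jform /qsum /=; apply: Z.mul_pos_pos; lia.
- have -> : fa (jform a) * fb (jform a) - fr (jform a) * fr (jform a) = q1 a * q2 a * (qsum a * (q3 a + q4 a)).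
    by rewrite /jform /qsum /=; ring.
  by rewrite /qsum; do ! (apply: Z.mul_pos_pos); lia.
- by rewrite fdet_jform /qsum /qprod; do ! (apply: Z.mul_pos_pos); lia.
Qed.

(** Modulo [S] the form is minus the square of a linear form, so its two-by-two minors vanish. *)
Lemma hb_act_jform a Q : (qsum a | hb1 (act (jform a) Q)) /\ (qsum a | hb2 (act (jform a) Q)) /\
  (qsum a | hb3 (act (jform a) Q)).
Proof.
rewrite /hb1 /hb2 /hb3 /act; cbn [fa fb fc fr fs ft]; rewrite !val_bil !bil_jform.
move: (qsum a) => S.
case: Q => v1 v2 v3; cbn [mc1 mc2 mc3].
move: (bil _ v1 v1) (bil _ v2 v2) (bil _ v3 v3) (bil _ v1 v2) (bil _ v1 v3) (bil _ v2 v3) => b11 b22 b33 b12 b13 b23.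
move: (dot _ v1) (dot _ v2) (dot _ v3) => l1 l2 l3.
split; first by exists (S * (b11 * b22 - b12 * b12) - b11 * (l2 * l2) - b22 * (l1 * l1) + 2 * b12 * (l1 * l2)); ring.
split; last by exists (S * (b11 * b33 - b13 * b13) - b11 * (l3 * l3) - b33 * (l1 * l1) + 2 * b13 * (l1 * l3)); ring.
by exists (S * (b11 * b23 - b12 * b13) - b11 * (l2 * l3) - b23 * (l1 * l1) + b12 * (l1 * l3) + b13 * (l1 * l2)); ring.
Qed.

Lemma divide_congr q x y : (q | x - y) -> (q | y) -> (q | x).
Proof. by move=> h1 h2; have -> : x = (x - y) + y by [ring]; apply: Z.divide_add_r. Qed.

Lemma hb_feq m f g : feq m f g -> (m | hb1 f - hb1 g) /\ (m | hb2 f - hb2 g) /\ (m | hb3 f - hb3 g).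
Proof.
move=> [[i1 e1] [[i2 e2] [[i3 e3] [[i4 e4] [[i5 e5] [i6 e6]]]]]]; rewrite /hb1 /hb2 /hb3.
have -> : fa f = fa g + i1 * m by lia.
have -> : fb f = fb g + i2 * m by lia.
have -> : fc f = fc g + i3 * m by lia.
have -> : fr f = fr g + i4 * m by lia.
have -> : fs f = fs g + i5 * m by lia.
have -> : ft f = ft g + i6 * m by lia.
split; first by exists (fa g * i2 + i1 * fb g + i1 * i2 * m - 2 * fr g * i4 - i4 * i4 * m); ring.
split; last by exists (fa g * i3 + i1 * fc g + i1 * i3 * m - 2 * fs g * i5 - i5 * i5 * m); ring.
by exists (fa g * i6 + i1 * ft g + i1 * i6 * m - fr g * i5 - i4 * fs g - i4 * i5 * m); ring.
Qed.

(** Succeeds as soon as the remaining list is too short to exceed the allowance [b], which spares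
    most of the tests. *)
Fixpoint few_bad (A : Type) (ok : A -> bool) b l := if Nat.leb (List.length l) b then true else
  if l is k :: l' then if ok k then few_bad ok b l' else if b is S b' then few_bad ok b' l' else false else true.

Lemma few_badP (A : Type) (ok : A -> bool) b l :
  few_bad ok b l -> (List.length (List.filter (fun k => negb (ok k)) l) <= b)%N.
Proof.
elim: l b => [//|k l IH] b.
rewrite -[few_bad _ _ _]/(if Nat.leb (List.length (k :: l)) b then true else
  if ok k then few_bad ok b l else if b is S b' then few_bad ok b' l else false).
have h := List.filter_length_le (fun k => negb (ok k)) (k :: l).
case E : (Nat.leb _ b); first by move/Nat.leb_le: E => E _; apply/leP; apply: Nat.le_trans h E.
move=> {h E} /=; case: (ok k) => /= [/IH//|].
by case: b => // b /IH.
Qed.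

(* Condition at the prime [l_p].  Witnesses modulo [p^l_k] are searched in the box
   [l_box]; [D'] is required to lie in [l_G] modulo [l_h], [B] in [l_B] modulo [l_q];
   [l_st] is the [p]-part of the tracked modulus.  Among [kc] terms of a progression of
   step [g] inside a suitable class modulo [l_g], at most [l_b] values of [B] fail. *)
Record locus := Locus { l_p : Z; l_k : nat; l_box : vec; l_h : Z; l_G : list Z;
  l_q : Z; l_B : list Z; l_st : Z; l_g : Z; l_b : nat }.

Section Checker.
Variables (a : quad) (c : Z).
Let S := qsum a.
Let J := jform a.
Let lin := qlin a.
Let c3 := 3 * (c * c).

Definition memz x (l : list Z) := List.existsb (Z.eqb x) l.
Lemma memzP x l : memz x l -> In x l.
Proof. by move/List.existsb_exists => [y [hy /Z.eqb_eq ->]]. Qed.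

(** Meant as the full [p]-part of [c3]; [locus_wf] confirms that the exponent 6 is large enough. *)
Definition l_v L := Z.gcd c3 (l_p L ^ 6).
(** Since [eform N B = c3 * D'], a residue modulo [l_K] of the left side fixes [D'] modulo
    [l_p ^ l_k]. *)
Definition l_K L := l_p L ^ Z.of_nat (l_k L) * l_v L.

(** Searches the exact exponent [s] of [p] in the derivative along [e]; it must be small enough for
    [hensel] to start at precision [l_k] and for the lift to preserve the linear form modulo
    [l_st]. *)
Definition grad_ok L v e := let g := 2 * bil J v e in
  if g mod (l_p L ^ Z.of_nat (l_k L)) =? 0 then false else
  anyb (fun s : nat =>
    if g mod (l_p L ^ Z.of_nat s.+1) =? 0 then false else
    if g mod (l_p L ^ Z.of_nat s) =? 0 then
      if Nat.leb (s + s.+1) (l_k L) then (l_p L ^ Z.of_nat (l_k L - s)) mod l_st L =? 0 else false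
    else false) (List.seq 0 (l_k L)).

Definition witness L v :=
  if memz (val J v mod l_h L) (l_G L) then
    if (if vx v mod l_p L =? 0 then if vy v mod l_p L =? 0 then vz v mod l_p L =? 0 else false else false) then false
    else if grad_ok L v (Vec 1 0 0) then true else if grad_ok L v (Vec 0 1 0) then true else grad_ok L v (Vec 0 0 1)
  else false.

Definition cuboid b := List.flat_map (fun x => List.flat_map (fun y =>
  List.map (fun z => Vec x y z) (zrange (vz b))) (zrange (vy b))) (zrange (vx b)).
(** Two residues packed into one positive key, so that local solvability for given [N] and [B]
    becomes a single lookup. *)
Definition wkey L K e l := Z.to_pos (e mod K * l_st L + l mod l_st L + 1).
Definition wset L K := List.fold_right (fun v w => if witness L v then
  PositiveSet.add (wkey L K (c3 * val J v) (dot lin v)) w else w) PositiveSet.empty (cuboid (l_box L)).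

Definition eform N B := S * (2 * N + B) - 3 * (B * B).
(** The extra condition at 3 makes [(2 * N + B) / 3] an integer. *)
Definition ok_at L K w N B :=
  if (if l_p L =? 3 then (B - N) mod 3 =? 0 else true) then
    if memz (B mod l_q L) (l_B L) then PositiveSet.mem (wkey L K (eform N B) B) w else false
  else false.

Definition n_cond nq nres L N := if nq mod l_p L =? 0
  then List.existsb (fun x => (N - x) mod l_p L =? 0) nres else true.

(** Only the class of [B] modulo [l_g] is prescribed at this prime, so all its lifts modulo [K] are
    tested. *)
Definition step_ok L K w g kc N beta :=
  for_upto (K / l_g L) (fun i =>
    few_bad (fun k => ok_at L K w N (beta + l_g L * i + g * Z.of_nat k)) (l_b L) (List.seq 0 kc)).

Definition locus_wf L :=
  (0 < l_k L)%N && [&& memz (l_p L) [:: 2; 3; 5; 7; 11; 13], 0 <? l_g L, 0 <? l_h L, 0 <? l_q L, 0 <? l_st L &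
   [&& l_K L mod l_g L =? 0, l_K L mod l_q L =? 0, l_K L mod l_st L =? 0,
       l_p L ^ Z.of_nat (l_k L) mod l_h L =? 0, l_p L ^ 2 mod l_st L =? 0 &
       (c3 mod l_v L =? 0) && negb ((c3 / l_v L) mod l_p L =? 0)]].

Definition locus_ok nq nres g kc L := locus_wf L &&
  let K := l_K L in let w := wset L K in
  for_upto K (fun N => if n_cond nq nres L N then anyb (step_ok L K w g kc N) (zrange (l_g L)) else true).

Lemma small_primes p : memz p [:: 2; 3; 5; 7; 11; 13] -> Znumtheory.prime p.
Proof.
move=> /memzP h; have chk : forall q, In q [:: 2; 3; 5; 7; 11; 13] -> for_range 1 (Z.to_nat (q - 1)) (fun n => Z.gcd n q =? 1).
  by move=> q /= [<-|[<-|[<-|[<-|[<-|[<-|//]]]]]].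
have p2 : 1 < p by move: h => /= [<-|[<-|[<-|[<-|[<-|[<-|//]]]]]].
apply: prime_intro => // n hn; apply/Zgcd_1_rel_prime/Z.eqb_eq.
by apply: (for_rangeP (chk p h)); lia.
Qed.

Lemma wset_mem L K k : PositiveSet.mem k (wset L K) -> exists v, witness L v /\ k = wkey L K (c3 * val J v) (dot lin v).
Proof.
rewrite /wset; elim: (cuboid _) => [//|v l IH] /=.
case E : (witness L v) => // /PositiveSet.mem_spec /PositiveSet.add_spec [->|]; first by exists v.
by move/PositiveSet.mem_spec.
Qed.

Lemma locus_wfP L : locus_wf L -> Znumtheory.prime (l_p L) /\ 0 < l_g L /\ 0 < l_h L /\ 0 < l_q L /\ 0 < l_st L /\
  (l_g L | l_K L) /\ (l_q L | l_K L) /\ (l_st L | l_K L) /\ (l_h L | l_p L ^ Z.of_nat (l_k L)) /\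
  (l_st L | l_p L ^ 2) /\ (l_v L | c3) /\ ~ (l_p L | c3 / l_v L) /\ 0 < l_v L /\ 0 < l_K L /\ (0 < l_k L)%N.
Proof.
rewrite /locus_wf => /andP[k0 /and5P[/small_primes pp /Z.ltb_lt hg /Z.ltb_lt hh /Z.ltb_lt hq /andP[/Z.ltb_lt hs]]].
move=> /and5P[h1 h2 h3 h4 /andP[h5 /andP[h6 h7]]].
have p2 := prime_ge_2 _ pp.
have v0 : 0 < l_v L.
  have := Z.gcd_nonneg c3 (l_p L ^ 6); rewrite /l_v => hv.
  suff : Z.gcd c3 (l_p L ^ 6) <> 0 by lia.
  by move/Z.gcd_eq_0_r; apply: Z.pow_nonzero; lia.
have K0 : 0 < l_K L by apply: Z.mul_pos_pos => //; apply: Z.pow_pos_nonneg; lia.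
do 5 (split; first by []).
do 6 (split; first by apply: mod0_divide; [lia|]).
split=> //.
move=> hd; move/negP: h7; apply; apply/Z.eqb_eq; apply/Z.mod_divide => //; lia.
Qed.

Lemma mod_small_key K st e l e' l' : 0 < K -> 0 < st ->
  Z.to_pos (e mod K * st + l mod st + 1) = Z.to_pos (e' mod K * st + l' mod st + 1) ->
  (K | e - e') /\ (st | l - l').
Proof.
move=> K0 s0 h.
have e1 := Z.mod_pos_bound e K K0; have e2 := Z.mod_pos_bound e' K K0.
have l1 := Z.mod_pos_bound l st s0; have l2 := Z.mod_pos_bound l' st s0.
have p1 : 0 <= e mod K * st by apply: Z.mul_nonneg_nonneg; lia.
have p2 : 0 <= e' mod K * st by apply: Z.mul_nonneg_nonneg; lia.
have E : e mod K * st + l mod st = e' mod K * st + l' mod st by lia.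
have El : l mod st = l' mod st.
  have : (e mod K * st + l mod st) mod st = (e' mod K * st + l' mod st) mod st by rewrite E.
  by rewrite !(Z.add_comm (_ * st)) !Z_mod_plus_full !Z.mod_mod; lia.
have Ee : e mod K = e' mod K.
  have : e mod K * st = e' mod K * st by lia.
  by move/Z.mul_reg_r; apply; lia.
split.
- exists (e / K - e' / K); have := Z.div_mod e K ltac:(lia); have := Z.div_mod e' K ltac:(lia); lia.
- exists (l / st - l' / st); have := Z.div_mod l st ltac:(lia); have := Z.div_mod l' st ltac:(lia); lia.
Qed.

Lemma wkey_eq L e l e' l' : locus_wf L -> wkey L (l_K L) e l = wkey L (l_K L) e' l' -> (l_K L | e - e') /\ (l_st L | l - l').
Proof.
by move=> /locus_wfP[_ [_ [_ [_ [s0 [_ [_ [_ [_ [_ [_ [_ [_ [K0 _]]]]]]]]]]]]]]; apply: mod_small_key.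
Qed.

Lemma ok_periodic L w N N' B B' : locus_wf L -> (l_K L | N - N') -> (l_K L | B - B') ->
  ok_at L (l_K L) w N B = ok_at L (l_K L) w N' B'.
Proof.
move=> /locus_wfP[pp [_ [h0 [q0 [s0 [_ [qK [sK [_ [_ [_ [_ [v0 [K0 kp]]]]]]]]]]]]]] hN hB.
rewrite /ok_at.
have eB q : 0 < q -> (q | l_K L) -> B mod q = B' mod q.
  by move=> hq hd; apply: mod_eq_cong => //; apply: Z.divide_trans hd hB.
have cg (x x' y y' z z' : bool) : x = x' -> y = y' -> z = z' ->
  (if x then if y then z else false else false) = (if x' then if y' then z' else false else false).
  by move=> -> -> ->.
apply: cg; last congr (PositiveSet.mem _ w).
- case E : (l_p L =? 3) => //; move/Z.eqb_eq: E => E.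
  have d3 : (3 | l_K L).
    rewrite /l_K; apply: Z.divide_mul_r; apply: Z.gcd_greatest; first by exists (c * c); rewrite /c3; ring.
    by rewrite E; exists 243.
  congr (_ =? 0); apply: mod_eq_cong => //.
  have -> : B - N - (B' - N') = (B - B') - (N - N') by ring.
  by apply: Z.divide_sub_r; apply: Z.divide_trans d3 _.
- by rewrite (eB _ q0 qK).
- rewrite /wkey (eB _ s0 sK); suff -> : eform N B mod l_K L = eform N' B' mod l_K L by [].
  apply: mod_eq_cong => //.
  have [x Ex] := hN; have [y Ey] := hB.
  exists (S * (2 * x + y) - 3 * y * (B + B')).
  rewrite /eform; have -> : N = N' + x * l_K L by lia.
  have -> : B = B' + y * l_K L by lia.
  by ring.
Qed.

(* What a successful test at [L] yields: [D'] stands for [eform N B / c3]. *)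
Lemma ok_atP L N B : locus_wf L -> ok_at L (l_K L) (wset L (l_K L)) N B ->
  (l_p L = 3 -> (3 | B - N)) /\ In (B mod l_q L) (l_B L) /\ (l_v L | eform N B) /\
  forall D', eform N B = c3 * D' ->
    In (D' mod l_h L) (l_G L) /\ local_solution J D' lin (l_st L) B (l_p L).
Proof.
move=> hw; have [pp [_ [h0 [q0 [s0 [_ [qK [sK [hk [_ [vc [pu [v0 [K0 kp]]]]]]]]]]]]]] := locus_wfP hw.
rewrite /ok_at => /and3P[h1 /memzP h2 /wset_mem[v [hv /(wkey_eq hw)[kE kl]]]].
split; first by move=> E; move: h1; rewrite E /=; apply: mod0_divide.
split=> //; split.
  have -> : eform N B = (eform N B - c3 * val J v) + c3 * val J v by ring.
  apply: Z.divide_add_r; last by apply: Z.divide_mul_l.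
  by apply: Z.divide_trans kE; rewrite /l_K; apply: Z.divide_factor_r.
move=> D' ED.
have pk : (l_p L ^ Z.of_nat (l_k L) | val J v - D').
  have [u Eu] := vc.
  have Eu' : c3 / l_v L = u by rewrite Eu; apply: Z_div_mult_full; lia.
  rewrite Eu' in pu.
  apply: (Gauss _ u).
    have [y Ey] := kE; exists (- y).
    have : l_v L * (u * (val J v - D')) = l_v L * (- y * l_p L ^ Z.of_nat (l_k L)).
      have -> : l_v L * (u * (val J v - D')) = - (c3 * D' - c3 * val J v) by rewrite Eu; ring.
      by rewrite -ED Ey /l_K; ring.
    by move/Z.mul_reg_l; apply; lia.
  apply: rel_prime_by_primes => [u0|p hp /(prime_pow_div hp) q1 q2].
    by apply: pu; rewrite u0; apply: Z.divide_0_r.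
  by apply: pu; rewrite -(prime_div_prime p (l_p L) hp pp q1).
move: hv; rewrite /witness; case hG : (memz _ _) => //; move/memzP: hG => hG.
case prim : (if _ then _ else false) => // hgr; split.
  have -> : D' mod l_h L = val J v mod l_h L => //.
  apply: mod_eq_cong => //; have -> : D' - val J v = - (val J v - D') by ring.
  by apply/Z.divide_opp_r; apply: Z.divide_trans hk pk.
have prim' : primitive_at (l_p L) v.
  move=> [d1 [d2 d3]]; move/negP: prim; apply.
  have p2 := prime_ge_2 _ pp.
  have h x : (l_p L | x) -> (x mod l_p L =? 0) = true.
    by move=> hx; apply/Z.eqb_eq; apply/Z.mod_divide => //; lia.
  by rewrite !h.
have p2 := prime_ge_2 _ pp.
have main e : grad_ok L v e -> local_solution J D' lin (l_st L) B (l_p L).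
  rewrite /grad_ok; case: (_ =? 0) => // /anybP[s [_]].
  case g2 : (_ =? 0) => //; case g1 : (_ =? 0) => //; case hs : (Nat.leb _ _) => // g3; move/Nat.leb_le: hs => hs.
  have pn n : l_p L ^ Z.of_nat n <> 0 by apply: Z.pow_nonzero; lia.
  apply: (@local_solutionI _ J D' lin _ B v e s (l_k L - (s + s.+1))) => //.
  - exact: mod0_divide.
  - by move=> hd; move/negP: g2; apply; apply/Z.eqb_eq; apply/Z.mod_divide.
  - by rewrite subnKC //; apply/leP.
  - have -> : (s.+1 + (l_k L - (s + s.+1)) = l_k L - s)%N by lia.
    by apply: mod0_divide => //; lia.
  - have -> : dot lin v - B = - (B - dot lin v) by ring.
    by apply/Z.divide_opp_r.
move: hgr; case e1 : (grad_ok _ _ _); first by move=> _; apply: main e1.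
case e2 : (grad_ok _ _ _); first by move=> _; apply: main e2.
exact: main.
Qed.

Lemma locus_okP nq nres g kc L N : locus_ok nq nres g kc L ->
  (exists x, In x nres /\ (nq | N - x)) ->
  exists beta, forall B, (l_g L | B - beta) ->
    (List.length (List.filter (fun k => negb (ok_at L (l_K L) (wset L (l_K L)) N (B + g * Z.of_nat k))) (List.seq 0 kc)) <= l_b L)%N.
Proof.
move=> /andP[hw hN] [x [hx nx]].
have [pp [g0 [h0 [q0 [s0 [gK [qK [sK [hk [_ [vc [pu [v0 [K0 kp]]]]]]]]]]]]]] := locus_wfP hw.
have p2 := prime_ge_2 _ pp.
have := for_uptoP hN (Z.mod_pos_bound N (l_K L) K0).
set N' := N mod l_K L.
have NN : (l_K L | N - N') by exists (N / l_K L); have := Z.div_mod N (l_K L) ltac:(lia); rewrite /N'; lia.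
have -> /= : n_cond nq nres L N'.
  rewrite /n_cond; case E : (_ =? 0) => //.
  apply/List.existsb_exists; exists x; split=> //; apply/Z.eqb_eq; apply/Z.mod_divide; first by lia.
  have pK : (l_p L | N - N').
    apply: Z.divide_trans NN; rewrite /l_K; apply: Z.divide_mul_l.
    have -> : l_k L = ((l_k L).-1.+1)%N by lia.
    by rewrite Nat2Z.inj_succ Z.pow_succ_r; [apply: Z.divide_factor_l|lia].
  have -> : N' - x = (N - x) - (N - N') by ring.
  by apply: Z.divide_sub_r => //; apply: Z.divide_trans nx; apply: mod0_divide E; lia.
move=> /anybP[beta [_ hb]].
exists beta => B [y Ey].
have [z Ez] := gK.
have z0 : 0 < z by nia.
have Kz : l_K L / l_g L = z by rewrite Ez; apply: Z_div_mult_full; lia.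
have := for_uptoP hb (x := y mod z); rewrite Kz => /(_ (Z.mod_pos_bound y z z0))/few_badP.
congr (is_true (leq (List.length _) _)).
apply: List.filter_ext => k; congr negb; symmetry; apply: ok_periodic => //.
have -> : B + g * Z.of_nat k - (beta + l_g L * (y mod z) + g * Z.of_nat k) = (B - beta) - l_g L * (y mod z) by ring.
exists (y / z); rewrite Ey Ez; have := Z.div_mod y z ltac:(lia) => E.
by rewrite {1}E; ring.
Qed.

End Checker.

End LocalConditions.

(** * Carrying representations from the classes of the genus to J *)

Module RepresentationTables.
Import ZArith Znumtheory Lia List Bool MSetPositive all_boot zify AnkenyClass TernaryForms HermiteForms AnkenyTernary FormReduction LocalSolutions Windows LocalConditions.
Set Implicit Arguments. Unset Strict Implicit. Unset Printing Implicit Defensive.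
Local Close Scope nat_scope.
Local Open Scope Z_scope.

Definition form_eqb f g := [&& fa f =? fa g, fb f =? fb g, fc f =? fc g, fr f =? fr g, fs f =? fs g & ft f =? ft g].
Lemma form_eqbP f g : form_eqb f g -> f = g.
Proof.
case: f g => a b c r s t [a' b' c' r' s' t'].
move=> /and5P[/= /Z.eqb_eq -> /Z.eqb_eq -> /Z.eqb_eq -> /Z.eqb_eq -> /andP[/Z.eqb_eq -> /Z.eqb_eq ->]].
by [].
Qed.
Definition scale k f := Form (k * fa f) (k * fb f) (k * fc f) (k * fr f) (k * fs f) (k * ft f).
Lemma val_scale k f v : val (scale k f) v = k * val f v.
Proof. by rewrite /scale; forms; ring. Qed.

(* [(Bm, Y)] sends a vector [z = Bm t] with [f z = D'] to the vector [Y t], where [J] takes the value [c^2 D']. *)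
Definition move := (mat * mat)%type.
Record table := Table { t_form : form; t_ell : vec; t_moves : list move }.
(** [o_nq] and [o_nres] restrict [N], [o_c] is the scaling of the embeddings, [o_hz] a common period
    of their lattices, and [o_kc] the number of candidates for [B]. *)
Record opt := Opt { o_nq : Z; o_nres : list Z; o_c : Z; o_hz : Z; o_kc : nat;
  o_loci : list locus; o_tables : list table }.

Lemma forallbP_in (A : Type) (p : A -> bool) l x : List.forallb p l -> In x l -> p x.
Proof. by move/List.forallb_forall => h hx; apply: h. Qed.

Definition cross u v := Vec (vy u * vz v - vz u * vy v) (vz u * vx v - vx u * vz v) (vx u * vy v - vy u * vx v).
(** The cross products are the rows of the adjugate: by Cramer's rule they decide membership in the
    lattice spanned by the columns. *)
Definition normals (mv : move) := let M := mv.1 in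
  (mdet M, cross (mc2 M) (mc3 M), cross (mc3 M) (mc1 M), cross (mc1 M) (mc2 M)).
Definition on_lattice (n : Z * vec * vec * vec) z := let: (e, n1, n2, n3) := n in
  if dot n1 z mod e =? 0 then if dot n2 z mod e =? 0 then dot n3 z mod e =? 0 else false else false.
Definition member mv z := on_lattice (normals mv) z.

Lemma pos_neq0 x : 0 < x -> x <> 0.
Proof. by move=> + e; rewrite e. Qed.

Lemma memberP mv z : mdet mv.1 <> 0 -> member mv z -> exists t, z = app mv.1 t.
Proof.
case: mv => M Y; rewrite /member /on_lattice /normals; cbn [fst] => e0 /and3P[/(mod0_divide e0)[i hi] /(mod0_divide e0)[j hj] /(mod0_divide e0)[k hk]].
have h x w : mdet M * x = mdet M * w -> x = w by move/Z.mul_reg_l; apply.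
exists (Vec i j k); case: M z e0 hi hj hk h => [[a b c] [d e f] [g h l]] [x y z] e0 hi hj hk H.
set D := mdet _ in e0 hi hj hk H; forms.
congr Vec; apply: H.
- transitivity (a * (i * D) + d * (j * D) + g * (k * D)); last by ring.
  by rewrite -hi -hj -hk /D /cross /dot; forms; ring.
- transitivity (b * (i * D) + e * (j * D) + h * (k * D)); last by ring.
  by rewrite -hi -hj -hk /D /cross /dot; forms; ring.
- transitivity (c * (i * D) + f * (j * D) + l * (k * D)); last by ring.
  by rewrite -hi -hj -hk /D /cross /dot; forms; ring.
Qed.

Lemma vcong_shift q u v : vcong q u v -> exists k, u = vadd v q k.
Proof.
case: u v => x y z [x' y' z'] [[k1 E1] [[k2 E2] [k3 E3]]]; exists (Vec k1 k2 k3).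
by move: E1 E2 E3; rewrite /vadd; cbn [vx vy vz] => *; congr Vec; lia.
Qed.

Lemma sign_combine q e e' y p r B : (e = 1 \/ e = -1) -> (e' = 1 \/ e' = -1) ->
  (q | y - e * p) -> (q | r - e' * p) -> (q | r - B) -> (q | y - B) \/ (q | y + B).
Proof.
move=> he he' [u1 E1] [u2 E2] [u3 E3].
case: he E1 => -> E1; case: he' E2 => -> E2.
- by left; exists (u1 - u2 + u3); lia.
- by right; exists (u1 + u2 - u3); lia.
- by right; exists (u1 + u2 - u3); lia.
- by left; exists (u1 - u2 + u3); lia.
Qed.

Section Case.
Variables (a : quad) (qs : list Z) (amax : Z) (reps : list form).
Let S := qsum a.
Let d := qprod a.
Let J := jform a.
Let lin := qlin a.

(** [reps] may contain forms outside the genus; only the forms missing from it have to be excluded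
    by a residue count. *)
Definition genus_filter (pre : list (Z * list (Z * nat))) f := if List.existsb (form_eqb f) reps then true
  else anyb (fun qr => exceeds (residues f qr.1) qr.2) pre.
Definition genus_ok := (64 * (S * S * d) <? 27 * ((amax + 1) * (amax + 1) * (amax + 1))) &&
  (let pre := List.map (fun q => (q, histogram q (residues J q))) qs in enum_forms S d amax (genus_filter pre)).

Lemma genus_reduced m f P : qpos a -> 0 <= amax -> genus_ok -> (forall q, In q qs -> 0 < q /\ (q | m)) -> (S | m) ->
  pd f -> fdet f = fdet J -> rel_prime (mdet P) m -> feq m f (act J P) ->
  exists U, unimodular U /\ In (act f U) reps.
Proof.
move=> [h1 [h2 [h3 h4]]] am0 /andP[/Z.ltb_lt ham hen] hq Sm hf hdet hP hfeq.
have [U [uU rU]] := reduction hf; exists U; split=> //.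
have hg : feq m (act f U) (act J (mmul P U)) by rewrite act_mmul; apply: feq_act.
have S0 : 0 < S by rewrite /S /qsum; lia.
have d0 : 0 < d by rewrite /d /qprod; do ! apply: Z.mul_pos_pos.
have [e1 [e2 e3]] := hb_feq hg; have [k1 [k2 k3]] := hb_act_jform a (mmul P U).
have dU : fdet (act f U) = S * S * d.
  by rewrite fdet_act hdet fdet_jform -/S -/d; case: uU => ->; ring.
have := enum_formsP S0 d0 am0 ham hen (unimodular_pd uU hf) dU rU.
move=> /(_ (divide_congr (Z.divide_trans _ _ _ Sm e1) k1) (divide_congr (Z.divide_trans _ _ _ Sm e2) k2)
   (divide_congr (Z.divide_trans _ _ _ Sm e3) k3)).
rewrite /genus_filter; case E : (List.existsb _ _).
  by move: E => /List.existsb_exists[g [hg' /form_eqbP ->]].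
move=> /anybP[[q l] [/List.in_map_iff[q' [[<- <-] hq']]]] /=.
have [q0 qm] := hq q' hq'.
rewrite (exceedsP q0 qm (P := mmul P U)) //.
rewrite mdet_mmul; case: uU => ->; first by rewrite Z.mul_1_r.
have -> : mdet P * -1 = - mdet P by ring.
apply: rel_prime_sym; apply/Zgcd_1_rel_prime; rewrite Z.gcd_opp_r; apply/Zgcd_1_rel_prime.
exact: rel_prime_sym.
Qed.

Section Option.
Variable o : opt.
Let c := o_c o.
Let ls := o_loci o.
Definition o_g := prodz (List.map l_g ls).
Definition o_st := prodz (List.map l_st ls).
(** The exponent 12 only has to make [o_m] a multiple of the moduli listed in [opt_ok]. *)
Definition o_m := prodz (powers 12 (List.map l_p ls)).
Definition o_w := Z.of_nat (o_kc o) * o_g.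
Definition o_N0 := 3 * o_w * (S - 1) * (2 * o_w + 1) + 5 * (o_w * o_w).

Definition move_ok f ell (mv : move) := let: (M, Y) := mv in
  [&& form_eqb (act J Y) (scale (c * c) (act f M)), negb (mdet M =? 0),
      [&& member mv (Vec (o_hz o) 0 0), member mv (Vec 0 (o_hz o) 0) & member mv (Vec 0 0 (o_hz o))] &
      let chk e := [&& (dot lin (mc1 Y) - e * dot ell (mc1 M)) mod o_st =? 0,
        (dot lin (mc2 Y) - e * dot ell (mc2 M)) mod o_st =? 0 &
        (dot lin (mc3 Y) - e * dot ell (mc3 M)) mod o_st =? 0] in chk 1 || chk (-1)].

(** A shift of [v] by [h] times a vector changes [val f v] by multiples of [2 h] and [h * h], so
    under these divisibilities [v] modulo [o_hz] determines the value modulo [l_h]. *)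
Definition checkable L := [&& negb (l_h L =? 1), (2 * o_hz o) mod l_h L =? 0 & (o_hz o * o_hz o) mod l_h L =? 0].
Fixpoint admissible v l := if l is L :: l' then
  if memz (v mod l_h L) (l_G L) then admissible v l' else false else true.
Lemma admissibleI v l : (forall L, In L l -> memz (v mod l_h L) (l_G L)) -> admissible v l.
Proof. by elim: l => [//|L l IH] h /=; rewrite h; [apply: IH => L' hL'; apply: h; right|left]. Qed.

Definition covers f mvs := let ns := List.map normals mvs in
  let ls' := List.filter checkable ls in
  for_upto (o_hz o) (fun x => for_upto (o_hz o) (fun y =>
    let A := (fa f * x + 2 * fr f * y) * x + fb f * y * y in let L := 2 * (fs f * x + ft f * y) in
    for_upto (o_hz o) (fun z => let v := A + z * (L + fc f * z) in
      if admissible v ls'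
      then anyb (fun n => on_lattice n (Vec x y z)) ns else true))).

Lemma coversP f mvs v : covers f mvs -> In v (box (o_hz o)) ->
  (forall L, In L ls -> checkable L -> memz (val f v mod l_h L) (l_G L)) -> exists mv, In mv mvs /\ member mv v.
Proof.
move=> h /in_box; case: v => x y z; cbn [vx vy vz] => -[hx [hy hz]] hv.
have := for_uptoP (for_uptoP (for_uptoP h hx) hy) hz; cbv zeta.
have <- : val f (Vec x y z) = (fa f * x + 2 * fr f * y) * x + fb f * y * y + z * (2 * (fs f * x + ft f * y) + fc f * z).
  by rewrite /val; cbn [vx vy vz]; ring.
rewrite admissibleI; last by move=> L /List.filter_In[hL hc]; exact: hv.
move=> /anybP[n [/List.in_map_iff[mv [<- hmv]] hn]].
by exists mv.
Qed.

(** [f] is minus the square of [l] modulo [o_st], as [J] is minus the square of [lin] modulo [S].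
    The tables have to cover every such [l], up to sign. *)
Definition ell_ok f l := [&& (fa f + vx l * vx l) mod o_st =? 0, (fb f + vy l * vy l) mod o_st =? 0,
  (fc f + vz l * vz l) mod o_st =? 0, (fr f + vx l * vy l) mod o_st =? 0 &
  ((fs f + vx l * vz l) mod o_st =? 0) && ((ft f + vy l * vz l) mod o_st =? 0)].

Definition same_ell e l l' := [&& (vx l - e * vx l') mod o_st =? 0, (vy l - e * vy l') mod o_st =? 0 &
  (vz l - e * vz l') mod o_st =? 0].

Definition table_ok T := List.forallb (move_ok (t_form T) (t_ell T)) (t_moves T) && covers (t_form T) (t_moves T).
Definition tables_ok := List.forallb table_ok (o_tables o) &&
  List.forallb (fun f => List.forallb (fun l => if ell_ok f l then
    anyb (fun T => form_eqb (t_form T) f && (same_ell 1 l (t_ell T) || same_ell (-1) l (t_ell T))) (o_tables o)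
    else true) (box o_st)) reps.

(** The congruence between squares leaves a sign at each prime power of [S], and more if that prime
    divides [B]. The conditions on [B] and the tracked residue must reduce this to one common
    sign. *)
Definition sign_ok := for_upto (2 * S) (fun l => for_upto (2 * S) (fun B =>
  [&& (l * l - B * B - S * (l - B)) mod (2 * S) =? 0,
     List.forallb (fun L => memz (B mod l_q L) (l_B L)) ls &
     ((l - B) mod o_st =? 0) || ((l + B) mod o_st =? 0)] ==>
  ((l - B) mod S =? 0) || ((l + B) mod S =? 0))).

Definition opt_ok :=
  [&& [&& 1 <=? q1 a, 1 <=? q2 a, 1 <=? q3 a, 1 <=? q4 a & (4 <=? S) && (S <=? 15)],
      [&& coprime_all (List.map l_p ls), coprime_all (List.map l_g ls), coprime_all (List.map l_st ls) &
        coprime_all (List.map (l_v c) ls)],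
      [&& 0 <? c, 0 <? o_hz o, memz 3 (List.map l_p ls), (List.fold_right (fun L n => l_b L + n)%N 0%N ls < o_kc o)%N &
        prodz (List.map (l_v c) ls) mod (3 * (c * c)) =? 0],
      [&& o_m mod (2 * (S * S * d)) =? 0, List.forallb (fun q => (0 <? q) && (o_m mod q =? 0)) qs,
        S mod o_st =? 0 &
        List.forallb (fun L => (2 * S) mod l_q L =? 0) ls] &
      [&& List.forallb (locus_ok a c (o_nq o) (o_nres o) o_g (o_kc o)) ls, tables_ok & sign_ok]].


Lemma member_vadd mv v h k1 k2 k3 : mdet mv.1 <> 0 -> member mv v -> member mv (Vec h 0 0) ->
  member mv (Vec 0 h 0) -> member mv (Vec 0 0 h) -> member mv (vadd v h (Vec k1 k2 k3)).
Proof.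
move=> e0 /and3P[a1 a2 a3] /and3P[b1 b2 b3] /and3P[c1 c2 c3] /and3P[d1 d2 d3].
have H n : (dot n v mod mdet mv.1 =? 0) = true -> (dot n (Vec h 0 0) mod mdet mv.1 =? 0) = true ->
  (dot n (Vec 0 h 0) mod mdet mv.1 =? 0) = true -> (dot n (Vec 0 0 h) mod mdet mv.1 =? 0) = true ->
  (dot n (vadd v h (Vec k1 k2 k3)) mod mdet mv.1 =? 0) = true.
  move=> /(mod0_divide e0) y0 /(mod0_divide e0) y1 /(mod0_divide e0) y2 /(mod0_divide e0) y3.
  apply/Z.eqb_eq; apply/Z.mod_divide => //.
  have -> : dot n (vadd v h (Vec k1 k2 k3)) = dot n v + k1 * dot n (Vec h 0 0) + k2 * dot n (Vec 0 h 0) + k3 * dot n (Vec 0 0 h).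
    by rewrite /dot /vadd /=; ring.
  by do 3 (apply: Z.divide_add_r; last by apply: Z.divide_mul_r).
by rewrite /member /on_lattice /normals !H.
Qed.

Lemma coprime_all_nodup l : (forall x, In x l -> 1 < x) -> coprime_all l -> List.NoDup l.
Proof.
elim: l => [|x l IH] h /=; first by move=> _; apply: List.NoDup_nil.
move=> /andP[/Z.eqb_eq g1 /IH hl]; apply: List.NoDup_cons; last by apply: hl => y hy; apply: h; right.
move=> /in_divide_prodz hx; have x1 := h x (or_introl erefl).
have := Z.gcd_greatest _ _ _ (Z.divide_refl x) hx; rewrite g1 => /Z.divide_1_r_nonneg; lia.
Qed.

Lemma prodz_gt0 l : (forall x, In x l -> 0 < x) -> 0 < prodz l.
Proof.
elim: l => [|x l IH] h; first by [].
have h1 := h x (or_introl erefl); have h2 := IH (fun y hy => h y (or_intror hy)).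
exact: Z.mul_pos_pos.
Qed.

Lemma nodup_map_inj (A B : Type) (g : A -> B) l x y : List.NoDup (List.map g l) ->
  In x l -> In y l -> g x = g y -> x = y.
Proof.
elim: l => [//|z l IH] /= h; inversion h as [|? ? nz nl]; subst => -[<-|hx] [<-|hy] // E.
- by case: nz; rewrite E; apply: List.in_map.
- by case: nz; rewrite -E; apply: List.in_map.
- exact: IH.
Qed.

Hypothesis hopt : opt_ok.
Hypothesis hgen : genus_ok.
Hypothesis ham : 0 <= amax.

(** Local solvability yields, by [ankeny], a form that represents [D'] and is equivalent to a member
    of [reps]. The residue modulo [o_hz] of the representing vector puts it into a lattice that some
    move carries into [J], and the linear form is followed, up to sign, through each change. *)
Lemma tables_represent B D' : 0 < D' ->
  (forall L, In L ls -> In (D' mod l_h L) (l_G L) /\ local_solution J D' lin (l_st L) B (l_p L)) ->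
  exists y, val J y = c * c * D' /\ ((o_st | dot lin y - B) \/ (o_st | dot lin y + B)).
Proof.
move=> D0 hloc; move: (hopt) => /and5P[/and5P[/Z.leb_le a1 /Z.leb_le a2 /Z.leb_le a3 /Z.leb_le a4 /andP[/Z.leb_le S4 _]]].
move=> /and4P[cp _ cst _] /and5P[/Z.ltb_lt c0 /Z.ltb_lt hz0 _ _ _].
move=> /and4P[hm hqs hst _] /and3P[hl /andP[htab htab2] _].
have hq : qpos a by do 3 (split; first exact: Z.lt_le_trans Z.lt_0_1 _); apply: Z.lt_le_trans Z.lt_0_1 _.
have d0 : 0 < d.
  by case: hq => p1 [p2 [p3 p4]]; rewrite /d /qprod; do ! apply: Z.mul_pos_pos.
have wf L : In L ls -> locus_wf c L by move=> hL; have /andP[] := forallbP_in hl hL.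
have wfP L (h : In L ls) := locus_wfP a (wf L h).
have pr L : In L ls -> Znumtheory.prime (l_p L) by move/wfP => [].
have hps : primes_list (List.map l_p ls).
  split.
    apply: coprime_all_nodup cp => x /List.in_map_iff[L [<- hL]]; have := prime_ge_2 _ (pr L hL); lia.
  by move=> x /List.in_map_iff[L [<- hL]]; apply: pr.
have m0 : 0 < o_m by apply: prodz_pos.
have st0 : 0 < o_st.
  apply: prodz_gt0 => x /List.in_map_iff[L [<- /wfP]].
  by case=> _ [_ [_ [_ []]]].
have st1 : o_st <> 0 by move=> e; rewrite e in st0.
have S0 : 0 < S by apply: Z.lt_le_trans S4.
have S1 : S <> 0 by move=> e; rewrite e in S0.
have Sd0 : 0 < 2 * (S * S * d) by apply: Z.mul_pos_pos => //; apply: Z.mul_pos_pos => //; apply: Z.mul_pos_pos.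
have hm2 : (2 * fdet J | o_m) by rewrite /J fdet_jform; exact: mod0_divide (pos_neq0 Sd0) hm.
have Sm : (S | o_m).
  by apply: Z.divide_trans hm2; rewrite /J fdet_jform -/S; exists (2 * S * qprod a); ring.
have stS : (o_st | S) by exact: mod0_divide hst.
have [M0 [M00 [hM0 hank]]] := ankeny (pd_jform hq) m0 hm2 D0.
pose stf p := match List.find (fun L => l_p L =? p) ls with Some L => l_st L | None => 1 end.
have stfP p : In p (List.map l_p ls) -> exists L, In L ls /\ l_p L = p /\ stf p = l_st L.
  move=> /List.in_map_iff[L [Lp hL]]; rewrite /stf.
  case E : (List.find _ _) => [L'|]; last first.
    by have /= := List.find_none _ _ E L hL; rewrite Lp Z.eqb_refl.
  by have [h1 /Z.eqb_eq h2] := List.find_some _ _ E; exists L'.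
have [x0 [hx0 [cx0 lx0]]] : exists x, (M0 | val J x - D') /\ content1 x /\
    forall p, In p (List.map l_p ls) -> (stf p | dot lin x - B).
  apply: global_solution => //.
  - by move=> p pp /(hM0 p pp); apply: prime_div_prodz.
  - by move=> p /stfP[L [hL [<- ->]]]; have [_ [_ [_ [_ [_ [_ [_ [_ [_ [h _]]]]]]]]]] := wfP L hL.
  - by move=> p /stfP[L [hL [<- ->]]]; have [_] := hloc L hL.
have inj L L' : In L ls -> In L' ls -> l_p L = l_p L' -> L = L' by apply: nodup_map_inj; case: hps.
have hlx : (o_st | dot lin x0 - B).
  apply: coprime_all_divide => // s /List.in_map_iff[L [<- hL]].
  have pin := List.in_map l_p _ _ hL; have [L' [hL' [E1 E2]]] := stfP _ pin.
  by have := lx0 _ pin; rewrite E2 (inj L' L).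
have [f [P [hf [df [fD [hfeq [hP hP1]]]]]]] := hank x0 hx0 cx0.
have hqs' q : In q qs -> 0 < q /\ (q | o_m).
  by move=> /(forallbP_in hqs)/andP[/Z.ltb_lt q0 h]; split=> //; exact: mod0_divide (pos_neq0 q0) h.
have [U [uU hU]] := genus_reduced hq ham hgen hqs' Sm hf df hP hfeq.
have [w hw] := unimodular_surjective (Vec 1 0 0) uU.
set R := act f U in hU.
have Rw : val R w = D' by rewrite /R val_act hw -fD; case: (f) => *; forms; ring.
pose Q := mmul P U.
have hR : feq o_m R (act J Q) by rewrite /Q act_mmul; apply: feq_act.
(* The linear form [lin] in the coordinates of [R]; its residue passes [ell_ok] because [R] and
   [act J Q] agree modulo [o_m]. *)
pose lQ := Vec (dot lin (mc1 Q)) (dot lin (mc2 Q)) (dot lin (mc3 Q)).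
have lQw v : dot lin (app Q v) = dot lQ v by rewrite /lQ /dot; forms; ring.
have Qw : app Q w = x0.
  rewrite /Q app_mmul hw -hP1; case: (P) => [[? ? ?] [? ? ?] [? ? ?]]; forms; congr Vec; ring.
have hlw : (o_st | dot lQ w - B) by rewrite -lQw Qw.
have stm : (o_st | o_m) by apply: Z.divide_trans stS Sm.
pose l0 := vmod o_st lQ.
have l0Q : vcong o_st l0 lQ by apply: vmod_cong.
have entry x u v i j i' j' : (o_m | x - bil J u v) -> i = dot lin u -> j = dot lin v ->
    (o_st | i' - i) -> (o_st | j' - j) -> ((x + i' * j') mod o_st =? 0) = true.
  move=> h -> -> [k1 E1] [k2 E2]; apply/Z.eqb_eq; apply/Z.mod_divide => //.
  have -> : x + i' * j' = (x - bil J u v) + (S * bil (qsq a) u v) + ((i' - dot lin u) * j' + dot lin u * (j' - dot lin v)).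
    by rewrite bil_jform -/S -/lin; ring.
  apply: Z.divide_add_r; last by rewrite E1 E2; exists (k1 * j' + dot lin u * k2); ring.
  by apply: Z.divide_add_r; [apply: Z.divide_trans stm h|apply: Z.divide_mul_l].
have hell : ell_ok R l0.
  move: hR l0Q => [r1 [r2 [r3 [r4 [r5 r6]]]]] [v1 [v2 v3]].
  rewrite /act in r1 r2 r3 r4 r5 r6; cbn [fa fb fc fr fs ft] in r1, r2, r3, r4, r5, r6; rewrite !val_bil in r1 r2 r3.
  apply/and5P; split; last (apply/andP; split).
  - exact: (entry _ _ _ _ _ _ _ r1 erefl erefl v1 v1).
  - exact: (entry _ _ _ _ _ _ _ r2 erefl erefl v2 v2).
  - exact: (entry _ _ _ _ _ _ _ r3 erefl erefl v3 v3).
  - exact: (entry _ _ _ _ _ _ _ r4 erefl erefl v1 v2).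
  - exact: (entry _ _ _ _ _ _ _ r5 erefl erefl v1 v3).
  - exact: (entry _ _ _ _ _ _ _ r6 erefl erefl v2 v3).
have := forallbP_in (forallbP_in htab2 hU) (vmod_box lQ st0); rewrite -/l0 hell.
move=> /anybP[T [hT /andP[/form_eqbP ET hsame]]].
have /andP[hmv hcov] := forallbP_in htab hT; rewrite ET in hmv hcov.
pose v0 := vmod (o_hz o) w.
have [[k1 k2 k3] Ew] := vcong_shift (vcong_sym (vmod_cong w hz0)); rewrite -/v0 in Ew.
have hcond L : In L ls -> checkable L -> memz (val R v0 mod l_h L) (l_G L).
  move=> hL /and3P[_ z1 z2]; have [pp [_ [h0 _]]] := wfP L hL.
  have {}z1 : (l_h L | 2 * o_hz o) by exact: mod0_divide (pos_neq0 h0) z1.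
  have {}z2 : (l_h L | o_hz o * o_hz o) by exact: mod0_divide (pos_neq0 h0) z2.
  have [hG _] := hloc L hL; apply/List.existsb_exists; exists (D' mod l_h L); split=> //.
  apply/Z.eqb_eq; apply: mod_eq_cong => //.
  have := val_vadd R v0 (o_hz o) (Vec k1 k2 k3); rewrite -Ew Rw => ->.
  have -> : forall p q r s t, p - (p + q * (2 * r) + s * t) = - (2 * q * r + s * t) by move=> *; ring.
  by apply/Z.divide_opp_r; apply: Z.divide_add_r; apply: Z.divide_mul_l.
have [[M Y] [hMY mem0]] := coversP hcov (vmod_box w hz0) hcond.
have := forallbP_in hmv hMY; rewrite /move_ok => /and4P[/form_eqbP EJ /negP nM /and3P[m1 m2 m3] hchk].
have dM : mdet M <> 0 by move=> e; apply: nM; rewrite e.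
have memw : member (M, Y) w by rewrite Ew; exact: member_vadd.
have [t Et] : exists t, w = app M t := @memberP (M, Y) w dM memw.
exists (app Y t); split.
  by rewrite -val_act EJ val_scale val_act -Et Rw.
have [e [he hY]] : exists e, (e = 1 \/ e = -1) /\ (o_st | dot lin (app Y t) - e * dot (t_ell T) w).
  have chk e : [&& (dot lin (mc1 Y) - e * dot (t_ell T) (mc1 M)) mod o_st =? 0,
        (dot lin (mc2 Y) - e * dot (t_ell T) (mc2 M)) mod o_st =? 0 &
        (dot lin (mc3 Y) - e * dot (t_ell T) (mc3 M)) mod o_st =? 0] -> (o_st | dot lin (app Y t) - e * dot (t_ell T) w).
    move=> /and3P[/(mod0_divide st1) y1 /(mod0_divide st1) y2 /(mod0_divide st1) y3].
    have -> : dot lin (app Y t) - e * dot (t_ell T) w = vx t * (dot lin (mc1 Y) - e * dot (t_ell T) (mc1 M)) +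
      vy t * (dot lin (mc2 Y) - e * dot (t_ell T) (mc2 M)) + vz t * (dot lin (mc3 Y) - e * dot (t_ell T) (mc3 M)).
      by rewrite Et /dot; forms; ring.
    by apply: Z.divide_add_r; [apply: Z.divide_add_r|]; apply: Z.divide_mul_r.
  by case/orP: hchk => /chk h; [exists 1|exists (-1)]; split=> //; [left|right].
have [e' [he' hl0]] : exists e', (e' = 1 \/ e' = -1) /\ (o_st | dot l0 w - e' * dot (t_ell T) w).
  have chk e0 : same_ell e0 l0 (t_ell T) -> (o_st | dot l0 w - e0 * dot (t_ell T) w).
    move=> /and3P[/(mod0_divide st1) y1 /(mod0_divide st1) y2 /(mod0_divide st1) y3].
    have -> : dot l0 w - e0 * dot (t_ell T) w = vx w * (vx l0 - e0 * vx (t_ell T)) +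
      vy w * (vy l0 - e0 * vy (t_ell T)) + vz w * (vz l0 - e0 * vz (t_ell T)) by rewrite /dot; ring.
    by apply: Z.divide_add_r; [apply: Z.divide_add_r|]; apply: Z.divide_mul_r.
  by case/orP: hsame => /chk h; [exists 1|exists (-1)]; split=> //; [left|right].
have hlw0 : (o_st | dot l0 w - B).
  apply: divide_sub_trans hlw; have -> : dot l0 w - dot lQ w = dot w l0 - dot w lQ by rewrite /dot; ring.
  exact: dot_cong.
exact: sign_combine he he' hY hl0 hlw0.
Qed.

Lemma sign_okP l B : 0 < S -> 0 < o_st -> (o_st | S) -> sign_ok ->
  (forall L, In L ls -> 0 < l_q L /\ (l_q L | 2 * S) /\ In (B mod l_q L) (l_B L)) ->
  (2 * S | l * l - B * B - S * (l - B)) -> (o_st | l - B) \/ (o_st | l + B) ->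
  (S | l - B) \/ (S | l + B).
Proof.
move=> S0 st0 stS hs hB hl hst.
have S20 : 0 < 2 * S by lia.
have S2z := pos_neq0 S20; have Sz := pos_neq0 S0; have stz := pos_neq0 st0.
have SS : (S | 2 * S) by exists 2.
set l' := l mod (2 * S); set B' := B mod (2 * S).
have dl : (2 * S | l - l') by exists (l / (2 * S)); have := Z.div_mod l (2 * S) S2z; rewrite /l'; lia.
have dB : (2 * S | B - B') by exists (B / (2 * S)); have := Z.div_mod B (2 * S) S2z; rewrite /B'; lia.
have m0 x q : 0 < q -> (q | x) -> (x mod q =? 0) = true.
  by move=> q0 hx; apply/Z.eqb_eq; apply/Z.mod_divide => //; apply: pos_neq0.
have sub q : (q | 2 * S) -> (q | l - B) -> (q | l' - B').
  move=> h1 h2; have -> : l' - B' = (l - B) - (l - l') + (B - B') by ring.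
  by apply: Z.divide_add_r; [apply: Z.divide_sub_r => //|]; apply: Z.divide_trans h1 _.
have add q : (q | 2 * S) -> (q | l + B) -> (q | l' + B').
  move=> h1 h2; have -> : l' + B' = (l + B) - (l - l') - (B - B') by ring.
  by apply: Z.divide_sub_r; [apply: Z.divide_sub_r => //|]; apply: Z.divide_trans h1 _.
have := for_uptoP (for_uptoP hs (Z.mod_pos_bound l _ S20)) (Z.mod_pos_bound B _ S20).
rewrite -/l' -/B'.
have -> : ((l' * l' - B' * B' - S * (l' - B')) mod (2 * S) =? 0) = true.
  apply: m0 => //; have [i Ei] := dl; have [j Ej] := dB.
  have -> : l' * l' - B' * B' - S * (l' - B') = (l * l - B * B - S * (l - B)) - (l - l') * (l + l' - S) + (B - B') * (B + B' - S) by ring.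
  by apply: Z.divide_add_r; [apply: Z.divide_sub_r => //|]; apply: Z.divide_mul_l.
have -> : List.forallb (fun L => memz (B' mod l_q L) (l_B L)) ls = true.
  apply/List.forallb_forall => L hL; have [q0 [qS hq]] := hB L hL.
  apply/List.existsb_exists; exists (B mod l_q L); split=> //; apply/Z.eqb_eq; apply: mod_eq_cong => //.
  have -> : B' - B = - (B - B') by ring.
  by apply/Z.divide_opp_r; apply: Z.divide_trans qS dB.
have st2 := Z.divide_trans _ _ _ stS SS.
have -> : ((l' - B') mod o_st =? 0) || ((l' + B') mod o_st =? 0) = true.
  by apply/orP; case: hst => h; [left; apply: m0 => //; apply: sub|right; apply: m0 => //; apply: add].
move=> /orP[/(mod0_divide Sz) h|/(mod0_divide Sz) h]; [left|right].
- have -> : l - B = (l' - B') + (l - l') - (B - B') by ring.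
  by apply: Z.divide_sub_r; [apply: Z.divide_add_r => //|]; apply: Z.divide_trans SS _.
- have -> : l + B = (l' + B') + (l - l') + (B - B') by ring.
  by apply: Z.divide_add_r; [apply: Z.divide_add_r => //|]; apply: Z.divide_trans SS _.
Qed.

(** For [y_i = x_i - x_4] the condition [sum a_i x_i = B] reads [dot lin y + S x_4 = B], which has
    an integral [x_4] exactly under the congruence; [- y] serves the opposite sign. *)
Lemma solution_of_difference y A B : qpos a -> val J y = S * A - B * B -> 0 <= B -> 0 <= A ->
  (S - 1) * A < (B + 1) * (B + 1) -> (S | dot lin y - B) \/ (S | dot lin y + B) ->
  exists x1 x2 x3 x4, 0 <= x1 /\ 0 <= x2 /\ 0 <= x3 /\ 0 <= x4 /\
    q1 a * x1 + q2 a * x2 + q3 a * x3 + q4 a * x4 = B /\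
    q1 a * (x1 * x1) + q2 a * (x2 * x2) + q3 a * (x3 * x3) + q4 a * (x4 * x4) = A.
Proof.
move=> [p1 [p2 [p3 p4]]] hJ B0 A0 hw hS.
have S0 : 0 < S by rewrite /S /qsum; lia.
have [z [Ez hz]] : exists z, val J z = S * A - B * B /\ (S | B - dot lin z).
  case: hS => [[k E]|[k E]].
    by exists y; split=> //; exists (- k); lia.
  exists (Vec (- vx y) (- vy y) (- vz y)); split.
    by rewrite -hJ; case: (y) => *; rewrite /J /jform; forms; ring.
  exists k; rewrite -E /dot; cbn [vx vy vz]; ring.
have [t Et] := hz.
set x1 := vx z + t; set x2 := vy z + t; set x3 := vz z + t.
have eB : q1 a * x1 + q2 a * x2 + q3 a * x3 + q4 a * t = B.
  have -> : B = (B - dot lin z) + dot lin z by ring.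
  rewrite Et /x1 /x2 /x3 /dot /lin /qlin /S /qsum; cbn [vx vy vz]; ring.
have eA : q1 a * (x1 * x1) + q2 a * (x2 * x2) + q3 a * (x3 * x3) + q4 a * (t * t) = A.
  have : S * (q1 a * (x1 * x1) + q2 a * (x2 * x2) + q3 a * (x3 * x3) + q4 a * (t * t)) = S * A.
    have -> : S * A = val J z + B * B by lia.
    rewrite -eB /x1 /x2 /x3 /S /J /jform /qsum; case: (z) => u v w; forms; ring.
  by move/Z.mul_reg_l; apply; apply: pos_neq0.
exists x1, x2, x3, t.
have one b : 0 < b -> 1 <= b by lia.
split; first by apply: (coordinate_nonneg (one _ p1) p2 p3 p4 B0 A0 eB eA).
have w (p q r u : Z) : p + q + r + u = S -> (p + q + r + u - 1) * A < (B + 1) * (B + 1) by move=> ->.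
have eB2 : q2 a * x2 + q1 a * x1 + q3 a * x3 + q4 a * t = B by rewrite -eB; ring.
have eA2 : q2 a * (x2 * x2) + q1 a * (x1 * x1) + q3 a * (x3 * x3) + q4 a * (t * t) = A by rewrite -eA; ring.
have eB3 : q3 a * x3 + q1 a * x1 + q2 a * x2 + q4 a * t = B by rewrite -eB; ring.
have eA3 : q3 a * (x3 * x3) + q1 a * (x1 * x1) + q2 a * (x2 * x2) + q4 a * (t * t) = A by rewrite -eA; ring.
have eB4 : q4 a * t + q1 a * x1 + q2 a * x2 + q3 a * x3 = B by rewrite -eB; ring.
have eA4 : q4 a * (t * t) + q1 a * (x1 * x1) + q2 a * (x2 * x2) + q3 a * (x3 * x3) = A by rewrite -eA; ring.
have s2 : q2 a + q1 a + q3 a + q4 a = S by rewrite /S /qsum; ring.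
have s3 : q3 a + q1 a + q2 a + q4 a = S by rewrite /S /qsum; ring.
have s4 : q4 a + q1 a + q2 a + q3 a = S by rewrite /S /qsum; ring.
split; first exact: (coordinate_nonneg (one _ p2) p1 p3 p4 B0 A0 eB2 eA2 (w _ _ _ _ s2)).
split; first exact: (coordinate_nonneg (one _ p3) p1 p2 p4 B0 A0 eB3 eA3 (w _ _ _ _ s3)).
split=> //; exact: (coordinate_nonneg (one _ p4) p1 p2 p3 B0 A0 eB4 eA4 (w _ _ _ _ s4)).
Qed.

(** The loci prescribe [B] modulo [o_g]; [o_kc] terms of this progression fit into the window, and
    fewer than [o_kc] of them are spoiled by some locus. *)
Theorem opt_sound N : o_N0 <= N -> (exists x, In x (o_nres o) /\ (o_nq o | N - x)) ->
  exists x1 x2 x3 x4, 0 <= x1 /\ 0 <= x2 /\ 0 <= x3 /\ 0 <= x4 /\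
    q1 a * (3 * (x1 * x1) - x1) + q2 a * (3 * (x2 * x2) - x2) + q3 a * (3 * (x3 * x3) - x3) +
    q4 a * (3 * (x4 * x4) - x4) = 2 * N.
Proof.
move=> hN hres; have rep := tables_represent.
move: (hopt) => /and5P[/and5P[/Z.leb_le a1 /Z.leb_le a2 /Z.leb_le a3 /Z.leb_le a4 /andP[/Z.leb_le S4 /Z.leb_le S15]]].
move=> /and4P[cp cg cst cv] /and5P[/Z.ltb_lt c0 _ h3 hb hv].
move=> /and4P[_ _ hst hqS] /and3P[hl _ hsign].
have hq : qpos a by do 3 (split; first exact: Z.lt_le_trans Z.lt_0_1 _); apply: Z.lt_le_trans Z.lt_0_1 _.
have S0 : 0 < S by apply: Z.lt_le_trans S4.
have wf L : In L ls -> locus_wf c L by move=> hL; have /andP[] := forallbP_in hl hL.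
have wfP L (h : In L ls) := locus_wfP a (wf L h).
have g0 : 0 < o_g by apply: prodz_gt0 => x /List.in_map_iff[L [<- /wfP]] [_ []].
have st0 : 0 < o_st.
  apply: prodz_gt0 => x /List.in_map_iff[L [<- /wfP]].
  by case=> _ [_ [_ [_ []]]].
have kc0 : (0 < o_kc o)%N by apply: leq_ltn_trans hb.
have w1 : 1 <= o_w by rewrite /o_w; clear -g0 kc0; nia.
have [b0 [b01 hwin]] := window (conj S4 S15) w1 hN.
have [x0 hx0] := crt_family cg (fun L hL => locus_okP (forallbP_in hl hL) hres).
set B0 := b0 + (x0 - b0) mod o_g.
have hB0 : (o_g | B0 - x0).
  by exists (- ((x0 - b0) / o_g)); have := Z.div_mod (x0 - b0) o_g (pos_neq0 g0); rewrite /B0; clear; lia.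
have B0r : b0 <= B0 < b0 + o_g by have := Z.mod_pos_bound (x0 - b0) o_g g0; rewrite /B0; clear; lia.
have [k [hk hok]] := pigeonhole (bad := fun L k => negb (ok_at a L (l_K c L) (wset a c L (l_K c L)) N (B0 + o_g * Z.of_nat k)))
   (bound := l_b) (ls := ls) (ks := List.seq 0 (o_kc o)) (fun L hL =>
   let: ex_intro beta (conj h1 h2) := hx0 L hL in
     h1 B0 (divide_sub_trans (Z.divide_trans _ _ _ (in_divide_prodz (List.in_map l_g _ _ hL)) hB0) h2))
   ltac:(by rewrite List.length_seq).
set B := B0 + o_g * Z.of_nat k in hok.
have kk : (k < o_kc o)%coq_nat by move: hk => /List.in_seq; clear; lia.
have Br : b0 <= B < b0 + o_w by rewrite /B /o_w; clear -B0r kk g0; nia.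
have [win1 win2] := hwin B Br.
have hok' L (hL : In L ls) := ok_atP (wf L hL) (negbFE (hok L hL)).
have B3 : (3 | B - N).
  move: h3 => /memzP/List.in_map_iff[L [E hL]]; have [h _] := hok' L hL; exact: h.
have [u Eu] := B3.
set A := N + u.
have EA : 2 * N + B = 3 * A by rewrite /A; clear -Eu; lia.
have hE : (3 * (c * c) | eform a N B).
  apply: (Z.divide_trans _ (prodz (List.map (l_v c) ls))).
    by apply: mod0_divide hv; apply: pos_neq0; clear -c0; nia.
  apply: coprime_all_divide => // v /List.in_map_iff[L [<- hL]].
  by have [_ [_ [h _]]] := hok' L hL.
have [D' ED] := hE.
have ED' : eform a N B = 3 * (c * c) * D' by rewrite ED; ring.
have D0 : 0 < D'.
  have E0 : 0 < eform a N B by rewrite /eform -/S; clear -win2; lia.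
  by move: E0; rewrite ED'; clear -c0 => h; apply/(Z.mul_pos_cancel_l (3 * (c * c)) D') => //; nia.
have [y [Ey hy]] := rep B D' D0 (fun L hL => let: conj _ (conj _ (conj _ h)) := hok' L hL in h D' ED').
have EJ : val J y = S * A - B * B.
  have : 3 * val J y = 3 * (S * A - B * B).
    by rewrite Ey; have := ED'; rewrite /eform -/S EA; clear; lia.
  by clear; lia.
have stS : (o_st | S) by exact: mod0_divide (pos_neq0 st0) hst.
have hsg : (S | dot lin y - B) \/ (S | dot lin y + B).
  apply: sign_okP => //.
    move=> L hL; have [_ [_ [_ [q0 _]]]] := wfP L hL; split=> //; split.
      by apply: mod0_divide (pos_neq0 q0) _; exact: (forallbP_in hqS hL).
    by have [_ [h _]] := hok' L hL.
  (* A square has the parity of its root, so [val (qsq a) y] has the parity of [dot lin y]; likewise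
     [A] has that of [B]. This sharpens the congruence from modulus [S] to [2 * S]. *)
  have [k1 Ek1] : exists k1, val (qsq a) y - dot lin y = 2 * k1.
    have ev x : exists q, x * x - x = 2 * q.
      by case: (Z.Even_or_Odd x) => [[q ->]|[q ->]]; [exists (q * (2 * q - 1))|exists (q * (2 * q + 1))]; ring.
    have [i Ei] := ev (vx y); have [j Ej] := ev (vy y); have [l El] := ev (vz y).
    exists (q1 a * i + q2 a * j + q3 a * l).
    transitivity (q1 a * (vx y * vx y - vx y) + q2 a * (vy y * vy y - vy y) + q3 a * (vz y * vz y - vz y)).
      by rewrite /qsq /dot /lin /qlin; forms; ring.
    by rewrite Ei Ej El; ring.
  have Elb : dot lin y * dot lin y - B * B = S * (val (qsq a) y - A).
    by move: EJ; rewrite /J val_jform -/S -/lin; clear; lia.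
  rewrite Elb; exists (k1 - (A - N) + (B - N) - u); rewrite -?Eu.
  have -> : val (qsq a) y = dot lin y + 2 * k1 by rewrite -Ek1; ring.
  by rewrite /A; have -> : B = N + 3 * u by [rewrite -(Z.mul_comm u) -Eu; ring]; ring.
have [x1 [x2 [x3 [x4 [p1 [p2 [p3 [p4 [e1 e2]]]]]]]]] : exists x1 x2 x3 x4, 0 <= x1 /\ 0 <= x2 /\ 0 <= x3 /\ 0 <= x4 /\
    q1 a * x1 + q2 a * x2 + q3 a * x3 + q4 a * x4 = B /\
    q1 a * (x1 * x1) + q2 a * (x2 * x2) + q3 a * (x3 * x3) + q4 a * (x4 * x4) = A.
  apply: (solution_of_difference hq EJ) => //.
  - by clear -Br b01; lia.
  - clear -EA win2 S0; nia.
  - by move: win1; rewrite EA; clear; lia.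
exists x1, x2, x3, x4; do 4 (split=> //).
transitivity (3 * A - B); first by rewrite -e1 -e2; ring.
by clear -EA; lia.
Qed.

End Option.
End Case.

End RepresentationTables.

(** * Certificates for the 34 quaternary sums *)

Module Quaternaries.
Import ZArith Znumtheory Lia List Bool MSetPositive all_boot zify TernaryForms FormReduction LocalSolutions Windows LocalConditions RepresentationTables.
Set Implicit Arguments. Unset Strict Implicit. Unset Printing Implicit Defensive.
Local Close Scope nat_scope.
Local Open Scope Z_scope.

Record case := Case { c_quad : quad; c_qs : list Z; c_amax : Z; c_reps : list form; c_opts : list opt }.

(** The last test requires an option for every class of [N] modulo 6. *)
Definition case_ok cs := [&& 0 <=? c_amax cs, genus_ok (c_quad cs) (c_qs cs) (c_amax cs) (c_reps cs),
  List.forallb (opt_ok (c_quad cs) (c_qs cs) (c_reps cs)) (c_opts cs) &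
  List.forallb (fun r => List.existsb (fun o => (0 <? o_nq o) && (6 mod o_nq o =? 0) &&
    List.existsb (fun x => (r - x) mod o_nq o =? 0) (o_nres o)) (c_opts cs)) (zrange 6)].

Definition case_N0 cs := List.fold_right (fun o n => Z.max (o_N0 (c_quad cs) o) n) 0 (c_opts cs).

Definition quad_value a x1 x2 x3 x4 := q1 a * (3 * (x1 * x1) - x1) + q2 a * (3 * (x2 * x2) - x2) +
  q3 a * (3 * (x3 * x3) - x3) + q4 a * (3 * (x4 * x4) - x4).

Lemma case_sound cs N : case_ok cs -> case_N0 cs <= N ->
  exists x1 x2 x3 x4, 0 <= x1 /\ 0 <= x2 /\ 0 <= x3 /\ 0 <= x4 /\ quad_value (c_quad cs) x1 x2 x3 x4 = 2 * N.
Proof.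
move=> /and4P[/Z.leb_le ham hgen hopts hres] hN.
have r6 := Z.mod_pos_bound N 6 (erefl : 0 < 6).
have := forallbP_in hres (proj2 (in_zrange 6 (N mod 6)) r6).
move=> /List.existsb_exists[o [ho /andP[/andP[/Z.ltb_lt n0 h6] /List.existsb_exists[x [hx hxr]]]]].
have No : o_N0 (c_quad cs) o <= N.
  apply: Z.le_trans hN; rewrite /case_N0; elim: (c_opts cs) ho => [//|o' l IH] /= [->|/IH h].
    exact: Z.le_max_l.
  by apply: Z.le_trans h _; apply: Z.le_max_r.
suff hd : (o_nq o | N - x).
  by have [x1 [x2 [x3 [x4 h]]]] := opt_sound (forallbP_in hopts ho) hgen ham No (ex_intro _ x (conj hx hd));
    exists x1, x2, x3, x4.
have n1 := pos_neq0 n0.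
have -> : N - x = (N mod 6 - x) + 6 * (N / 6) by have := Z.div_mod N 6 (pos_neq0 (erefl : 0 < 6)); clear; lia.
by apply: Z.divide_add_r; [exact: mod0_divide hxr|apply: Z.divide_mul_l; exact: mod0_divide h6].
Qed.

Definition M a b c d e f g h i := Mat (Vec a b c) (Vec d e f) (Vec g h i).

(** Certificates are trusted only through [case_ok]. With a single class the one move is an isometry
    onto [J]. Other classes are reached by scaling with [c], which makes [3 * (c * c)] divide
    [eform], or by conditions on [D'] that force its vectors into the sublattices of the moves. *)
Definition case_1111 := Case (Quad 1 1 1 1) [:: 4] 3 [:: Form 3 3 3 1 1 (-1)]
 [:: Opt 1 [:: 0] 1 1 1
 [:: Locus 3 1 (Vec 1 2 3) 1 [:: 0] 1 [:: 0] 1 3 0;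
  Locus 2 3 (Vec 1 1 2) 1 [:: 0] 1 [:: 0] 1 2 0]
 [:: Table (Form 3 3 3 1 1 (-1)) (Vec 0 0 0) [:: (M 1 0 0 0 1 0 0 0 1, M 0 0 1 (-1) 0 0 0 (-1) 0)]]].

Definition case_1112 := Case (Quad 1 1 1 2) [:: 4] 4 [:: Form 4 4 4 1 1 (-1)]
 [:: Opt 1 [:: 0] 1 1 2
 [:: Locus 5 1 (Vec 1 1 3) 1 [:: 0] 5 [:: 1; 2; 3; 4] 1 1 1;
  Locus 3 1 (Vec 2 2 3) 1 [:: 0] 1 [:: 0] 1 3 0;
  Locus 2 3 (Vec 1 2 4) 1 [:: 0] 1 [:: 0] 1 1 0]
 [:: Table (Form 4 4 4 1 1 (-1)) (Vec 0 0 0) [:: (M 1 0 0 0 1 0 0 0 1, M 0 0 1 (-1) 0 0 0 (-1) 0)]]].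

Definition case_1113 := Case (Quad 1 1 1 3) [:: 4; 3] 6 [:: Form 5 5 5 1 1 (-1)]
 [:: Opt 1 [:: 0] 1 1 1
 [:: Locus 3 3 (Vec 2 3 7) 1 [:: 0] 1 [:: 0] 1 9 0;
  Locus 2 3 (Vec 2 2 2) 1 [:: 0] 1 [:: 0] 1 2 0]
 [:: Table (Form 5 5 5 1 1 (-1)) (Vec 0 0 0) [:: (M 1 0 0 0 1 0 0 0 1, M 0 0 1 (-1) 0 0 0 (-1) 0)]]].

Definition case_1114 := Case (Quad 1 1 1 4) [:: 4] 7 [:: Form 6 6 6 1 1 (-1)]
 [:: Opt 1 [:: 0] 1 1 4
 [:: Locus 7 1 (Vec 1 1 4) 1 [:: 0] 7 [:: 1; 2; 3; 4; 5; 6] 1 1 1;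
  Locus 3 1 (Vec 1 2 3) 1 [:: 0] 1 [:: 0] 1 3 0;
  Locus 2 3 (Vec 1 2 2) 1 [:: 0] 1 [:: 0] 1 1 2]
 [:: Table (Form 6 6 6 1 1 (-1)) (Vec 0 0 0) [:: (M 1 0 0 0 1 0 0 0 1, M 0 0 1 (-1) 0 0 0 (-1) 0)]]].

Definition case_1122 := Case (Quad 1 1 2 2) [:: 4; 3] 6 [:: Form 5 5 8 1 2 (-2)]
 [:: Opt 1 [:: 0] 1 1 1
 [:: Locus 3 3 (Vec 2 6 6) 1 [:: 0] 1 [:: 0] 1 3 0;
  Locus 2 3 (Vec 1 2 2) 1 [:: 0] 1 [:: 0] 1 2 0]
 [:: Table (Form 5 5 8 1 2 (-2)) (Vec 0 0 0) [:: (M 1 0 0 0 1 0 0 0 1, M 0 1 0 (-1) 0 0 0 0 (-1))]]].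

Definition case_1123 := Case (Quad 1 1 2 3) [:: 4; 3] 8 [:: Form 6 6 10 1 2 (-2)]
 [:: Opt 1 [:: 0] 1 1 2
 [:: Locus 7 1 (Vec 1 1 4) 1 [:: 0] 7 [:: 1; 2; 3; 4; 5; 6] 1 1 1;
  Locus 3 1 (Vec 1 2 3) 1 [:: 0] 1 [:: 0] 1 3 0;
  Locus 2 3 (Vec 2 3 2) 1 [:: 0] 1 [:: 0] 1 1 0]
 [:: Table (Form 6 6 10 1 2 (-2)) (Vec 0 0 0) [:: (M 1 0 0 0 1 0 0 0 1, M 0 1 0 (-1) 0 0 0 0 (-1))]]].

(** The coefficients sum to 8 and [B] is kept odd: an odd square modulo 16 fixes its root modulo 8
    up to sign. *)
Definition case_1124 := Case (Quad 1 1 2 4) [:: 4; 3; 8; 16] 10 [:: Form 7 7 12 1 2 (-2)]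
 [:: Opt 1 [:: 0] 1 1 1
 [:: Locus 3 1 (Vec 1 2 3) 1 [:: 0] 1 [:: 0] 1 3 0;
  Locus 2 3 (Vec 1 2 1) 1 [:: 0] 2 [:: 1] 1 2 0]
 [:: Table (Form 7 7 12 1 2 (-2)) (Vec 0 0 0) [:: (M 1 0 0 0 1 0 0 0 1, M 0 1 0 (-1) 0 0 0 0 (-1))]]].

Definition case_1125 := Case (Quad 1 1 2 5) [:: 4; 3] 12 [:: Form 2 14 32 1 1 (-4);
  Form 2 14 32 1 1 5;
  Form 8 8 14 1 2 (-2)]
 [:: Opt 1 [:: 0] 1 8 5
 [:: Locus 2 4 (Vec 2 6 1) 16 [:: 0; 1; 3; 5; 6; 7; 8; 9; 11; 13; 14; 15] 1 [:: 0] 1 8 0;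
  Locus 5 1 (Vec 2 3 1) 1 [:: 0] 1 [:: 0] 1 1 2;
  Locus 3 3 (Vec 2 9 3) 1 [:: 0] 1 [:: 0] 9 3 2]
 [:: Table (Form 2 14 32 1 1 (-4)) (Vec 4 2 2) [:: (M 2 0 0 0 1 0 0 0 1, M 0 1 0 0 0 (-1) (-2) 0 0);
  (M 1 0 1 0 1 1 0 0 (-2), M 2 1 0 2 1 1 (-4) (-1) 0);
  (M 1 0 2 0 1 1 0 0 (-4), M (-2) 0 (-3) (-2) 0 (-1) 4 1 6)];
  Table (Form 2 14 32 1 1 5) (Vec 4 2 2) [:: (M 1 0 1 0 1 0 0 0 (-2), M 2 1 0 0 0 (-1) (-4) (-1) 0);
  (M 1 1 0 0 (-2) 0 0 0 1, M 0 1 1 0 (-1) (-2) (-2) 0 0);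
  (M 1 0 2 0 1 1 0 0 (-4), M 2 2 3 0 1 2 (-4) (-3) (-6))];
  Table (Form 8 8 14 1 2 (-2)) (Vec 1 8 7) [:: (M 1 0 0 0 1 0 0 0 1, M 0 1 0 (-1) 0 0 0 0 (-1))]]].

Definition case_1126 := Case (Quad 1 1 2 6) [:: 4; 3; 8] 14 [:: Form 1 20 60 0 0 0;
  Form 4 5 60 0 0 0;
  Form 9 9 16 1 2 (-2)]
 [:: Opt 1 [:: 0] 1 3 2
 [:: Locus 3 1 (Vec 1 2 1) 3 [:: 0] 1 [:: 0] 1 9 0;
  Locus 5 1 (Vec 1 1 3) 1 [:: 0] 1 [:: 0] 1 1 1;
  Locus 2 3 (Vec 1 2 2) 1 [:: 0] 1 [:: 0] 1 2 0]
 [:: Table (Form 1 20 60 0 0 0) (Vec 0 0 0) [:: (M 1 1 0 0 (-3) 0 0 0 1, M (-1) 0 (-1) 3 1 3 (-2) 0 1);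
  (M 1 2 0 0 3 0 0 0 1, M 2 1 2 3 1 3 (-2) 0 1)];
  Table (Form 4 5 60 0 0 0) (Vec 0 0 0) [:: (M 1 2 0 0 3 0 0 0 1, M (-1) (-1) (-1) (-2) (-1) (-1) 0 (-2) 1);
  (M 1 1 0 0 (-3) 0 0 0 1, M 1 0 0 (-2) (-1) (-1) 0 (-2) 1)];
  Table (Form 9 9 16 1 2 (-2)) (Vec 0 0 0) [:: (M 1 0 0 0 1 0 0 0 1, M 0 1 0 (-1) 0 0 0 0 (-1))]]].

Definition case_1127 := Case (Quad 1 1 2 7) [:: 4; 7] 15 [:: Form 2 6 154 1 0 0;
  Form 2 22 44 0 0 (-11);
  Form 2 22 44 0 0 11;
  Form 6 8 40 2 3 1;
  Form 10 10 18 1 2 (-2)]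
 [:: Opt 1 [:: 0] 3 2 4
 [:: Locus 11 1 (Vec 1 1 6) 1 [:: 0] 11 [:: 1; 2; 3; 4; 5; 6; 7; 8; 9; 10] 1 1 1;
  Locus 7 1 (Vec 1 3 4) 1 [:: 0] 1 [:: 0] 1 1 2;
  Locus 3 1 (Vec 1 2 3) 1 [:: 0] 1 [:: 0] 1 27 0;
  Locus 2 3 (Vec 2 3 2) 1 [:: 0] 1 [:: 0] 1 1 0]
 [:: Table (Form 2 6 154 1 0 0) (Vec 0 0 0) [:: (M 1 0 0 0 1 0 0 0 1, M 1 1 0 (-1) 2 0 (-2) (-2) (-9))];
  Table (Form 2 22 44 0 0 (-11)) (Vec 0 0 0) [:: (M 1 0 0 0 1 0 0 0 1, M 0 0 1 (-3) 3 0 (-3) (-6) (-1))];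
  Table (Form 2 22 44 0 0 11) (Vec 0 0 0) [:: (M 1 0 0 0 1 0 0 0 1, M 0 0 1 (-3) 3 0 (-6) (-3) (-1))];
  Table (Form 6 8 40 2 3 1) (Vec 0 0 0) [:: (M 1 1 0 0 (-2) 0 0 0 1, M 0 0 3 0 3 (-3) (-6) 0 0);
  (M 1 0 1 0 1 1 0 0 (-2), M 6 3 3 6 0 3 (-12) (-3) (-3));
  (M 1 0 0 0 1 0 0 0 2, M 1 (-2) 0 (-2) (-2) 0 (-1) (-4) (-9))];
  Table (Form 10 10 18 1 2 (-2)) (Vec 0 0 0) [:: (M 1 0 0 0 1 0 0 0 1, M 0 1 (-2) 3 0 0 0 4 1)]]].

Definition case_1128 := Case (Quad 1 1 2 8) [:: 4; 3; 8; 16; 32] 17 [:: Form 3 8 96 0 0 0;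
  Form 8 12 27 0 0 (-6);
  Form 8 12 27 0 0 6;
  Form 11 11 20 1 2 (-2)]
 [:: Opt 2 [:: 0] 1 8 1
 [:: Locus 2 5 (Vec 1 1 2) 16 [:: 0; 4] 2 [:: 0] 1 8 0;
  Locus 3 3 (Vec 3 8 3) 1 [:: 0] 1 [:: 0] 1 3 0]
 [:: Table (Form 3 8 96 0 0 0) (Vec 0 0 0) [:: (M 2 1 0 0 (-2) 0 0 0 1, M 0 0 (-1) 1 1 1 (-2) 2 0)];
  Table (Form 8 12 27 0 0 (-6)) (Vec 0 0 0) [:: (M 1 0 2 0 1 2 0 0 4, M (-1) 3 0 (-2) 2 0 (-3) 5 (-1))];
  Table (Form 8 12 27 0 0 6) (Vec 0 0 0) [:: (M 1 0 2 0 1 2 0 0 4, M (-2) 2 1 (-3) 1 1 (-5) 3 1)];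
  Table (Form 11 11 20 1 2 (-2)) (Vec 0 0 0) [:: (M 1 0 0 0 1 0 0 0 1, M 0 1 0 (-1) 0 0 0 0 (-1))]];
 Opt 6 [:: 1; 5] 1 15 4
 [:: Locus 3 1 (Vec 1 1 2) 3 [:: 2] 1 [:: 0] 1 3 0;
  Locus 5 1 (Vec 1 3 2) 5 [:: 0; 1; 4] 1 [:: 0] 1 1 3;
  Locus 2 5 (Vec 2 4 2) 1 [:: 0] 2 [:: 0] 1 8 0]
 [:: Table (Form 3 8 96 0 0 0) (Vec 0 0 0) [:: (M 1 0 1 0 1 1 0 0 (-3), M (-3) 0 0 (-3) (-1) 0 9 1 1);
  (M 1 0 1 0 1 2 0 0 (-3), M (-3) 0 0 (-6) 0 (-1) 9 1 1);
  (M 1 0 2 0 1 2 0 0 3, M 6 1 1 6 0 1 9 1 1);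
  (M 1 0 2 0 1 1 0 0 (-3), M 6 1 1 3 1 0 (-9) (-1) (-1));
  (M 1 0 1 0 1 1 0 0 (-5), M 0 1 (-2) (-1) 1 (-2) 1 (-7) 9);
  (M 1 0 4 0 1 4 0 0 5, M 1 (-6) 7 0 (-6) 7 1 (-7) 9);
  (M 1 0 1 0 1 4 0 0 (-5), M 0 1 (-2) 0 6 (-7) 1 (-7) 9);
  (M 1 0 4 0 1 1 0 0 (-5), M 1 (-6) 7 1 (-1) 2 (-1) 7 (-9));
  (M 1 2 2 0 5 0 0 0 3, M (-6) (-1) (-2) 0 (-2) (-3) (-9) (-1) (-1));
  (M 1 3 2 0 5 0 0 0 3, M (-6) 1 1 0 2 3 (-9) (-1) (-1))];
  Table (Form 8 12 27 0 0 (-6)) (Vec 0 0 0) [:: (M 1 2 0 0 3 0 0 0 1, M (-2) 0 (-1) (-3) (-1) (-1) 0 1 1);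
  (M 1 1 0 0 (-3) 0 0 0 1, M 1 1 0 (-3) (-1) (-1) 0 (-1) (-1));
  (M 1 0 1 0 1 1 0 0 (-3), M 1 0 (-1) 0 (-1) (-1) (-3) 2 2);
  (M 1 0 2 0 1 1 0 0 (-3), M (-2) 2 1 0 1 1 3 (-2) (-2));
  (M 1 0 1 0 1 3 0 0 (-5), M 0 (-1) 1 (-1) (-4) 1 0 7 (-2));
  (M 1 0 3 0 1 4 0 0 5, M 3 4 0 3 5 (-1) 5 6 (-1));
  (M 1 0 2 0 1 4 0 0 5, M (-2) (-2) 1 (-3) (-5) 1 (-5) (-6) 1);
  (M 1 0 4 0 1 3 0 0 5, M 0 6 (-1) 1 4 (-1) 0 7 (-2));
  (M 1 0 3 0 1 7 0 0 15, M (-1) 2 (-3) (-4) 3 (-7) (-7) 6 (-16));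
  (M 1 0 2 0 3 1 0 0 (-5), M (-2) 2 (-1) 1 0 (-2) 6 (-3) 3)];
  Table (Form 8 12 27 0 0 6) (Vec 0 0 0) [:: (M 1 0 2 0 1 2 0 0 3, M (-2) 2 1 (-3) 1 1 (-3) 2 2);
  (M 1 0 1 0 1 2 0 0 (-3), M 1 0 (-1) 3 (-1) (-1) (-3) 2 2);
  (M 1 2 0 0 3 0 0 0 1, M (-2) 0 (-1) (-3) (-1) (-1) 0 (-1) (-1));
  (M 1 1 0 0 (-3) 0 0 0 1, M 1 1 0 (-3) (-1) (-1) 0 1 1);
  (M 1 0 2 0 1 1 0 0 (-5), M (-2) (-2) 1 (-2) (-1) 0 5 6 (-1));
  (M 1 0 4 0 1 2 0 0 5, M 0 6 (-1) (-1) 3 (-1) 0 7 (-2));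
  (M 1 0 1 0 1 2 0 0 (-5), M 0 (-1) 1 1 (-3) 1 0 7 (-2));
  (M 1 0 3 0 1 1 0 0 (-5), M 3 4 0 2 1 0 (-5) (-6) 1);
  (M 1 0 2 0 3 4 0 0 5, M (-2) 2 (-1) (-7) 3 (-1) (-6) 3 (-3));
  (M 1 0 3 0 1 8 0 0 15, M (-1) 2 (-3) (-3) 3 (-9) (-7) 6 (-16))];
  Table (Form 11 11 20 1 2 (-2)) (Vec 0 0 0) [:: (M 1 0 0 0 1 0 0 0 1, M 0 1 0 (-1) 0 0 0 0 (-1))]];
 Opt 6 [:: 3] 1 9 1
 [:: Locus 3 3 (Vec 2 7 2) 9 [:: 0] 1 [:: 0] 1 9 0;
  Locus 2 5 (Vec 2 4 2) 1 [:: 0] 2 [:: 0] 1 8 0]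
 [:: Table (Form 3 8 96 0 0 0) (Vec 0 0 0) [:: (M 1 0 1 0 1 1 0 0 (-3), M (-3) 0 0 (-3) (-1) 0 9 1 1);
  (M 1 0 2 0 1 2 0 0 3, M 6 1 1 6 0 1 9 1 1)];
  Table (Form 8 12 27 0 0 (-6)) (Vec 0 0 0) [:: (M 1 2 0 0 3 0 0 0 1, M (-2) 0 (-1) (-3) (-1) (-1) 0 1 1);
  (M 1 0 1 0 1 1 0 0 (-3), M 1 0 (-1) 0 (-1) (-1) (-3) 2 2)];
  Table (Form 8 12 27 0 0 6) (Vec 0 0 0) [:: (M 1 0 2 0 1 2 0 0 3, M (-2) 2 1 (-3) 1 1 (-3) 2 2);
  (M 1 2 0 0 3 0 0 0 1, M (-2) 0 (-1) (-3) (-1) (-1) 0 (-1) (-1))];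
  Table (Form 11 11 20 1 2 (-2)) (Vec 0 0 0) [:: (M 1 0 0 0 1 0 0 0 1, M 0 1 0 (-1) 0 0 0 0 (-1))]]].

Definition case_1129 := Case (Quad 1 1 2 9) [:: 4; 3] 19 [:: Form 4 26 36 0 1 (-13);
  Form 4 26 36 0 1 13;
  Form 10 12 30 4 1 3;
  Form 12 12 22 1 2 (-2);
  Form 12 14 22 5 2 3]
 [:: Opt 1 [:: 0] 3 1 2
 [:: Locus 13 1 (Vec 1 1 7) 1 [:: 0] 13 [:: 1; 2; 3; 4; 5; 6; 7; 8; 9; 10; 11; 12] 1 1 1;
  Locus 3 1 (Vec 1 2 3) 1 [:: 0] 1 [:: 0] 1 27 0;
  Locus 2 3 (Vec 2 4 1) 1 [:: 0] 1 [:: 0] 1 1 0]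
 [:: Table (Form 4 26 36 0 1 (-13)) (Vec 0 0 0) [:: (M 1 0 0 0 1 0 0 0 1, M 1 1 1 (-3) (-1) 2 4 (-3) 0)];
  Table (Form 4 26 36 0 1 13) (Vec 0 0 0) [:: (M 1 0 0 0 1 0 0 0 1, M 1 1 1 (-3) (-1) 2 1 (-4) 2)];
  Table (Form 10 12 30 4 1 3) (Vec 0 0 0) [:: (M 1 0 0 0 1 0 0 0 1, M 1 (-2) 1 (-1) 0 2 (-4) (-3) (-1))];
  Table (Form 12 12 22 1 2 (-2)) (Vec 0 0 0) [:: (M 1 0 0 0 1 0 0 0 1, M 0 1 (-2) 3 0 0 0 4 1)];
  Table (Form 12 14 22 5 2 3) (Vec 0 0 0) [:: (M 1 0 0 0 1 0 0 0 1, M 0 1 (-2) (-1) 3 0 (-4) (-1) (-1))]]].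

Definition case_1133 := Case (Quad 1 1 3 3) [:: 4; 3; 8; 16] 11 [:: Form 7 7 15 1 3 (-3)]
 [:: Opt 1 [:: 0] 1 1 1
 [:: Locus 3 1 (Vec 1 2 1) 1 [:: 0] 1 [:: 0] 1 9 0;
  Locus 2 3 (Vec 1 1 2) 1 [:: 0] 2 [:: 1] 1 2 0]
 [:: Table (Form 7 7 15 1 3 (-3)) (Vec 0 0 0) [:: (M 1 0 0 0 1 0 0 0 1, M 0 1 0 (-1) 0 0 0 0 (-1))]]].

Definition case_1134 := Case (Quad 1 1 3 4) [:: 4; 3] 13 [:: Form 2 18 32 0 1 (-9);
  Form 2 18 32 0 1 9;
  Form 8 8 18 1 3 (-3)]
 [:: Opt 1 [:: 0] 1 4 3
 [:: Locus 2 3 (Vec 1 2 2) 8 [:: 0; 1; 3; 4; 5; 7] 1 [:: 0] 1 1 2;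
  Locus 3 3 (Vec 2 3 9) 1 [:: 0] 1 [:: 0] 9 9 0]
 [:: Table (Form 2 18 32 0 1 (-9)) (Vec 4 0 2) [:: (M 1 0 1 0 1 1 0 0 (-2), M (-1) 1 1 (-2) 0 0 2 (-1) (-2));
  (M 1 1 0 0 (-2) 0 0 0 1, M 1 1 1 (-2) (-1) (-2) (-2) 0 0)];
  Table (Form 2 18 32 0 1 9) (Vec 4 0 2) [:: (M 1 1 0 0 (-2) 0 0 0 1, M (-1) 0 (-1) 2 1 2 (-2) 0 0);
  (M 1 0 1 0 1 1 0 0 (-2), M (-1) 1 1 0 1 2 2 (-1) (-2))];
  Table (Form 8 8 18 1 3 (-3)) (Vec 1 8 6) [:: (M 1 0 0 0 1 0 0 0 1, M 0 1 0 (-1) 0 0 0 0 (-1))]]].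

Definition case_1135 := Case (Quad 1 1 3 5) [:: 4; 3; 5] 15 [:: Form 1 20 80 0 0 (-10);
  Form 1 20 80 0 0 10;
  Form 4 5 76 0 2 0;
  Form 9 9 21 1 3 (-3)]
 [:: Opt 1 [:: 0] 1 3 2
 [:: Locus 3 1 (Vec 1 2 1) 3 [:: 0] 1 [:: 0] 1 9 0;
  Locus 5 1 (Vec 1 1 3) 1 [:: 0] 1 [:: 0] 1 1 1;
  Locus 2 3 (Vec 1 2 2) 1 [:: 0] 1 [:: 0] 1 2 0]
 [:: Table (Form 1 20 80 0 0 (-10)) (Vec 0 0 0) [:: (M 1 0 1 0 1 2 0 0 (-3), M (-3) 0 0 (-6) (-1) (-1) 9 1 0);
  (M 1 0 2 0 1 2 0 0 3, M (-6) (-1) (-2) (-6) (-1) (-1) (-9) (-2) (-3))];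
  Table (Form 1 20 80 0 0 10) (Vec 0 0 0) [:: (M 1 0 2 0 1 1 0 0 (-3), M (-6) (-1) (-2) (-3) (-1) (-2) 9 2 3);
  (M 1 0 1 0 1 1 0 0 (-3), M (-3) 0 0 (-3) 0 1 9 1 0)];
  Table (Form 4 5 76 0 2 0) (Vec 0 0 0) [:: (M 1 0 1 0 1 1 0 0 (-3), M (-3) 0 (-1) (-3) (-1) (-1) 9 1 2);
  (M 1 0 1 0 1 2 0 0 (-3), M (-3) 0 (-1) (-6) 0 (-1) 9 1 2)];
  Table (Form 9 9 21 1 3 (-3)) (Vec 0 0 0) [:: (M 1 0 0 0 1 0 0 0 1, M 0 1 0 (-1) 0 0 0 0 (-1))]]].

Definition case_1136 := Case (Quad 1 1 3 6) [:: 4; 3] 17 [:: Form 6 18 22 3 0 0;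
  Form 6 22 22 0 0 (-11);
  Form 6 22 22 0 0 11;
  Form 10 10 24 1 3 (-3)]
 [:: Opt 1 [:: 0] 1 9 2
 [:: Locus 3 3 (Vec 2 2 7) 9 [:: 0; 2; 5; 8] 1 [:: 0] 1 27 0;
  Locus 11 1 (Vec 1 1 6) 1 [:: 0] 11 [:: 1; 2; 3; 4; 5; 6; 7; 8; 9; 10] 1 1 1;
  Locus 2 3 (Vec 1 2 3) 1 [:: 0] 1 [:: 0] 1 1 0]
 [:: Table (Form 6 18 22 3 0 0) (Vec 0 0 0) [:: (M 1 0 1 0 1 0 0 0 (-3), M 0 (-1) (-1) (-1) (-1) 0 1 1 3);
  (M 1 0 1 0 1 1 0 0 (-3), M 0 (-1) (-1) 1 0 (-1) 1 1 3)];
  Table (Form 6 22 22 0 0 (-11)) (Vec 0 0 0) [:: (M 1 0 2 0 1 1 0 0 (-3), M 1 3 1 (-1) 1 0 (-1) (-4) (-2));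
  (M 1 1 0 0 (-3) 0 0 0 1, M (-1) 0 (-1) 4 1 2 1 (-1) 0)];
  Table (Form 6 22 22 0 0 11) (Vec 0 0 0) [:: (M 1 1 0 0 (-3) 0 0 0 1, M (-1) 0 (-1) 4 1 2 (-1) 1 0);
  (M 1 0 1 0 1 2 0 0 (-3), M 0 (-1) (-1) (-2) (-3) (-2) 1 4 2)];
  Table (Form 10 10 24 1 3 (-3)) (Vec 0 0 0) [:: (M 1 0 0 0 1 0 0 0 1, M 0 1 0 (-1) 0 0 0 0 (-1))]]].

Definition case_1137 := Case (Quad 1 1 3 7) [:: 4; 3; 8; 7] 19 [:: Form 8 11 44 4 4 2;
  Form 11 11 27 1 3 (-3)]
 [:: Opt 1 [:: 0] 1 8 5
 [:: Locus 2 7 (Vec 3 5 8) 16 [:: 0; 3; 11; 12] 2 [:: 0] 1 4 2;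
  Locus 7 1 (Vec 3 4 1) 1 [:: 0] 1 [:: 0] 1 1 2;
  Locus 3 3 (Vec 2 5 3) 1 [:: 0] 1 [:: 0] 1 9 0]
 [:: Table (Form 8 11 44 4 4 2) (Vec 0 0 0) [:: (M 1 1 0 0 (-2) 0 0 0 1, M 0 0 1 0 1 (-1) (-2) 0 0);
  (M 1 0 1 0 1 1 0 0 (-2), M 2 1 1 2 0 1 (-4) (-1) (-1));
  (M 2 0 0 0 1 0 0 0 1, M 0 1 1 0 1 0 (-2) 0 0)];
  Table (Form 11 11 27 1 3 (-3)) (Vec 0 0 0) [:: (M 1 0 0 0 1 0 0 0 1, M 0 1 0 (-1) 0 0 0 0 (-1))]]].

Definition case_1222 := Case (Quad 1 2 2 2) [:: 4; 8] 9 [:: Form 6 10 10 2 2 (-4)]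
 [:: Opt 1 [:: 0] 1 1 6
 [:: Locus 7 1 (Vec 1 1 4) 1 [:: 0] 7 [:: 1; 2; 3; 4; 5; 6] 1 1 1;
  Locus 3 1 (Vec 2 1 3) 1 [:: 0] 1 [:: 0] 1 3 0;
  Locus 2 5 (Vec 2 3 5) 1 [:: 0] 1 [:: 0] 1 1 4]
 [:: Table (Form 6 10 10 2 2 (-4)) (Vec 0 0 0) [:: (M 1 0 0 0 1 0 0 0 1, M 1 0 0 0 (-1) 0 0 0 (-1))]]].

Definition case_1223 := Case (Quad 1 2 2 3) [:: 4; 3; 8; 16] 12 [:: Form 7 12 12 2 2 (-4)]
 [:: Opt 1 [:: 0] 1 1 1
 [:: Locus 3 1 (Vec 1 2 3) 1 [:: 0] 1 [:: 0] 1 3 0;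
  Locus 2 3 (Vec 2 1 1) 1 [:: 0] 2 [:: 1] 1 2 0]
 [:: Table (Form 7 12 12 2 2 (-4)) (Vec 0 0 0) [:: (M 1 0 0 0 1 0 0 0 1, M 1 0 0 0 (-1) 0 0 0 (-1))]]].

Definition case_1224 := Case (Quad 1 2 2 4) [:: 4; 3] 14 [:: Form 2 18 36 0 0 0;
  Form 8 14 14 2 2 (-4)]
 [:: Opt 1 [:: 0] 1 4 2
 [:: Locus 2 5 (Vec 3 2 3) 8 [:: 0; 1; 3; 4; 5; 7] 1 [:: 0] 1 16 0;
  Locus 3 3 (Vec 9 2 4) 1 [:: 0] 1 [:: 0] 9 3 1]
 [:: Table (Form 2 18 36 0 0 0) (Vec 4 0 0) [:: (M 1 1 0 0 (-2) 0 0 0 1, M 0 (-1) (-1) 1 2 2 0 (-1) 1)];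
  Table (Form 8 14 14 2 2 (-4)) (Vec 1 7 7) [:: (M 1 0 0 0 1 0 0 0 1, M 1 0 0 0 (-1) 0 0 0 (-1))]]].

Definition case_1225 := Case (Quad 1 2 2 5) [:: 4; 5; 16] 16 [:: Form 1 40 60 0 0 (-20);
  Form 1 40 60 0 0 20;
  Form 9 16 16 2 2 (-4)]
 [:: Opt 1 [:: 0] 1 8 2
 [:: Locus 2 5 (Vec 3 2 3) 16 [:: 0; 2; 3; 6; 7; 10; 11; 12; 14; 15] 1 [:: 0] 1 16 0;
  Locus 5 1 (Vec 1 1 3) 1 [:: 0] 1 [:: 0] 1 1 1;
  Locus 3 1 (Vec 2 1 3) 1 [:: 0] 1 [:: 0] 1 3 0]
 [:: Table (Form 1 40 60 0 0 (-20)) (Vec 0 0 0) [:: (M 2 0 1 0 1 1 0 0 (-2), M 0 2 1 (-2) 1 0 0 (-4) (-1));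
  (M 2 1 0 0 (-2) 0 0 0 1, M (-2) (-1) 0 4 2 1 2 (-1) 0)];
  Table (Form 1 40 60 0 0 20) (Vec 0 0 0) [:: (M 2 1 0 0 (-2) 0 0 0 1, M (-2) (-1) 0 4 2 1 (-2) 1 0);
  (M 2 0 1 0 1 1 0 0 (-2), M 0 (-2) 0 (-2) (-3) (-1) 0 4 1)];
  Table (Form 9 16 16 2 2 (-4)) (Vec 0 0 0) [:: (M 1 0 0 0 1 0 0 0 1, M 1 0 0 0 (-1) 0 0 0 (-1))]]].

Definition case_1226 := Case (Quad 1 2 2 6) [:: 4; 3; 8] 19 [:: Form 2 22 66 0 0 0;
  Form 6 8 66 2 0 0;
  Form 10 18 18 2 2 (-4)]
 [:: Opt 1 [:: 0] 3 1 2
 [:: Locus 11 1 (Vec 1 1 6) 1 [:: 0] 11 [:: 1; 2; 3; 4; 5; 6; 7; 8; 9; 10] 1 1 1;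
  Locus 3 1 (Vec 1 2 3) 1 [:: 0] 1 [:: 0] 1 27 0;
  Locus 2 5 (Vec 6 2 6) 1 [:: 0] 1 [:: 0] 1 1 0]
 [:: Table (Form 2 22 66 0 0 0) (Vec 0 0 0) [:: (M 1 0 0 0 1 0 0 0 1, M 0 0 1 (-3) (-3) (-1) (-6) 3 0)];
  Table (Form 6 8 66 2 0 0) (Vec 0 0 0) [:: (M 1 0 0 0 1 0 0 0 1, M 1 (-1) 1 (-1) (-2) (-1) (-6) 0 3)];
  Table (Form 10 18 18 2 2 (-4)) (Vec 0 0 0) [:: (M 1 0 0 0 1 0 0 0 1, M 1 (-2) 0 0 0 3 4 1 0)]]].

(** The coefficients sum to 9, and a square modulo 9 fixes its root up to sign only if it is prime
    to 3. As [B] is congruent to [N] modulo 3, the option for multiples of 3 tracks the linear form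
    modulo 9. *)
Definition case_1233 := Case (Quad 1 2 3 3) [:: 4; 3] 15 [:: Form 2 14 54 1 0 0;
  Form 8 14 18 2 3 (-6)]
 [:: Opt 3 [:: 1; 2] 1 8 5
 [:: Locus 2 4 (Vec 3 1 5) 16 [:: 0; 1; 3; 5; 6; 7; 8; 9; 11; 13; 14; 15] 1 [:: 0] 1 1 4;
  Locus 3 1 (Vec 1 2 1) 1 [:: 0] 3 [:: 1; 2] 1 3 0]
 [:: Table (Form 2 14 54 1 0 0) (Vec 0 0 0) [:: (M 2 0 0 0 1 0 0 0 1, M 1 0 0 0 (-1) 0 (-1) (-1) (-2));
  (M 1 1 0 0 (-2) 0 0 0 1, M 1 1 0 (-1) (-2) 0 (-1) (-1) (-2));
  (M 1 0 1 0 2 1 0 0 (-2), M 0 (-2) 0 (-1) (-3) (-2) 1 4 0)];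
  Table (Form 8 14 18 2 3 (-6)) (Vec 0 0 0) [:: (M 1 0 0 0 1 0 0 0 1, M 1 0 0 0 (-1) 0 0 0 (-1))]];
 Opt 3 [:: 0] 1 8 8
 [:: Locus 2 4 (Vec 3 1 5) 16 [:: 0; 1; 3; 5; 6; 7; 8; 9; 11; 13; 14; 15] 1 [:: 0] 1 1 4;
  Locus 3 5 (Vec 10 10 8) 1 [:: 0] 1 [:: 0] 9 9 3]
 [:: Table (Form 2 14 54 1 0 0) (Vec 4 2 0) [:: (M 2 0 0 0 1 0 0 0 1, M 1 0 0 0 (-1) 0 (-1) (-1) (-2));
  (M 1 1 0 0 (-2) 0 0 0 1, M 1 1 0 (-1) (-2) 0 (-1) (-1) (-2));
  (M 1 0 1 0 2 1 0 0 (-2), M 0 (-2) 0 (-1) (-3) (-2) 1 4 0)];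
  Table (Form 8 14 18 2 3 (-6)) (Vec 1 7 6) [:: (M 1 0 0 0 1 0 0 0 1, M 1 0 0 0 (-1) 0 0 0 (-1))]]].

Definition case_1234 := Case (Quad 1 2 3 4) [:: 4; 3; 5] 17 [:: Form 1 20 120 0 0 0;
  Form 4 5 120 0 0 0;
  Form 9 16 21 2 3 (-6)]
 [:: Opt 1 [:: 0] 1 3 2
 [:: Locus 3 1 (Vec 2 1 1) 3 [:: 0] 1 [:: 0] 1 9 0;
  Locus 5 1 (Vec 1 1 3) 1 [:: 0] 1 [:: 0] 1 1 1;
  Locus 2 3 (Vec 1 2 2) 1 [:: 0] 1 [:: 0] 1 2 0]
 [:: Table (Form 1 20 120 0 0 0) (Vec 0 0 0) [:: (M 1 1 0 0 (-3) 0 0 0 1, M 0 0 (-1) 1 0 3 (-1) (-3) (-1));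
  (M 1 2 0 0 3 0 0 0 1, M 1 0 2 1 0 3 (-1) (-3) (-1))];
  Table (Form 4 5 120 0 0 0) (Vec 0 0 0) [:: (M 1 2 0 0 3 0 0 0 1, M (-1) 0 (-1) (-2) 0 (-1) (-1) (-3) (-1));
  (M 1 1 0 0 (-3) 0 0 0 1, M 1 0 0 (-2) 0 (-1) (-1) (-3) (-1))];
  Table (Form 9 16 21 2 3 (-6)) (Vec 0 0 0) [:: (M 1 0 0 0 1 0 0 0 1, M 1 0 0 0 (-1) 0 0 0 (-1))]]].

Definition case_1235 := Case (Quad 1 2 3 5) [:: 4; 3; 5] 20 [:: Form 2 6 330 1 0 0;
  Form 2 22 88 0 0 (-11);
  Form 2 22 88 0 0 11;
  Form 6 8 84 2 3 1;
  Form 6 18 40 3 3 (-4);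
  Form 6 18 40 3 3 7;
  Form 10 18 24 2 3 (-6)]
 [:: Opt 1 [:: 0] 2 3 8
 [:: Locus 3 1 (Vec 1 2 1) 3 [:: 0] 1 [:: 0] 1 9 0;
  Locus 11 1 (Vec 1 1 6) 1 [:: 0] 11 [:: 1; 2; 3; 4; 5; 6; 7; 8; 9; 10] 1 1 1;
  Locus 5 1 (Vec 4 1 2) 1 [:: 0] 1 [:: 0] 1 1 0;
  Locus 2 3 (Vec 2 1 3) 1 [:: 0] 1 [:: 0] 1 1 6]
 [:: Table (Form 2 6 330 1 0 0) (Vec 0 0 0) [:: (M 3 0 0 0 1 0 0 0 1, M 0 2 0 0 0 (-1) (-12) (-2) (-2));
  (M 1 2 0 0 3 0 0 0 1, M 0 2 2 0 2 3 (-12) (-2) (-2))];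
  Table (Form 2 22 88 0 0 (-11)) (Vec 0 0 0) [:: (M 1 0 1 0 1 2 0 0 (-3), M 0 2 4 (-3) 2 7 0 (-4) (-12));
  (M 1 0 2 0 1 2 0 0 3, M 0 (-2) (-8) (-3) (-3) (-8) 0 (-4) (-12))];
  Table (Form 2 22 88 0 0 11) (Vec 0 0 0) [:: (M 1 0 2 0 1 1 0 0 (-3), M (-6) 2 6 (-6) 0 2 9 (-2) (-9));
  (M 1 0 1 0 1 1 0 0 (-3), M (-3) (-1) (-4) (-6) (-2) (-4) 9 5 12)];
  Table (Form 6 8 84 2 3 1) (Vec 0 0 0) [:: (M 1 0 0 0 1 0 0 0 1, M 1 1 0 (-1) 1 0 (-1) (-1) (-4))];
  Table (Form 6 18 40 3 3 (-4)) (Vec 0 0 0) [:: (M 1 0 0 0 1 0 0 0 1, M 0 0 1 0 (-2) 0 (-4) 0 0)];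
  Table (Form 6 18 40 3 3 7) (Vec 0 0 0) [:: (M 1 0 0 0 1 0 0 0 1, M 0 0 1 0 (-2) 0 4 0 1)];
  Table (Form 10 18 24 2 3 (-6)) (Vec 0 0 0) [:: (M 1 0 0 0 1 0 0 0 1, M 1 0 (-1) 0 2 0 3 0 1)]]].

Definition case_1236 := Case (Quad 1 2 3 6) [:: 4; 3; 9] 23 [:: Form 8 11 72 4 0 0;
  Form 8 27 27 0 0 (-9);
  Form 8 27 27 0 0 9;
  Form 11 20 27 2 3 (-6)]
 [:: Opt 3 [:: 0] 1 6 1
 [:: Locus 3 3 (Vec 2 2 3) 3 [:: 0] 3 [:: 0] 1 9 0;
  Locus 2 3 (Vec 1 1 2) 1 [:: 0] 1 [:: 0] 1 2 0]
 [:: Table (Form 8 11 72 4 0 0) (Vec 0 0 0) [:: (M 1 1 0 0 (-3) 0 0 0 1, M 0 0 (-1) 1 1 2 (-2) 1 0)];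
  Table (Form 8 27 27 0 0 (-9)) (Vec 0 0 0) [:: (M 3 0 0 0 1 0 0 0 1, M 2 (-1) 0 (-1) (-1) 0 0 0 (-1))];
  Table (Form 8 27 27 0 0 9) (Vec 0 0 0) [:: (M 3 0 0 0 1 0 0 0 1, M 2 (-1) 0 (-1) (-1) 0 0 0 1)];
  Table (Form 11 20 27 2 3 (-6)) (Vec 0 0 0) [:: (M 1 0 0 0 1 0 0 0 1, M 1 0 0 0 (-1) 0 0 0 (-1))]];
 Opt 6 [:: 1; 5] 1 8 1
 [:: Locus 2 5 (Vec 2 1 5) 16 [:: 0; 3; 11; 12] 2 [:: 0] 1 8 0;
  Locus 3 1 (Vec 1 2 1) 1 [:: 0] 1 [:: 0] 1 3 0]
 [:: Table (Form 8 11 72 4 0 0) (Vec 0 0 0) [:: (M 1 0 1 0 1 1 0 0 (-2), M 0 (-2) 0 (-1) (-2) 0 1 4 1);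
  (M 1 0 1 0 1 0 0 0 (-2), M 0 (-2) 0 1 0 0 1 4 1)];
  Table (Form 8 27 27 0 0 (-9)) (Vec 0 0 0) [:: (M 1 0 1 0 1 0 0 0 (-2), M 0 1 1 (-1) (-1) 0 1 (-2) (-1));
  (M 1 1 0 0 (-2) 0 0 0 1, M 0 1 1 1 (-2) (-1) (-1) (-1) 0)];
  Table (Form 8 27 27 0 0 9) (Vec 0 0 0) [:: (M 1 0 1 0 1 0 0 0 (-2), M 1 (-1) 0 (-1) (-1) 0 (-1) 2 1);
  (M 1 1 0 0 (-2) 0 0 0 1, M 0 1 1 1 (-2) (-1) 1 1 0)];
  Table (Form 11 20 27 2 3 (-6)) (Vec 0 0 0) [:: (M 1 0 0 0 1 0 0 0 1, M 1 0 0 0 (-1) 0 0 0 (-1))]];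
 Opt 6 [:: 2; 4] 1 8 3
 [:: Locus 2 9 (Vec 16 9 4) 16 [:: 0; 3; 11; 12] 2 [:: 0] 1 4 2;
  Locus 3 1 (Vec 1 2 1) 1 [:: 0] 1 [:: 0] 1 3 0]
 [:: Table (Form 8 11 72 4 0 0) (Vec 0 0 0) [:: (M 1 0 1 0 1 1 0 0 (-2), M 0 (-2) 0 (-1) (-2) 0 1 4 1);
  (M 1 0 1 0 1 0 0 0 (-2), M 0 (-2) 0 1 0 0 1 4 1)];
  Table (Form 8 27 27 0 0 (-9)) (Vec 0 0 0) [:: (M 1 0 1 0 1 0 0 0 (-2), M 0 1 1 (-1) (-1) 0 1 (-2) (-1));
  (M 1 1 0 0 (-2) 0 0 0 1, M 0 1 1 1 (-2) (-1) (-1) (-1) 0)];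
  Table (Form 8 27 27 0 0 9) (Vec 0 0 0) [:: (M 1 0 1 0 1 0 0 0 (-2), M 1 (-1) 0 (-1) (-1) 0 (-1) 2 1);
  (M 1 1 0 0 (-2) 0 0 0 1, M 0 1 1 1 (-2) (-1) 1 1 0)];
  Table (Form 11 20 27 2 3 (-6)) (Vec 0 0 0) [:: (M 1 0 0 0 1 0 0 0 1, M 1 0 0 0 (-1) 0 0 0 (-1))]]].

Definition case_1237 := Case (Quad 1 2 3 7) [:: 4; 3; 7] 25 [:: Form 4 10 182 1 0 0;
  Form 10 16 48 2 5 1;
  Form 12 22 30 2 3 (-6);
  Form 12 22 30 2 3 7;
  Form 12 26 30 0 3 (-13);
  Form 12 26 30 0 3 13]
 [:: Opt 1 [:: 0] 1 6 4
 [:: Locus 3 1 (Vec 2 1 1) 3 [:: 0] 1 [:: 0] 1 9 0;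
  Locus 13 1 (Vec 1 1 7) 1 [:: 0] 13 [:: 1; 2; 3; 4; 5; 6; 7; 8; 9; 10; 11; 12] 1 1 1;
  Locus 7 1 (Vec 1 3 3) 1 [:: 0] 1 [:: 0] 1 1 2;
  Locus 2 3 (Vec 2 2 2) 1 [:: 0] 1 [:: 0] 1 1 0]
 [:: Table (Form 4 10 182 1 0 0) (Vec 0 0 0) [:: (M 1 0 2 0 1 2 0 0 3, M (-1) (-6) (-1) (-2) (-6) (-1) (-2) (-9) (-2));
  (M 1 0 1 0 1 1 0 0 (-3), M 1 3 1 0 3 1 (-2) (-9) (-2))];
  Table (Form 10 16 48 2 5 1) (Vec 0 0 0) [:: (M 1 1 0 0 (-2) 0 0 0 1, M 0 0 1 0 1 (-1) (-2) 0 0);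
  (M 1 0 1 0 1 1 0 0 (-2), M 2 1 1 2 0 1 (-4) (-1) (-1));
  (M 1 1 0 0 3 0 0 0 2, M 0 0 (-1) (-2) 0 (-2) 0 (-3) (-1));
  (M 1 0 2 0 1 4 0 0 6, M 2 3 0 2 6 0 4 9 1)];
  Table (Form 12 22 30 2 3 (-6)) (Vec 0 0 0) [:: (M 1 0 0 0 1 0 0 0 1, M 1 0 0 0 (-1) 0 0 0 (-1))];
  Table (Form 12 22 30 2 3 7) (Vec 0 0 0) [:: (M 1 0 0 0 3 0 0 0 1, M 1 0 0 1 3 0 0 0 (-1));
  (M 1 0 0 0 1 0 0 0 2, M 1 0 0 0 (-1) 0 1 0 2);
  (M 1 0 1 0 1 1 0 0 (-6), M 2 0 0 2 0 1 (-8) 3 (-1));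
  (M 1 1 2 0 2 2 0 0 3, M 0 3 0 0 3 (-1) (-2) 3 0)];
  Table (Form 12 26 30 0 3 (-13)) (Vec 0 0 0) [:: (M 1 0 0 0 1 1 0 0 (-3), M 1 0 0 0 0 (-1) (-1) (-3) 1);
  (M 1 0 0 0 3 0 0 0 1, M 1 0 0 1 3 2 0 0 (-1))];
  Table (Form 12 26 30 0 3 13) (Vec 0 0 0) [:: (M 1 0 0 0 3 0 0 0 1, M 1 0 0 (-1) (-3) (-2) 0 0 (-1));
  (M 1 0 0 0 1 2 0 0 3, M 1 0 0 1 3 0 1 3 (-1))]]].

Definition case_1238 := Case (Quad 1 2 3 8) [:: 4; 3; 8; 16] 28 [:: Form 5 17 112 1 0 0;
  Form 13 24 33 2 3 (-6);
  Form 17 21 33 7 1 7;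
  Form 20 20 33 8 10 4;
  Form 20 20 33 8 4 10]
 [:: Opt 1 [:: 0] 1 6 4
 [:: Locus 2 5 (Vec 2 4 4) 4 [:: 0] 1 [:: 0] 1 2 2;
  Locus 3 1 (Vec 1 2 1) 3 [:: 0] 1 [:: 0] 1 9 0;
  Locus 7 1 (Vec 1 1 4) 1 [:: 0] 1 [:: 0] 1 1 1]
 [:: Table (Form 5 17 112 1 0 0) (Vec 0 0 0) [:: (M 1 0 1 0 1 2 0 0 (-3), M (-3) 0 0 (-6) 0 (-1) 9 1 1);
  (M 1 0 2 0 1 1 0 0 (-3), M 6 1 1 3 1 0 (-9) (-1) (-1))];
  Table (Form 13 24 33 2 3 (-6)) (Vec 0 0 0) [:: (M 1 0 0 0 1 0 0 0 1, M 1 0 0 0 (-1) 0 0 0 (-1))];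
  Table (Form 17 21 33 7 1 7) (Vec 0 0 0) [:: (M 1 0 1 0 1 1 0 0 (-2), M 2 0 0 2 1 0 (-3) (-1) (-1))];
  Table (Form 20 20 33 8 10 4) (Vec 0 0 0) [:: (M 1 2 0 0 3 0 0 0 1, M 3 1 1 3 2 1 0 0 1);
  (M 1 0 2 0 1 2 0 0 3, M 3 (-1) (-1) 3 0 (-1) 3 (-1) (-2))];
  Table (Form 20 20 33 8 4 10) (Vec 0 0 0) [:: (M 1 2 0 0 3 0 0 0 1, M 3 0 1 3 (-1) 1 0 0 1);
  (M 1 0 2 0 1 2 0 0 3, M 3 0 (-1) 3 (-1) (-1) 3 (-1) (-2))]]].

Definition case_1239 := Case (Quad 1 2 3 9) [:: 4; 3; 5; 9] 30 [:: Form 14 26 36 2 3 (-6);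
  Form 20 26 26 5 5 (-1)]
 [:: Opt 3 [:: 0] 1 8 7
 [:: Locus 2 4 (Vec 2 1 8) 16 [:: 0; 2; 8; 10] 1 [:: 0] 1 1 4;
  Locus 5 1 (Vec 1 1 3) 1 [:: 0] 1 [:: 0] 1 1 2;
  Locus 3 3 (Vec 5 2 2) 1 [:: 0] 3 [:: 0] 1 27 0]
 [:: Table (Form 14 26 36 2 3 (-6)) (Vec 0 0 0) [:: (M 1 0 0 0 1 0 0 0 1, M 1 0 0 0 (-1) 0 0 0 (-1))];
  Table (Form 20 26 26 5 5 (-1)) (Vec 0 0 0) [:: (M 1 0 1 0 1 0 0 0 (-2), M 2 0 0 0 (-1) 0 (-2) 0 1);
  (M 1 1 0 0 (-2) 0 0 0 1, M 2 0 0 (-2) 0 1 0 (-1) 0);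
  (M 1 0 2 0 1 1 0 0 (-4), M 2 2 1 0 1 1 (-2) (-4) (-1))]];
 Opt 3 [:: 1; 2] 1 8 5
 [:: Locus 2 4 (Vec 2 1 8) 16 [:: 0; 2; 8; 10] 1 [:: 0] 1 1 4;
  Locus 5 3 (Vec 5 10 8) 1 [:: 0] 5 [:: 0] 1 5 0;
  Locus 3 1 (Vec 1 2 1) 1 [:: 0] 1 [:: 0] 1 3 0]
 [:: Table (Form 14 26 36 2 3 (-6)) (Vec 0 0 0) [:: (M 1 0 0 0 1 0 0 0 1, M 1 0 0 0 (-1) 0 0 0 (-1))];
  Table (Form 20 26 26 5 5 (-1)) (Vec 0 0 0) [:: (M 1 0 1 0 1 0 0 0 (-2), M 2 0 0 0 (-1) 0 (-2) 0 1);
  (M 1 1 0 0 (-2) 0 0 0 1, M 2 0 0 (-2) 0 1 0 (-1) 0);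
  (M 1 0 2 0 1 1 0 0 (-4), M 2 2 1 0 1 1 (-2) (-4) (-1))]]].

Definition case_1244 := Case (Quad 1 2 4 4) [:: 4; 8; 11] 20 [:: Form 2 44 44 0 0 0;
  Form 10 18 28 2 4 (-8)]
 [:: Opt 1 [:: 0] 1 3 3
 [:: Locus 3 1 (Vec 1 2 2) 3 [:: 0; 1] 1 [:: 0] 1 3 1;
  Locus 11 1 (Vec 1 1 6) 1 [:: 0] 11 [:: 1; 2; 3; 4; 5; 6; 7; 8; 9; 10] 1 1 1;
  Locus 2 5 (Vec 2 5 2) 1 [:: 0] 1 [:: 0] 1 8 0]
 [:: Table (Form 2 44 44 0 0 0) (Vec 0 0 0) [:: (M 1 0 2 0 1 2 0 0 3, M (-2) 1 2 (-4) 0 1 (-3) 1 3);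
  (M 1 0 1 0 1 1 0 0 (-3), M 1 0 (-1) (-1) (-1) (-2) (-3) 1 3);
  (M 1 0 2 0 1 1 0 0 (-3), M (-4) (-1) (-2) (-1) (-1) (-2) 6 2 3);
  (M 1 0 1 0 1 2 0 0 (-3), M 2 1 1 5 1 1 (-6) (-2) (-3))];
  Table (Form 10 18 28 2 4 (-8)) (Vec 0 0 0) [:: (M 1 0 0 0 1 0 0 0 1, M 1 0 0 0 (-1) 0 0 0 (-1))]]].

Definition case_1245 := Case (Quad 1 2 4 5) [:: 4; 3; 8; 5] 23 [:: Form 3 8 240 0 0 0;
  Form 8 27 27 0 0 (-3);
  Form 8 27 27 0 0 3;
  Form 11 20 32 2 4 (-8)]
 [:: Opt 3 [:: 1; 2] 1 33 1
 [:: Locus 3 1 (Vec 1 1 2) 3 [:: 2] 1 [:: 0] 1 3 0;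
  Locus 11 1 (Vec 2 5 1) 11 [:: 0; 1; 3; 4; 5; 9] 1 [:: 0] 1 11 0;
  Locus 5 1 (Vec 2 4 1) 1 [:: 0] 1 [:: 0] 1 1 0;
  Locus 2 5 (Vec 3 3 2) 1 [:: 0] 2 [:: 0] 1 8 0]
 [:: Table (Form 3 8 240 0 0 0) (Vec 0 0 0) [:: (M 1 0 1 0 1 1 0 0 (-3), M (-1) (-1) (-3) (-2) (-1) (-3) 4 4 9);
  (M 1 0 1 0 1 2 0 0 (-3), M (-1) (-1) (-3) (-2) (-3) (-6) 4 4 9);
  (M 1 0 2 0 1 2 0 0 3, M 3 3 6 2 3 6 4 4 9);
  (M 1 0 2 0 1 1 0 0 (-3), M 3 3 6 2 1 3 (-4) (-4) (-9));
  (M 1 0 7 0 1 8 0 0 11, M (-33) (-8) (-11) (-38) (-9) (-12) (-52) (-12) (-17));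
  (M 1 0 4 0 1 3 0 0 11, M 19 4 6 14 3 5 52 12 17);
  (M 1 0 7 0 1 3 0 0 11, M (-33) (-8) (-11) (-14) (-3) (-5) (-52) (-12) (-17));
  (M 1 0 4 0 1 8 0 0 11, M 19 4 6 38 9 12 52 12 17);
  (M 1 0 10 0 1 7 0 0 11, M (-25) 11 (-21) (-18) 7 (-15) (-28) 12 (-23));
  (M 1 0 1 0 1 4 0 0 (-11), M 3 (-1) 2 10 (-5) 8 (-28) 12 (-23));
  (M 1 0 10 0 1 4 0 0 11, M (-25) 11 (-21) (-10) 5 (-8) (-28) 12 (-23));
  (M 1 0 1 0 1 7 0 0 (-11), M 3 (-1) 2 18 (-7) 15 (-28) 12 (-23));
  (M 1 0 11 0 1 9 0 0 33, M (-41) 19 (-3) (-34) 15 (-3) (-124) 56 (-9));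
  (M 1 0 22 0 1 24 0 0 33, M 83 (-37) 6 90 (-41) 6 124 (-56) 9);
  (M 1 1 1 0 11 0 0 0 3, M (-1) (-2) (-3) (-2) (-7) 0 (-4) (-4) (-9));
  (M 1 10 1 0 11 0 0 0 3, M 1 5 (-3) 2 7 0 (-4) (-4) (-9))];
  Table (Form 8 27 27 0 0 (-3)) (Vec 0 0 0) [:: (M 1 0 2 0 1 0 0 0 3, M 0 (-1) (-2) (-1) (-1) 0 (-1) (-1) (-3));
  (M 1 0 1 0 1 0 0 0 (-3), M 1 0 1 1 1 0 (-1) (-1) (-3));
  (M 1 2 0 0 3 0 0 0 1, M 0 (-1) (-2) (-1) (-1) (-3) (-1) (-1) 0);
  (M 1 1 0 0 (-3) 0 0 0 1, M 1 0 1 (-1) (-1) (-3) 1 1 0);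
  (M 1 6 0 0 11 0 0 0 1, M (-8) 3 0 (-15) 5 (-1) 1 1 0);
  (M 1 0 5 0 1 0 0 0 11, M 7 (-2) 1 (-1) (-1) 0 15 (-5) 1);
  (M 1 0 6 0 1 0 0 0 11, M (-8) 3 0 1 1 0 (-15) 5 (-1));
  (M 1 5 0 0 11 0 0 0 1, M 7 (-2) 1 15 (-5) 1 (-1) (-1) 0);
  (M 1 0 8 0 1 9 0 0 11, M (-2) (-3) (-8) (-4) (-4) (-9) (-3) (-5) (-11));
  (M 1 0 4 0 1 5 0 0 11, M (-6) 1 0 (-8) 0 (-1) (-17) 1 0);
  (M 1 0 7 0 1 5 0 0 11, M 11 0 0 8 0 1 17 (-1) 0);
  (M 1 0 3 0 1 9 0 0 11, M 1 2 3 4 4 9 3 5 11);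
  (M 1 0 3 0 3 3 0 0 11, M 1 (-3) (-2) (-4) (-4) (-3) 3 (-12) (-6));
  (M 1 0 30 0 1 12 0 0 33, M (-48) (-7) (-14) (-19) (-4) (-6) (-53) (-8) (-15));
  (M 1 0 6 0 1 21 0 0 33, M (-4) 3 (-4) (-16) 8 (-15) (-23) 13 (-24));
  (M 1 0 5 0 3 8 0 0 11, M 7 2 (-1) 13 1 0 15 3 (-3))];
  Table (Form 8 27 27 0 0 3) (Vec 0 0 0) [:: (M 1 0 1 0 1 0 0 0 (-3), M 1 0 1 (-1) (-1) 0 (-1) (-1) (-3));
  (M 1 0 2 0 1 0 0 0 3, M 0 (-1) (-2) 1 1 0 (-1) (-1) (-3));
  (M 1 2 0 0 3 0 0 0 1, M 0 (-1) (-2) (-1) (-1) (-3) 1 1 0);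
  (M 1 1 0 0 (-3) 0 0 0 1, M 1 0 1 (-1) (-1) (-3) (-1) (-1) 0);
  (M 1 6 0 0 11 0 0 0 1, M (-8) 3 0 (-15) 5 (-1) (-1) (-1) 0);
  (M 1 0 6 0 1 0 0 0 11, M (-8) 3 0 (-1) (-1) 0 (-15) 5 (-1));
  (M 1 0 5 0 1 0 0 0 11, M 7 (-2) 1 1 1 0 15 (-5) 1);
  (M 1 5 0 0 11 0 0 0 1, M 7 (-2) 1 15 (-5) 1 1 1 0);
  (M 1 0 3 0 1 2 0 0 11, M 1 2 3 (-1) 1 2 3 5 11);
  (M 1 0 7 0 1 6 0 0 11, M 11 0 0 9 (-1) (-1) 17 (-1) 0);
  (M 1 0 4 0 1 6 0 0 11, M (-6) 1 0 (-9) 1 1 (-17) 1 0);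
  (M 1 0 8 0 1 2 0 0 11, M (-2) (-3) (-8) 1 (-1) (-2) (-3) (-5) (-11));
  (M 1 0 8 0 3 8 0 0 11, M (-2) 9 4 (-7) 8 3 (-3) 12 6);
  (M 1 0 3 0 1 21 0 0 33, M 5 1 1 34 4 9 53 8 15);
  (M 1 0 27 0 1 12 0 0 33, M 19 (-10) 20 7 (-5) 9 23 (-13) 24);
  (M 1 0 6 0 3 3 0 0 11, M (-8) (-1) 2 (-2) (-2) 3 (-15) (-3) 3)];
  Table (Form 11 20 32 2 4 (-8)) (Vec 0 0 0) [:: (M 1 0 0 0 1 0 0 0 1, M 1 0 0 0 (-1) 0 0 0 (-1))]];
 Opt 3 [:: 0] 1 9 1
 [:: Locus 3 3 (Vec 4 2 2) 9 [:: 0] 1 [:: 0] 1 9 0;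
  Locus 5 1 (Vec 2 4 1) 1 [:: 0] 1 [:: 0] 1 1 0;
  Locus 2 5 (Vec 3 3 2) 1 [:: 0] 2 [:: 0] 1 8 0]
 [:: Table (Form 3 8 240 0 0 0) (Vec 0 0 0) [:: (M 1 0 1 0 1 1 0 0 (-3), M (-1) (-1) (-3) (-2) (-1) (-3) 4 4 9);
  (M 1 0 2 0 1 2 0 0 3, M 3 3 6 2 3 6 4 4 9)];
  Table (Form 8 27 27 0 0 (-3)) (Vec 0 0 0) [:: (M 1 0 2 0 1 0 0 0 3, M 0 (-1) (-2) (-1) (-1) 0 (-1) (-1) (-3));
  (M 1 2 0 0 3 0 0 0 1, M 0 (-1) (-2) (-1) (-1) (-3) (-1) (-1) 0)];
  Table (Form 8 27 27 0 0 3) (Vec 0 0 0) [:: (M 1 0 1 0 1 0 0 0 (-3), M 1 0 1 (-1) (-1) 0 (-1) (-1) (-3));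
  (M 1 2 0 0 3 0 0 0 1, M 0 (-1) (-2) (-1) (-1) (-3) 1 1 0)];
  Table (Form 11 20 32 2 4 (-8)) (Vec 0 0 0) [:: (M 1 0 0 0 1 0 0 0 1, M 1 0 0 0 (-1) 0 0 0 (-1))]]].

Definition case_1246 := Case (Quad 1 2 4 6) [:: 4; 3; 13] 26 [:: Form 4 26 78 0 0 0;
  Form 10 12 78 4 0 0;
  Form 12 22 36 2 4 (-8)]
 [:: Opt 1 [:: 0] 3 1 4
 [:: Locus 13 1 (Vec 1 1 7) 1 [:: 0] 13 [:: 1; 2; 3; 4; 5; 6; 7; 8; 9; 10; 11; 12] 1 1 1;
  Locus 3 1 (Vec 1 2 3) 1 [:: 0] 1 [:: 0] 1 27 0;
  Locus 2 5 (Vec 3 4 3) 1 [:: 0] 1 [:: 0] 1 1 2]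
 [:: Table (Form 4 26 78 0 0 0) (Vec 0 0 0) [:: (M 1 0 0 0 1 0 0 0 1, M 0 0 1 (-3) (-3) (-1) (-6) 3 0)];
  Table (Form 10 12 78 4 0 0) (Vec 0 0 0) [:: (M 1 0 0 0 1 0 0 0 1, M 1 1 (-1) 2 2 1 (-6) 3 0)];
  Table (Form 12 22 36 2 4 (-8)) (Vec 0 0 0) [:: (M 1 0 0 0 1 0 0 0 1, M 1 (-2) 0 4 1 0 0 0 3)]]].

Definition case_1247 := Case (Quad 1 2 4 7) [:: 4; 7; 8; 16; 32] 29 [:: Form 5 12 196 2 0 0;
  Form 12 20 49 4 0 0;
  Form 13 24 40 2 4 (-8);
  Form 17 21 40 7 8 0]
 [:: Opt 2 [:: 1] 3 4 4
 [:: Locus 2 5 (Vec 3 3 2) 4 [:: 0; 2; 3] 1 [:: 0] 1 2 2;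
  Locus 7 1 (Vec 1 1 4) 1 [:: 0] 1 [:: 0] 1 1 1;
  Locus 3 1 (Vec 1 2 3) 1 [:: 0] 1 [:: 0] 1 27 0]
 [:: Table (Form 5 12 196 2 0 0) (Vec 0 0 0) [:: (M 1 0 0 0 1 0 0 0 1, M 1 0 1 (-2) 0 1 (-2) (-9) (-2))];
  Table (Form 12 20 49 4 0 0) (Vec 0 0 0) [:: (M 1 0 0 0 1 0 0 0 2, M 2 0 (-1) (-2) 0 (-2) (-2) (-9) (-2))];
  Table (Form 13 24 40 2 4 (-8)) (Vec 0 0 0) [:: (M 1 0 0 0 1 0 0 0 1, M 1 (-2) 0 4 1 0 0 0 3)];
  Table (Form 17 21 40 7 8 0) (Vec 0 0 0) [:: (M 1 0 0 0 1 0 0 0 1, M 3 (-1) 0 3 2 0 0 (-2) (-3))]];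
 Opt 2 [:: 0] 1 8 6
 [:: Locus 2 5 (Vec 1 2 2) 8 [:: 0] 1 [:: 0] 1 2 4;
  Locus 7 1 (Vec 1 1 4) 1 [:: 0] 1 [:: 0] 1 1 1;
  Locus 3 1 (Vec 1 2 3) 1 [:: 0] 1 [:: 0] 1 3 0]
 [:: Table (Form 5 12 196 2 0 0) (Vec 0 0 0) [:: (M 2 0 1 0 1 1 0 0 (-2), M (-4) 0 (-1) (-4) (-1) (-1) 8 1 1)];
  Table (Form 12 20 49 4 0 0) (Vec 0 0 0) [:: (M 1 0 2 0 1 2 0 0 4, M (-4) 0 0 (-4) (-1) 0 (-8) (-1) (-1))];
  Table (Form 13 24 40 2 4 (-8)) (Vec 0 0 0) [:: (M 1 0 0 0 1 0 0 0 1, M 1 0 0 0 (-1) 0 0 0 (-1))];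
  Table (Form 17 21 40 7 8 0) (Vec 0 0 0) [:: (M 1 1 0 0 (-2) 0 0 0 1, M 2 0 0 (-2) 1 0 0 0 (-1))]]].

(** The coefficients sum to 15, where the signs modulo 3 and modulo 5 are independent. The first
    option tracks the linear form modulo 15, so each form occurs with two linear forms; the second
    one takes [B] divisible by 3, which removes the sign at 3. *)
Definition case_1248 := Case (Quad 1 2 4 8) [:: 4; 3; 8; 5] 32 [:: Form 6 20 120 0 0 0;
  Form 14 26 44 2 4 (-8);
  Form 20 24 30 0 0 0]
 [:: Opt 3 [:: 1; 2] 1 8 2
 [:: Locus 2 7 (Vec 2 8 5) 16 [:: 0; 12] 1 [:: 0] 1 32 0;
  Locus 5 1 (Vec 1 1 5) 1 [:: 0] 1 [:: 0] 5 1 1;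
  Locus 3 1 (Vec 1 1 3) 1 [:: 0] 1 [:: 0] 3 3 0]
 [:: Table (Form 6 20 120 0 0 0) (Vec 3 5 0) [:: (M 2 0 1 0 1 1 0 0 (-2), M (-2) (-2) 0 (-3) (-1) 0 5 3 1)];
  Table (Form 6 20 120 0 0 0) (Vec 3 10 0) [:: (M 2 0 1 0 1 1 0 0 (-2), M (-2) (-2) 0 (-2) (-2) (-1) 5 3 1)];
  Table (Form 14 26 44 2 4 (-8)) (Vec 1 13 11) [:: (M 1 0 0 0 1 0 0 0 1, M 1 0 0 0 (-1) 0 0 0 (-1))];
  Table (Form 14 26 44 2 4 (-8)) (Vec 4 7 14) [:: (M 1 1 0 0 (-2) 0 0 0 1, M 0 0 1 1 1 (-1) (-1) 1 0)];
  Table (Form 20 24 30 0 0 0) (Vec 5 6 0) [:: (M 1 0 2 0 1 2 0 0 4, M (-2) (-2) (-1) (-3) (-1) (-1) (-5) (-3) (-1))];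
  Table (Form 20 24 30 0 0 0) (Vec 5 9 0) [:: (M 1 0 2 0 1 2 0 0 4, M (-2) (-2) (-1) (-2) (-2) 0 (-5) (-3) (-1))]];
 Opt 3 [:: 0] 1 9 4
 [:: Locus 3 3 (Vec 2 2 5) 9 [:: 0] 3 [:: 0] 1 9 0;
  Locus 5 1 (Vec 1 1 3) 5 [:: 0; 1; 4] 1 [:: 0] 1 1 1;
  Locus 2 5 (Vec 2 5 2) 1 [:: 0] 1 [:: 0] 1 1 2]
 [:: Table (Form 6 20 120 0 0 0) (Vec 0 0 0) [:: (M 1 0 1 0 1 1 0 0 (-3), M (-3) 0 0 (-3) (-1) 0 9 1 1);
  (M 1 0 2 0 1 2 0 0 3, M 6 1 1 6 0 1 9 1 1)];
  Table (Form 14 26 44 2 4 (-8)) (Vec 0 0 0) [:: (M 1 0 0 0 1 0 0 0 1, M 1 0 0 0 (-1) 0 0 0 (-1))];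
  Table (Form 20 24 30 0 0 0) (Vec 0 0 0) [:: (M 1 0 1 0 1 2 0 0 (-3), M (-1) 0 (-1) (-3) (-1) (-1) 3 2 2);
  (M 1 0 2 0 1 1 0 0 (-3), M 2 2 1 0 1 1 (-3) (-2) (-2))]]].

End Quaternaries.

(** * Bit vectors of sums of two pentagonal terms *)

Module PentagonalSieve.
Import NArith Lia List Bool MSetPositive all_boot zify.
Set Implicit Arguments. Unset Strict Implicit. Unset Printing Implicit Defensive.
Local Close Scope nat_scope.
Local Open Scope N_scope.

Lemma P5_double x : (2 * P5 x = 3 * x ^ 2 - x)%N.
Proof.
rewrite /P5 mulnC divnK // dvdn2 oddB; last by rewrite -mulnn; nia.
by rewrite oddM oddX /=; case: (odd x).
Qed.

Lemma P5S x : P5 x.+1 = (P5 x + (3 * x + 1))%N.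
Proof. by have := P5_double x; have := P5_double x.+1; rewrite -!mulnn; nia. Qed.

Definition is_pent u := exists x : nat, u = N.of_nat (P5 x).

Fixpoint pent_list (n : nat) (k p : N) : list N :=
  if n is S n' then p :: pent_list n' (k + 1) (p + 3 * k + 1) else nil.

Lemma pent_listP n u : In u (pent_list n 0 0) -> is_pent u.
Proof.
suff h k : In u (pent_list n (N.of_nat k) (N.of_nat (P5 k))) -> is_pent u by apply: (h 0%N).
elim: n k => [//|n IH] k /= [<-|]; first by exists k.
have -> : N.of_nat k + 1 = N.of_nat k.+1 by lia.
have -> : N.of_nat (P5 k) + 3 * N.of_nat k + 1 = N.of_nat (P5 k.+1) by rewrite P5S; lia.
exact: IH.
Qed.

(* A set of numbers is stored through the keys [n + 1], either as a trie or as the set of positions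
   of the nonzero bits of a number. *)
Fixpoint add_row lim u b vs t := if vs is v :: vs' then
  let w := u + b * v in
  if w <? lim then add_row lim u b vs' (PositiveSet.add (N.succ_pos w) t) else t else t.
Fixpoint pair_trie lim b us vs t := if us is u :: us' then
  if u <? lim then pair_trie lim b us' vs (add_row lim u b vs t) else t else t.

Definition in_trie n t := PositiveSet.mem (N.succ_pos n) t.

Lemma succ_pos_inj n m : N.succ_pos n = N.succ_pos m -> n = m.
Proof. by move=> e; have := N.succ_pos_spec n; have := N.succ_pos_spec m; rewrite e; lia. Qed.

Lemma in_trie_add n w t : in_trie n (PositiveSet.add (N.succ_pos w) t) -> n = w \/ in_trie n t.
Proof.
move=> /PositiveSet.mem_spec/PositiveSet.add_spec[/succ_pos_inj ->|/PositiveSet.mem_spec h]; [by left|by right].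
Qed.

Lemma add_rowP lim u b vs t n : in_trie n (add_row lim u b vs t) ->
  in_trie n t \/ exists v, In v vs /\ n = u + b * v.
Proof.
elim: vs t => [|v vs IH] t /=; first by left.
case: (_ <? _); last by left.
move=> /IH[/in_trie_add[->|h]|[v' [h ->]]]; last by right; exists v'; split=> //; right.
  by right; exists v; split=> //; left.
by left.
Qed.

Lemma pair_trieP lim b us vs t n : in_trie n (pair_trie lim b us vs t) ->
  in_trie n t \/ exists u v, In u us /\ In v vs /\ n = u + b * v.
Proof.
elim: us t => [|u us IH] t /=; first by left.
case: (_ <? _); last by left.
move=> /IH[/add_rowP[h|[v [h ->]]]|[u' [v' [h1 [h2 ->]]]]]; first by left.
  by right; exists u, v; split; [left|].
by right; exists u', v'; split; [right|].
Qed.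

(** Interleaving with zeros; merging whole vectors avoids setting their bits one at a time. *)
Fixpoint spread p := match p with
  | xH => xH | xO q => xO (xO (spread q)) | xI q => xI (xO (spread q)) end.
Fixpoint interleave a b := match a, b with
  | xH, xH => xI xH
  | xH, xO b' => xI (xO (xO (spread b')))
  | xH, xI b' => xI (xI (xO (spread b')))
  | xO a', xH => xO (xI (spread a'))
  | xO a', xO b' => xO (xO (interleave a' b'))
  | xO a', xI b' => xO (xI (interleave a' b'))
  | xI a', xH => xI (xI (spread a'))
  | xI a', xO b' => xI (xO (interleave a' b'))
  | xI a', xI b' => xI (xI (interleave a' b'))
  end.
Definition interleaveN a b := match a, b with
  | N0, N0 => N0
  | N0, Npos b => Npos (xO (spread b))
  | Npos a, N0 => Npos (spread a)
  | Npos a, Npos b => Npos (interleave a b) end.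

(** The subtries hold the keys of last digit 0 and 1, that is, the even and odd positions. Position
    0 of the right part is free, keys being positive, and takes the flag of the node, which stands
    for key 1. *)
Fixpoint to_bits (t : PositiveSet.t) : N := match t with
  | PositiveSet.Leaf => 0
  | PositiveSet.Node l b r => interleaveN (to_bits l) (if b then N.succ_double (N.div2 (to_bits r)) else to_bits r) end.

Fixpoint pbit p (i : nat) := match p, i with
  | xO q, S j => pbit q j | xI q, S j => pbit q j | xO _, O => false | xH, S _ => false | _, O => true end.
Definition bit a (i : nat) := if a is Npos p then pbit p i else false.
Lemma bitE a i : N.testbit a (N.of_nat i) = bit a i.
Proof.
case: a => [|p] //=; have e j : Pos.pred_N (Pos.of_succ_nat j) = N.of_nat j.
  by have -> : Pos.of_succ_nat j = N.succ_pos (N.of_nat j) by [case: j]; apply: N.pos_pred_succ.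
by elim: p i => [p IH|p IH|] [|i] //=; rewrite e IH.
Qed.

Lemma spread_bit p i : bit (Npos (spread p)) i = if odd i then false else bit (Npos p) i./2.
Proof. by elim: p i => [p IH|p IH|] [|[|i]] //=; rewrite negbK; first [exact: IH|case: (odd i)]. Qed.

Lemma interleave_bit a b i :
  bit (Npos (interleave a b)) i = if odd i then bit (Npos b) i./2 else bit (Npos a) i./2.
Proof.
have h q j : bit (Npos (spread q)) j = if odd j then false else bit (Npos q) j./2 := spread_bit q j.
have h' q j : bit (Npos (xO (spread q))) j = if odd j then bit (Npos q) j./2 else false.
  by case: j => [|j] //=; rewrite -[pbit _ _]/(bit (Npos (spread q)) j) h uphalf_half; case: (odd j).
have e p j : pbit p j = bit (Npos p) j by [].
elim: a b i => [a IH|a IH|] [b|b|] [|[|i]] //=; rewrite ?negbK; first [exact: IH|rewrite !e ?h; by case: (odd i)|idtac].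
all: try by case: (odd i).
all: by case: i => [|i] //=; rewrite !e ?h uphalf_half; case: (odd i).
Qed.

Lemma interleaveN_bit a b i : bit (interleaveN a b) i = if odd i then bit b i./2 else bit a i./2.
Proof.
case: a b => [|a] [|b] /=; first by case: (odd i).
- case: i => [|i] //=; rewrite -[pbit _ _]/(bit (Npos (spread b)) i) spread_bit uphalf_half.
  by case: (odd i).
- by rewrite -[pbit _ _]/(bit (Npos (spread a)) i) spread_bit; case: (odd i).
- exact: interleave_bit.
Qed.

Lemma to_bits_mem t : (forall p, bit (to_bits t) (Pos.to_nat p) = PositiveSet.mem p t) /\ bit (to_bits t) 0 = false.
Proof.
elim: t => [|l [hl l0] b r [hr r0]]; first by split.
have rb i : bit (if b then N.succ_double (N.div2 (to_bits r)) else to_bits r) i.+1 = bit (to_bits r) i.+1.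
  by case: b; case: (to_bits r) => [|[p|p|]].
have rb0 : bit (if b then N.succ_double (N.div2 (to_bits r)) else to_bits r) 0 = b.
  by case: b {rb}; rewrite ?r0 //; case: (N.div2 _).
split; last by rewrite /= interleaveN_bit.
move=> p; rewrite /= interleaveN_bit; case: p => [p|p|].
- have -> : Pos.to_nat p~1 = ((Pos.to_nat p).*2.+1)%N by lia.
  rewrite /= odd_double /= uphalf_double.
  have -> : Pos.to_nat p = ((Pos.to_nat p).-1.+1)%N by lia.
  by rewrite rb -hr; congr bit; lia.
- have -> : Pos.to_nat p~0 = ((Pos.to_nat p).*2)%N by lia.
  by rewrite odd_double doubleK hl.
- exact: rb0.
Qed.

Fixpoint bit_positions p k := match p with
  | xH => k :: nil | xO q => bit_positions q (N.succ k) | xI q => k :: bit_positions q (N.succ k) end.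
Lemma bit_positionsP p k i : bit (Npos p) i -> In (k + N.of_nat i) (bit_positions p k).
Proof.
elim: p k i => [p IH|p IH|] k [|i] //=; first by left; lia.
- by move/IH => h; right; have -> : k + N.of_nat i.+1 = N.succ k + N.of_nat i by lia.
- by move/IH => h; have -> : k + N.of_nat i.+1 = N.succ k + N.of_nat i by lia.
- by left; lia.
Qed.

(** The mask holds the numbers not yet represented; each shift treats one value of the last two
    terms for all of them at once. *)
Definition clear_shifts bits shifts U := List.fold_left (fun U s => N.ldiff U (N.shiftl bits s)) shifts U.
Lemma clear_shiftsP bits shifts U n : N.testbit U n ->
  N.testbit (clear_shifts bits shifts U) n \/ exists s, In s shifts /\ s <= n /\ N.testbit bits (n - s).
Proof.
elim: shifts U => [|s l IH] U /=; first by left.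
move=> hU; case E : (N.testbit (N.shiftl bits s) n).
  right; exists s; split; first by left.
  case: (N.le_gt_cases s n) => h; last by rewrite N.shiftl_spec_low in E.
  by split=> //; rewrite -N.shiftl_spec_high'.
have [|h|[s' [h1 h2]]] := IH (N.ldiff U (N.shiftl bits s)); first by rewrite N.ldiff_spec hU E.
  by left.
by right; exists s'; split=> //; right.
Qed.

Fixpoint find_one c us n (ok : N -> bool) := if us is u :: us' then
  if c * u <=? n then if ok (n - c * u) then true else find_one c us' n ok else false else false.
Lemma find_oneP c us n ok : find_one c us n ok -> exists u m, In u us /\ ok m /\ n = c * u + m.
Proof.
elim: us => [//|u us IH] /=; case E : (_ <=? _) => //; move/N.leb_le: E => E.
case h : (ok _); first by move=> _; exists u, (n - c * u); split; [left|split=> //; lia].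
by move=> /IH[u' [m [h1 h2]]]; exists u', m; split=> //; right.
Qed.

(** Twelve shifts thin out the mask before the survivors are searched individually. Bit [n + 1]
    stands for [n], so bit 0 is skipped. *)
Definition finite_ok t bits c d us lim exc :=
  let shifts := List.flat_map (fun u => List.map (fun v => c * u + d * v) (List.firstn 3 us)) (List.firstn 4 us) in
  match clear_shifts bits shifts (N.ones (N.succ lim)) with
  | N0 => true
  | Npos p => List.forallb (fun k => match k with N0 => true | _ =>
      let n := N.pred k in
      if List.existsb (N.eqb n) exc then true else find_one d us n (fun m => find_one c us m (fun m' => in_trie m' t)) end)
      (bit_positions p 0)
  end.

Lemma finite_okP t b c d us lim exc n : (forall m, in_trie m t -> exists u v, is_pent u /\ is_pent v /\ m = u + b * v) ->
  (forall u, In u us -> is_pent u) -> finite_ok t (to_bits t) c d us lim exc -> n < lim -> ~ In n exc ->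
  exists u1 u2 u3 u4, is_pent u1 /\ is_pent u2 /\ is_pent u3 /\ is_pent u4 /\ n = u1 + b * u2 + c * u3 + d * u4.
Proof.
move=> ht hu hf hn hexc.
set shifts := List.flat_map (fun u => List.map (fun v => c * u + d * v) (List.firstn 3 us)) (List.firstn 4 us).
have fin k (l : list N) x : In x (List.firstn k l) -> In x l.
  by move=> h; rewrite -(List.firstn_skipn k l); apply: List.in_or_app; left.
have h1 : N.testbit (N.ones (N.succ lim)) (n + 1) by apply: N.ones_spec_low; lia.
have [h|[s [hs [sn hb]]]] := clear_shiftsP (to_bits t) shifts h1.
- move: hf; rewrite /finite_ok -/shifts; move: h; case: (clear_shifts _ _ _) => [//|p].
  have En : n + 1 = N.of_nat (N.to_nat (n + 1)) by lia.
  rewrite {1}En bitE => /(bit_positionsP 0); rewrite -En N.add_0_l => hin.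
  move=> /List.forallb_forall/(_ _ hin); rewrite N.add_1_r; case E : (N.succ n) => [|q]; first by lia.
  rewrite -E N.pred_succ; case X : (List.existsb _ _).
    by move: X => /List.existsb_exists[m [hm /N.eqb_eq e]]; case: hexc; rewrite e.
  move=> /find_oneP[u4 [m [hu4 [hm ->]]]]; have [u3 [m' [hu3 [hm' ->]]]] := find_oneP hm.
  have [u1 [u2 [p1 [p2 ->]]]] := ht _ hm'.
  by exists u1, u2, u3, u4; do 4 (split; first by auto); lia.
- have En : n + 1 - s = N.of_nat (N.to_nat (n + 1 - s)) by lia.
  rewrite En bitE in hb; have [tm t0] := to_bits_mem t.
  move/List.in_flat_map: hs => [u3 [/fin h3 /List.in_map_iff[u4 [Es /fin h4]]]].
  have pos : (0 < N.to_nat (n + 1 - s))%coq_nat.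
    by case: (N.to_nat (n + 1 - s)) hb => [|k] h; [rewrite t0 in h|lia].
  have hm : in_trie (n - s) t.
    rewrite /in_trie -tm; have -> // : Pos.to_nat (N.succ_pos (n - s)) = N.to_nat (n + 1 - s).
    have := N.succ_pos_spec (n - s); lia.
  have [u1 [u2 [p1 [p2 E]]]] := ht _ hm.
  by exists u1, u2, u3, u4; do 4 (split; first by auto); lia.
Qed.

Lemma pair_trie_pents lim b n us m : us = pent_list n 0 0 ->
  in_trie m (pair_trie lim b us us PositiveSet.empty) -> exists u v, is_pent u /\ is_pent v /\ m = u + b * v.
Proof.
move=> -> /pair_trieP[|[u [v [h1 [h2 h3]]]]]; first by rewrite /in_trie; case: (N.succ_pos m).
by exists u, v; split; [exact: pent_listP h1|split=> //; exact: pent_listP h2].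
Qed.

End PentagonalSieve.

(** * The long finite ranges, block by block *)

Module FiniteRange.
Import NArith Lia List Bool MSetPositive all_boot zify PentagonalSieve.
Set Implicit Arguments. Unset Strict Implicit. Unset Printing Implicit Defensive.
Local Close Scope nat_scope.
Local Open Scope N_scope.

Definition add_shifts bits shifts := List.fold_right (fun s T => N.lor (N.shiftl bits s) T) 0 shifts.
Lemma add_shiftsP bits shifts n : N.testbit (add_shifts bits shifts) n ->
  exists s, In s shifts /\ s <= n /\ N.testbit bits (n - s).
Proof.
elim: shifts => [|s l IH] //=.
rewrite N.lor_spec => /orP[h|/IH[s' [h1 h2]]]; last by exists s'; split=> //; right.
exists s; split; first by left.
case: (N.le_gt_cases s n) => h'; last by rewrite N.shiftl_spec_low in h.
by split=> //; rewrite -N.shiftl_spec_high'.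
Qed.

(** Bit [k] of the mask stands for [d v + k] with the initial [v]. Passing to a smaller [v']
    enlarges the remainder by [d (v - v')], so [T] is shifted down by that amount. *)
Fixpoint clear_block J d T v vs U := let U' := N.ldiff U T in
  match J, vs with
  | S J', v' :: vs' => if v' <=? v then clear_block J' d (N.shiftr T (d * (v - v'))) v' vs' U' else U'
  | _, _ => U'
  end.

Lemma clear_blockP J d T v vs U n : N.testbit U n ->
  N.testbit (clear_block J d T v vs U) n \/
  exists v' m, In v' (v :: vs) /\ N.testbit T m /\ d * v + n = d * v' + m.
Proof.
elim: J T v vs U n => [|J IH] T v vs U n hU /=.
  case E : (N.testbit T n); last by left; rewrite N.ldiff_spec hU E.
  by right; exists v, n; split; [left|].
case E : (N.testbit T n); first by right; exists v, n; split; [left|].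
have hU' : N.testbit (N.ldiff U T) n by rewrite N.ldiff_spec hU E.
case: vs => [|v' vs]; first by left.
case L : (v' <=? v); last by left.
move/N.leb_le: L => L.
have [h|[w [m [hw [hm e]]]]] := IH (N.shiftr T (d * (v - v'))) v' vs _ n hU'; first by left.
rewrite N.shiftr_spec' in hm.
right; exists w, (m + d * (v - v')); split; first by right.
by split=> //; rewrite N.mul_sub_distr_l; have : d * v' <= d * v by [apply: N.mul_le_mono_l]; lia.
Qed.

Section Blocks.
Variables (t : PositiveSet.t) (b c d : N) (us : list N) (T : N) (J : nat).

Definition block_ok mask p0 rest :=
  match clear_block J d T p0 rest mask with
  | N0 => true
  | Npos p => List.forallb (fun k =>
      find_one d (p0 :: rest) (d * p0 + k) (fun m => find_one c us m (fun m' => in_trie m' t))) (bit_positions p 0)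
  end.

(* The mask of a block is [N.ones] of its length; cutting it down is cheaper than building it again. *)
Fixpoint blocks_ok lo mask rs := match rs with
  | p1 :: (p0 :: rest) as rs' =>
    if block_ok mask p0 rest then if d * p0 <=? lo then true else
      let len := d * (p1 - p0) in let len' := d * (p0 - List.hd 0 rest) in
      if len' <=? len then blocks_ok lo (N.shiftr mask (len - len')) rs' else false
    else false
  | _ => false
  end.

Definition quaternary n := exists u1 u2 u3 u4, is_pent u1 /\ is_pent u2 /\ is_pent u3 /\ is_pent u4 /\
  n = u1 + b * u2 + c * u3 + d * u4.

Hypothesis ht : forall m, in_trie m t -> exists u v, is_pent u /\ is_pent v /\ m = u + b * v.
Hypothesis hu : forall u, In u us -> is_pent u.
Hypothesis hT : forall m, N.testbit T m -> exists u v w, is_pent u /\ is_pent v /\ is_pent w /\ m = u + b * v + c * w.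

Lemma block_okP p1 p0 rest n : block_ok (N.ones (d * (p1 - p0))) p0 rest -> (forall u, In u (p0 :: rest) -> is_pent u) ->
  d * p0 <= n < d * p1 -> quaternary n.
Proof.
move=> hb hr [n0 n1].
have h1 : N.testbit (N.ones (d * (p1 - p0))) (n - d * p0).
  by apply: N.ones_spec_low; rewrite N.mul_sub_distr_l; lia.
have [h|[v [m [hv [/hT[u1 [u2 [u3 [i1 [i2 [i3 ->]]]]]] e]]]]] := clear_blockP J d T p0 rest h1; last first.
  by exists u1, u2, u3, v; do 4 (split; first by auto); lia.
move: hb; rewrite /block_ok; move: h; case: (clear_block _ _ _ _ _ _) => [//|p].
have En : n - d * p0 = N.of_nat (N.to_nat (n - d * p0)) by lia.
rewrite En bitE => /(bit_positionsP 0); rewrite -En N.add_0_l => hin.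
move=> /List.forallb_forall/(_ _ hin)/find_oneP[u4 [m [hu4 [hm e]]]].
have [u3 [m' [hu3 [hm' e']]]] := find_oneP hm.
have [u1 [u2 [p1' [p2' e'']]]] := ht hm'.
by exists u1, u2, u3, u4; do 4 (split; first by auto); lia.
Qed.

Lemma blocks_okP lo rs n : blocks_ok lo (N.ones (d * (List.nth 0 rs 0 - List.nth 1 rs 0))) rs ->
  (forall u, In u rs -> is_pent u) -> lo <= n -> n < d * List.hd 0 rs -> quaternary n.
Proof.
elim: rs => [//|p1 rs IH] + hr h1 /= h2; case: rs IH hr => [//|p0 rest] IH hr.
rewrite [blocks_ok _ _ _]/=; case E : (block_ok _ p0 rest) => // hs.
case: (N.le_gt_cases (d * p0) n) => h.
  by apply: (block_okP E) => // u hu'; apply: hr; right.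
move: hs; case L : (d * p0 <=? lo); first by move/N.leb_le: L; lia.
case: N.leb_spec => // hl hs; apply: IH => // [|u hu']; last by apply: hr; right.
move: hs; rewrite N.shiftr_div_pow2 N.ones_div_pow2; last exact: N.le_sub_l.
have -> : d * (p1 - p0) - (d * (p1 - p0) - d * (p0 - List.hd 0 rest)) = d * (p0 - List.hd 0 rest).
  by move: hl; move: (d * (p1 - p0)) (d * (p0 - _)) => A B; clear; lia.
by case: (rest).
Qed.

End Blocks.

(** [f_b] is a boolean because the second coefficient is 1 or 2, so two sets of pair sums serve all
    cases. *)
Record finite_case := Finite { f_b : bool; f_c : N; f_d : N; f_N0 : N; f_exc : list N }.

Definition finite_check us lo t bits (f : finite_case) :=
  (* Near [N0] consecutive multiples of pentagonal numbers by [d] differ by about [sqrt (6 d N0)],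
     so this list just passes [N0]. *)
  let rs := List.rev (List.filter (fun p => f_d f * p <? f_N0 f + N.sqrt (6 * f_d f * f_N0 f) + 4 * f_d f) us) in
  (* Each block tries two values of the last term, so the remainders looked up stay below twice the
     longest block. *)
  let width := 2 * f_d f * (List.nth 0 rs 0 - List.nth 1 rs 0) in
  (* The final shift by 1 undoes the offset of the keys. [T] may be incomplete: a missing sum only
     leaves more to the individual search. *)
  let T := N.shiftr (add_shifts (N.land bits (N.ones width)) (List.map (N.mul (f_c f)) (List.firstn 28 us))) 1 in
  if finite_ok t bits (f_c f) (f_d f) us (N.min lo (f_N0 f)) (f_exc f) then
    if f_N0 f <=? lo then true else if f_N0 f <=? f_d f * List.hd 0 rs then
      blocks_ok t (f_c f) (f_d f) us T 1 lo (N.ones (f_d f * (List.nth 0 rs 0 - List.nth 1 rs 0))) rs else false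
  else false.

Definition all_finite len lim lo fs := let us := pent_list len 0 0 in
  let t1 := pair_trie lim 1 us us PositiveSet.empty in let b1 := to_bits t1 in
  let t2 := pair_trie lim 2 us us PositiveSet.empty in let b2 := to_bits t2 in
  List.forallb (fun f => if f_b f then finite_check us lo t2 b2 f else finite_check us lo t1 b1 f) fs.

Lemma finite_checkP us lo t b f n : (forall u, In u us -> is_pent u) ->
  (forall m, in_trie m t -> exists u v, is_pent u /\ is_pent v /\ m = u + b * v) ->
  finite_check us lo t (to_bits t) f -> n < f_N0 f -> ~ In n (f_exc f) -> quaternary b (f_c f) (f_d f) n.
Proof.
move=> hu ht; rewrite /finite_check; case E : (finite_ok _ _ _ _ _ _ _) => // h hn hexc.
case: (N.le_gt_cases lo n) => hlo; last by apply: (finite_okP ht hu E) => //; lia.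
move: h; case: N.leb_spec => h0; first by lia.
case: N.leb_spec => // h1 hb; apply: (blocks_okP ht hu _ hb) => //; last by lia.
- move=> m; rewrite N.shiftr_spec' => /add_shiftsP[s [/List.in_map_iff[w [<- hw]] [h2 h3]]].
  move: h3; rewrite N.land_spec => /andP[h3 _].
  have hw' : In w us by rewrite -(List.firstn_skipn 28 us); apply: List.in_or_app; left.
  have En : m + 1 - f_c f * w = N.of_nat (N.to_nat (m + 1 - f_c f * w)) by lia.
  rewrite En bitE in h3; have [tm t0] := to_bits_mem t.
  have pos : (0 < N.to_nat (m + 1 - f_c f * w))%coq_nat.
    by case: (N.to_nat _) h3 => [|k] h; [rewrite t0 in h|lia].
  have hm : in_trie (m - f_c f * w) t.
    rewrite /in_trie -tm; have -> // : Pos.to_nat (N.succ_pos (m - f_c f * w)) = N.to_nat (m + 1 - f_c f * w).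
    by have := N.succ_pos_spec (m - f_c f * w); lia.
  have [u [v [p1 [p2 e]]]] := ht _ hm.
  by exists u, v, w; do 3 (split; first by auto); lia.
- by move=> u hin; have /List.filter_In[hu' _] := proj2 (List.in_rev _ u) hin; exact: hu.
Qed.

Definition second (f : finite_case) : N := if f_b f then 2 else 1.

Lemma all_finiteP len lim lo fs f n : all_finite len lim lo fs -> In f fs -> n < f_N0 f -> ~ In n (f_exc f) ->
  quaternary (second f) (f_c f) (f_d f) n.
Proof.
rewrite /all_finite => /List.forallb_forall h /h {h}; rewrite /second.
have hu u : In u (pent_list len 0 0) -> is_pent u by apply: pent_listP.
by case: (f_b f) => h; apply: (finite_checkP hu _ h) => m; apply: pair_trie_pents.
Qed.

End FiniteRange.

(** * Escalation from the critical numbers *)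

Module Escalation.
Import all_boot zify.
Set Implicit Arguments. Unset Strict Implicit. Unset Printing Implicit Defensive.

Fixpoint reps (t : seq nat) (n : nat) : Prop :=
  if t is c :: t' then exists x m, n = c * P5 x + m /\ reps t' m else n = 0.

(** The next pentagonal number is 145, so these decide every representation of a number up to 144,
    which covers all truants and exceptions that occur. *)
Definition small_pents := [:: 0; 1; 5; 12; 22; 35; 51; 70; 92; 117].

Lemma P5_small x : P5 x <= 144 -> P5 x \in small_pents.
Proof.
case: (ltnP x 10) => hx; first by do 10 (case: x hx => [|x] hx //).
have : 145 <= P5 x by rewrite /P5 leq_divRL //; nia.
by lia.
Qed.

Fixpoint omits (t : seq nat) (n : nat) : bool :=
  if t is c :: t' then all (fun p => if n < c * p then true else omits t' (n - c * p)) small_pents else n != 0.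

Lemma omits_cons c t n :
  omits (c :: t) n = all (fun p => if n < c * p then true else omits t (n - c * p)) small_pents.
Proof. by []. Qed.

Lemma omitsP t n : n <= 144 -> all (leq 1) t -> omits t n -> ~ reps t n.
Proof.
elim: t n => [|c t IH] n hn; first by move=> _ /eqP h /h.
move=> /andP[hc ht]; rewrite omits_cons => /allP h [x [m [e hr]]].
have hP : P5 x \in small_pents by apply: P5_small; nia.
have := h _ hP; case: ltnP => [|_]; first by lia.
move/(IH _ _ ht); apply; first by lia.
by have -> : n - c * P5 x = m by lia.
Qed.

(* The exceptions that remain when the coefficient [b] is added to a sum with exception set [E]. *)
Definition extend (b : nat) (E : seq nat) :=
  [seq n <- E | all (fun p => (n < b * p) || (n - b * p \in E)) small_pents].

Definition omits_exactly t (E : seq nat) := forall n, reps t n <-> n \notin E.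

Lemma extendP t b E : all (geq 144) E -> 0 < b -> omits_exactly t E -> omits_exactly (b :: t) (extend b E).
Proof.
move=> hE hb ht n; rewrite mem_filter negb_and; split.
- move=> [x [m [e /ht hm]]]; case hn : (n \in E); last by rewrite orbT.
  have n144 : n <= 144 := allP hE _ hn.
  have hP : P5 x \in small_pents by apply: P5_small; nia.
  apply/orP; left; apply/negP => /allP/(_ _ hP)/orP[|]; first by lia.
  by have -> : n - b * P5 x = m by [lia]; apply/negP.
- case hn : (n \in E); last by move=> _; exists 0, n; split; [rewrite muln0|apply/ht; rewrite hn].
  rewrite orbF => /allPn[p hp]; rewrite negb_or -leqNgt => /andP[h1 /ht h2].
  have [x e] : exists x, p = P5 x.
    by have /allP/(_ _ hp)/hasP[x _ /eqP <-] : all (fun p => has (fun x => P5 x == p) (iota 0 10)) small_pents by []; exists x.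
  by exists x, (n - b * p); split=> //; rewrite -e; lia.
Qed.

Section Selection.
Variables (k : nat) (a : 'I_k -> nat).

Lemma reps_bigP I N : uniq I ->
  reps (map a I) N <-> exists x : 'I_k -> nat, N = \sum_(i <- I) a i * P5 (x i).
Proof.
elim: I N => [|i I IH] N /=; first by split=> [->|[x]]; [exists (fun=> 0)|]; rewrite big_nil.
move=> /andP[hi hu]; split.
- move=> [x0 [m [-> /(IH _ hu)[x ->]]]]; exists (fun j => if j == i then x0 else x j).
  rewrite big_cons eqxx; congr (_ + _); apply: eq_big_seq => j hj.
  by case: eqP => // e; rewrite -e hj in hi.
- move=> [x]; rewrite big_cons => ->; exists (x i), (\sum_(j <- I) a j * P5 (x j)).
  by split=> //; apply/(IH _ hu); exists x.
Qed.

Lemma reps_represents I N : uniq I -> reps (map a I) N -> represents a N.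
Proof.
move=> hu /(reps_bigP _ hu)[x ->]; exists (fun i => if i \in I then x i else 0).
rewrite /P5a [RHS]big_uniq //= [RHS]big_mkcond /=; apply: eq_bigr => i _.
by case: (i \in I); rewrite // muln0.
Qed.

(** If all terms outside [I] vanished, the sum over [I] alone would represent [N]; so some outside
    term is positive, and its coefficient is at most [N]. *)
Lemma represents_new I N : uniq I -> represents a N -> ~ reps (map a I) N ->
  exists2 j, j \notin I & a j <= N.
Proof.
move=> hu [x hx] hn; case: (boolP [exists j, (j \notin I) && (0 < P5 (x j))]).
  move=> /existsP[j /andP[h1 h2]]; exists j => //.
  by rewrite -hx /P5a (bigD1 j) //=; nia.
rewrite negb_exists => /forallP h; case: hn; apply/(reps_bigP _ hu); exists x.
rewrite -hx /P5a [RHS]big_uniq //= [RHS]big_mkcond /=; apply: eq_bigr => i _.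
case: (boolP (i \in I)) => // hi; have := h i; rewrite hi /= -eqn0Ngt => /eqP ->; exact: muln0.
Qed.

Hypothesis a_gt0 : forall i, 0 < a i.
Hypothesis critical : forall N, N \in critical_set -> represents a N.

Fixpoint close (fuel : nat) (E : seq nat) : bool := match E, fuel with
  | [::], _ => true
  | t :: _, f.+1 => (t \in critical_set) && all (fun b => close f (extend b E)) (iota 1 t)
  | _, 0 => false end.

Lemma closeP fuel E I : close fuel E -> all (geq 144) E -> uniq I -> omits_exactly (map a I) E -> universal a.
Proof.
elim: fuel E I => [|f IH] [|t E] I //.
- by move=> _ _ hu h N; apply: (reps_represents hu); apply/h.
- by move=> _ _ hu h N; apply: (reps_represents hu); apply/h.
move=> /andP[hc /allP hall] hE hu h.
have hn : ~ reps (map a I) t by move/h; rewrite inE eqxx.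
have [j hj hjt] := represents_new hu (critical hc) hn.
have hb : a j \in iota 1 t by rewrite mem_iota a_gt0; lia.
apply: (IH _ (j :: I) (hall _ hb)).
- by apply/allP => n; rewrite mem_filter => /andP[_]; apply: (allP hE).
- by rewrite /= hj.
- exact: extendP.
Qed.

Variables (depth : nat) (leaves : seq (seq nat * seq nat)).
Hypothesis leavesP : forall t E n, (t, E) \in leaves -> n \notin E -> reps t n.

(** The default 0 is not critical, so [escalate] rejects a sum without a truant. *)
Definition truant t := head 0 [seq n <- critical_set | omits t n].

(** Sorting lets different orders of choice end in the same leaf. There the listed exceptions are
    checked to be omitted, the converse being [leavesP], so that [close] starts from an exact
    set. *)
Fixpoint escalate (fuel : nat) (t : seq nat) : bool := if fuel is f.+1 then
    [&& truant t \in critical_set, omits t (truant t) &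
        all (fun b => escalate f (sort leq (b :: t))) (iota 1 (truant t))]
  else has (fun e => if e.1 == t then [&& all (geq 144) e.2, all (omits t) e.2 & close depth e.2] else false) leaves.

Lemma escalateP fuel t I : escalate fuel t -> uniq I -> map a I = t -> universal a.
Proof.
elim: fuel t I => [|f IH] t I.
- move=> /hasP[[t' E] hin /=]; case: eqP => // e /and3P[h144 /allP ho hcl] hu ht; rewrite {}e in hin.
  apply: (closeP hcl h144 hu); rewrite ht => n; split; last exact: leavesP.
  move=> hr; apply/negP => hn; apply: (omitsP _ _ (ho _ hn) hr); first exact: (allP h144 _ hn).
  by rewrite -ht all_map; apply/allP => i _ /=; apply: a_gt0.
- move=> /and3P[]; move: (truant t) => n hc ho /allP hall hu ht.
  have hn : ~ reps (map a I) n.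
    rewrite ht; apply: omitsP ho; first by have /allP/(_ _ hc) : all (geq 144) critical_set by [].
    by rewrite -ht all_map; apply/allP => i _ /=; apply: a_gt0.
  have [j hj hjn] := represents_new hu (critical hc) hn.
  have hb : a j \in iota 1 n by rewrite mem_iota a_gt0; lia.
  apply: (IH _ (sort (relpre a leq) (j :: I)) (hall _ hb)); first by rewrite sort_uniq /= hj.
  by rewrite -sort_map /= ht.
Qed.

End Selection.

End Escalation.

(** * Joining the large and the small numbers for the 34 sums *)

Module QuaternaryPentagonal.
Import ZArith NArith Lia List Bool all_boot zify LocalConditions Quaternaries PentagonalSieve FiniteRange Escalation.
Set Implicit Arguments. Unset Strict Implicit. Unset Printing Implicit Defensive.
Local Close Scope nat_scope.
Local Open Scope N_scope.

(** The large number in each entry bounds [case_N0]: from there on the certificate gives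
    representations, below it the sieve does, apart from the listed exceptions. *)
Definition quaternaries : list (case * finite_case) := [::
  (case_1111, Finite false 1 1 882 [:: 9; 21; 31; 43; 55; 89]);
  (case_1112, Finite false 1 2 1116 [::]);
  (case_1113, Finite false 1 3 11610 [:: 19]);
  (case_1114, Finite false 1 4 6120 [:: 8]);
  (case_1122, Finite false 2 2 1350 [::]);
  (case_1123, Finite false 2 3 1584 [::]);
  (case_1124, Finite false 2 4 1818 [::]);
  (case_1125, Finite false 2 5 766080 [::]);
  (case_1126, Finite false 2 6 77436 [::]);
  (case_1127, Finite false 2 7 761400 [:: 28]);
  (case_1128, Finite false 2 8 657504 [:: 39]);
  (case_1129, Finite false 2 9 226476 [:: 18]);
  (case_1133, Finite false 3 3 15606 [:: 14]);
  (case_1134, Finite false 3 4 39285 [:: 11; 18; 81]);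
  (case_1135, Finite false 3 5 77436 [:: 19]);
  (case_1136, Finite false 3 6 191160 [::]);
  (case_1137, Finite false 3 7 2306340 [:: 14; 18]);
  (case_1222, Finite true 2 2 13608 [:: 8; 43; 67; 135]);
  (case_1223, Finite true 2 3 1818 [:: 33]);
  (case_1224, Finite true 2 4 490752 [::]);
  (case_1225, Finite true 2 5 546336 [:: 23; 33]);
  (case_1226, Finite true 2 6 191160 [::]);
  (case_1233, Finite true 3 3 276480 [:: 34; 99]);
  (case_1234, Finite true 3 4 77436 [::]);
  (case_1235, Finite true 3 5 339120 [::]);
  (case_1236, Finite true 3 6 93204 [:: 63]);
  (case_1237, Finite true 3 7 101088 [::]);
  (case_1238, Finite true 3 8 433080 [:: 31; 63]);
  (case_1239, Finite true 3 9 3187107 [:: 42]);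
  (case_1244, Finite true 4 4 339120 [:: 17]);
  (case_1245, Finite true 4 5 4957128 [:: 13]);
  (case_1246, Finite true 4 6 902016 [::]);
  (case_1247, Finite true 4 7 3880872 [::]);
  (case_1248, Finite true 4 8 3288960 [::])].

Definition matching (e : case * finite_case) :=
  let q := c_quad e.1 in let f := e.2 in
  [&& (q1 q =? 1)%Z, (q2 q =? Z.of_N (second f))%Z, (q3 q =? Z.of_N (f_c f))%Z, (q4 q =? Z.of_N (f_d f))%Z &
      (case_N0 e.1 <=? Z.of_N (f_N0 f))%Z].

Lemma quaternaries_match : List.forallb matching quaternaries.
Proof. vm_cast_no_check (erefl true). Qed.

Lemma quaternaries_case_ok : List.forallb (fun e => case_ok e.1) quaternaries.
Proof. vm_cast_no_check (erefl true). Qed.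

Lemma quaternaries_finite : all_finite 1900 60000 4000 (List.map snd quaternaries).
Proof. vm_cast_no_check (erefl true). Qed.

Definition coefficients f := [:: 1%N; N.to_nat (second f); N.to_nat (f_c f); N.to_nat (f_d f)].

Lemma quaternary_reps f n : quaternary (second f) (f_c f) (f_d f) n -> reps (coefficients f) (N.to_nat n).
Proof.
move=> [_ [_ [_ [_ [[x1 ->] [[x2 ->] [[x3 ->] [[x4 ->] ->]]]]]]]].
exists x1, (N.to_nat (second f) * P5 x2 + N.to_nat (f_c f) * P5 x3 + N.to_nat (f_d f) * P5 x4)%N; split; first by lia.
exists x2, (N.to_nat (f_c f) * P5 x3 + N.to_nat (f_d f) * P5 x4)%N; split; first by lia.
exists x3, (N.to_nat (f_d f) * P5 x4)%N; split; first by lia.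
by exists x4, 0%N; split=> //; lia.
Qed.

Lemma P5_to_nat x : (0 <= x)%Z -> (3 * (x * x) - x = 2 * Z.of_nat (P5 (Z.to_nat x)))%Z.
Proof. by move=> h; have := P5_double (Z.to_nat x); rewrite -mulnn; nia. Qed.

Lemma case_quaternary cs f n : case_ok cs -> matching (cs, f) -> f_N0 f <= n ->
  quaternary (second f) (f_c f) (f_d f) n.
Proof.
move=> hok /and5P[/Z.eqb_eq /= e1 /Z.eqb_eq e2 /Z.eqb_eq e3 /Z.eqb_eq e4 /Z.leb_le h0] hn.
have hN : (case_N0 cs <= Z.of_N n)%Z by clear hok; lia.
have [x1 [x2 [x3 [x4 [h1 [h2 [h3 [h4]]]]]]]] := case_sound hok hN.
rewrite /quad_value e1 e2 e3 e4 (P5_to_nat h1) (P5_to_nat h2) (P5_to_nat h3) (P5_to_nat h4) => e.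
exists (N.of_nat (P5 (Z.to_nat x1))), (N.of_nat (P5 (Z.to_nat x2))), (N.of_nat (P5 (Z.to_nat x3))),
  (N.of_nat (P5 (Z.to_nat x4))).
do 4 (split; first by eexists).
by clear -e; nia.
Qed.

Definition leaves : seq (seq nat * seq nat) :=
  List.map (fun e => (coefficients e.2, List.map N.to_nat (f_exc e.2))) quaternaries.

Lemma mem_In (T : eqType) (x : T) s : x \in s -> In x s.
Proof. by elim: s => [//|y s IH]; rewrite inE => /orP[/eqP ->|/IH]; [left|right]. Qed.

Lemma leavesP t E n : (t, E) \in leaves -> n \notin E -> reps t n.
Proof.
move=> /mem_In/List.in_map_iff[[cs f] [[<- <-] hin]] hn.
rewrite -[n]Nnat.Nat2N.id; apply: quaternary_reps.
case: (N.le_gt_cases (f_N0 f) (N.of_nat n)) => h.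
- apply: (@case_quaternary cs) => //.
  + exact: (proj1 (List.forallb_forall _ _) quaternaries_case_ok _ hin).
  + exact: (proj1 (List.forallb_forall _ _) quaternaries_match _ hin).
- apply: (all_finiteP quaternaries_finite) => //; first by apply/List.in_map_iff; exists (cs, f).
  move=> he; case/negP: hn; rewrite -[n]Nnat.Nat2N.id /=.
  elim: (f_exc f) he => [//|m l IH] /= [->|/IH h']; rewrite inE ?eqxx //.
  by rewrite h' orbT.
Qed.

Lemma escalate_ok : escalate 12 leaves 4 [::].
Proof. vm_cast_no_check (erefl true). Qed.

End QuaternaryPentagonal.

Theorem theorem1p1 (k : nat) (a : 'I_k -> nat) :
  1 <= k -> (forall i, 0 < a i) ->
  (universal a <-> forall N, N \in critical_set -> represents a N).
Proof.
move=> _ a_gt0; split=> [h N _|h]; first exact: h.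
exact: (@Escalation.escalateP k a a_gt0 h 12 QuaternaryPentagonal.leaves
  QuaternaryPentagonal.leavesP 4 [::] [::] QuaternaryPentagonal.escalate_ok).
Qed.
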